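(* Let $L$ be a countable metric signature, let $A$ be a separable $L$-structure, and let $\sigma_A$ be its Scott sentence (with respect to a universal weak modulus $\Omega$ for $L$). Then the following are equivalent: (i) the Scott sentence of $A$ only has separable models, i.e. every $L$-structure $B$ with $\sigma_A^B=0$ is separable; (ii) the left uniformity of the group $\operatorname{Aut}(A)$ (with the topology of pointwise convergence) is complete.
   Context: Moduli. For $n\in\mathbb N$ or $n=\mathbb N$, an $n$-ary modulus is a continuous function $\Delta:[0,\infty)^n\to[0,\infty)$ with $\Delta(0)=0$ and $\Delta(\delta)\le\Delta(\delta+\delta')\le\Delta(\delta)+\Delta(\delta')$. A weak modulus is a function $\Omega:[0,\infty)^{\mathbb N}\to[0,\infty]$ with $\Omega(0)=0$ and $\Omega(\delta)\le\Omega(\delta+\delta')\le\Omega(\delta)+\Omega(\delta')$ that is lower semicontinuous for the product topology and separately continuous in each argument; put $\Omega|_n(\delta_0,\dots,\delta_{n-1})=\Omega(\delta_0,\dots,\delta_{n-1},0,0,\dots)$. $\Omega$ is shift-increasing if for all $i_0<i_1<\cdots$ and all $\delta$, $\Omega(\delta)\le\Omega(\delta')$, where $\delta'_{i_p}=\delta_p$ and $\delta'_k=0$ for $k\notin\{i_0,i_1,\dots\}$. A map $f$ from a product of metric spaces $\prod_{i<n}X_i$ to a metric space respects $\Delta$ if $d(f(x),f(y))\le\Delta((d(x_i,y_i))_{i<n})$ for all $x,y$. Signatures and structures. A metric signature $L$ is a set of function and predicate symbols; each symbol $s$ has an arity $n_s$ and an $n_s$-ary modulus $\Delta_s$, and each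 predicate symbol $P$ also has a compact interval $I_P\subseteq\mathbb R$ (its bound). $L$ always contains a binary predicate symbol $d$ with $\Delta_d(\delta_1,\delta_2)=\delta_1+\delta_2$ and some bound. An $L$-structure $A$ is a complete metric space with maps $F^A:A^{n_F}\to A$ respecting $\Delta_F$ and functions $P^A:A^{n_P}\to I_P$ respecting $\Delta_P$, where $d$ is interpreted as the distance. $\operatorname{Aut}(A)$ is the group of bijections of $A$ preserving all symbols (including $d$). Formulas. Variables are $x_0,x_1,\dots$. $\Delta_{x_i}(\delta)=\delta_i$; $\Delta_{F(\bar\tau)}=\Delta_F\circ(\Delta_{\tau_i})_i$ for terms; an atomic formula $P(\bar\tau)$ has modulus $\Delta_P\circ(\Delta_{\tau_i})_i$ and bound $I_P$. A basic formula is $\phi=f(\phi_0,\dots,\phi_{m-1})$ with $\phi_i$ atomic and $f:\prod_i I_{\phi_i}\to\mathbb R$ continuous; its modulus is $\Delta_\phi=\Delta_f\circ(\Delta_{\phi_i})_i$, with $\Delta_f(\delta)=\sup\{|f(x)-f(y)|:|x_i-y_i|\le\delta_i\}$, and its bound is $f(\prod_i I_{\phi_i})$. A basic formula $\phi(x_0,\dots,x_{n-1})$ is a basic $n$-ary $(\Omega,[0,1])$-formula if $\Delta_\phi\le\Omega|_n$ and its bound is contained in $[0,1]$. Formulas of $\mathcal L_{\omega_1\omega}(L)$ are built from atomic formulas by continuous connectives, $\sup_x$, $\inf_x$, and countable $\bigvee,\bigwedge$ (interpreted as $\sup,\inf$) of formulas with a common modulus and bound; $\vee=\max$. $\phi^A$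 is the interpretation of $\phi$ in $A$. The seminorm of an $n$-ary formula is $\|\phi\|=\sup\{|\phi^A(\bar a)|: A\text{ an }L\text{-structure},\bar a\in A^n\}$. Universal weak modulus for $L$: a weak modulus $\Omega$ such that (1) for every atomic formula $\phi(x_0,\dots,x_{k-1})$ there is $n$ with $\Delta_\phi(\delta_0,\dots,\delta_{k-1})\le\Omega|_n(0,\dots,0,\delta_0,\dots,\delta_{k-1})$; (2) for all $k\in\mathbb N$, $M>0$ there is $n$ with $M\cdot\Omega|_k(\delta_0,\dots,\delta_{k-1})\le\Omega|_n(0,\dots,0,\delta_0,\dots,\delta_{k-1})$; (3) $\Omega|_k(\delta_0,\dots,\delta_{k-1})+\Omega|_n(\gamma_0,\dots,\gamma_{n-1})\le\Omega|_{k+n}(\delta_0,\dots,\delta_{k-1},\gamma_0,\dots,\gamma_{n-1})$ for all $k,n$; (4) $\Omega$ is shift-increasing. Scott rank. For $\bar a\in A^n,\bar b\in B^n$ define (values in $[0,\infty]$): $r_0(A\bar a,B\bar b)=\sup_\phi|\phi^A(\bar a)-\phi^B(\bar b)|$ over all basic formulas $\phi(x_0,\dots,x_{n-1})$ with $\Delta_\phi\le\Omega|_n$; $r_\alpha=\sup_{\beta<\alpha}r_\beta$ for $\alpha$ limit; $r_{\alpha+1}(A\bar a,B\bar b)=\sup_{c\in A,d\in B}\inf_{c'\in A,d'\in B}\max\bigl(r_\alpha(A\bar ac,B\bar bd'),r_\alpha(A\bar ac',B\bar bd)\bigr)$. The Scott rank $\alpha_A$ is the least $\alpha$ with $r_\alpha(A\bar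 a,A\bar b)=r_{\alpha+1}(A\bar a,A\bar b)$ for all $n$, $\bar a,\bar b\in A^n$; it is countable for separable $A$. Scott sentence. Fix a countable dense $D\subseteq A$. For $\bar a\in A^n$ let $\phi_{0,n,A\bar a}(x_0,\dots,x_{n-1})=\bigvee_\phi|\phi^A(\bar a)-\phi(x_0,\dots,x_{n-1})|$, with $\phi$ ranging over a countable $\|\cdot\|$-dense family of basic $n$-ary $(\Omega,[0,1])$-formulas; $\phi_{\alpha,n,A\bar a}=\bigvee_{\beta<\alpha}\phi_{\beta,n,A\bar a}$ for $\alpha$ limit; $\phi_{\alpha+1,n,A\bar a}=\bigl(\bigvee_{c\in D}\inf_{x_n}\phi_{\alpha,n+1,A\bar ac}\bigr)\vee\bigl(\sup_{x_n}\bigwedge_{c\in D}\phi_{\alpha,n+1,A\bar ac}\bigr)$. The Scott sentence is $$\sigma_A=\phi_{\alpha_A,0,A}\vee\bigvee_{n,\ \bar a\in D^n}\ \sup_{x_0,\dots,x_{n-1}}\tfrac12\bigl|\phi_{\alpha_A,n,A\bar a}-\phi_{\alpha_A+1,n,A\bar a}\bigr|.$$ *)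

(* Defs.v *)
From HB Require Import structures.
From mathcomp Require Import all_boot all_order all_algebra.
From mathcomp Require Import all_classical reals ereal topology normedtype.
From mathcomp Require wochoice.

Set Implicit Arguments.
Unset Strict Implicit.
Unset Printing Implicit Defensive.

Import Order.TTheory GRing.Theory Num.Theory.
Import numFieldNormedType.Exports.

Local Open Scope classical_set_scope.
Local Open Scope ring_scope.

(* Tuples of length n are functions on ['I_n]. *)

Definition tnil (T : Type) : 'I_0 -> T :=
  fun i => False_rect T (notF (leq_trans (ltn_ord i) (leq0n 0))).

Definition snoc (T : Type) (n : nat) (a : 'I_n -> T) (c : T) : 'I_n.+1 -> T :=
  fun i => if unlift ord_max i is Some j then a j else c.

Definition tcat (T : Type) (k n : nat) (a : 'I_k -> T) (b : 'I_n -> T) :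
    'I_(k + n) -> T :=
  fun i => match fintype.split i with inl j => a j | inr j => b j end.

Definition separable (T : topologicalType) : Prop :=
  exists D : set T, countable D /\ dense D.

(* [cvg F] in the library's [completeType] requires a pointed type; structures
   are allowed to be empty here. *)
Definition complete_space (T : uniformType) : Prop :=
  forall F : set_system T, ProperFilter F -> cauchy F -> exists x : T, F --> x.

Section Moduli.
Variable R : realType.

Definition nonneg_fun (I : Type) : set {ptws I -> R} :=
  [set u | forall i, 0 <= u i].

(* Moduli are functions on all of [I -> R], but only their values on
   [nonneg_fun I], i.e. [0,oo)^I, are constrained or used. *)
Record is_modulus (I : Type) (D : (I -> R) -> R) : Prop := {
  modulus_continuous :
    {within nonneg_fun (I:=I), continuous (D : {ptws I -> R} -> R)};
  modulus_ge0 : forall u, nonneg_fun u -> 0 <= D u;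
  modulus0 : D (fun=> 0) = 0;
  modulus_le : forall u v, nonneg_fun u -> nonneg_fun v ->
    D u <= D (fun i => u i + v i);
  modulus_add : forall u v, nonneg_fun u -> nonneg_fun v ->
    D (fun i => u i + v i) <= D u + D v }.

Definition update (u : nat -> R) (i : nat) (t : R) : nat -> R :=
  fun k => if k == i then t else u k.

Record is_weak_modulus (Omega : (nat -> R) -> \bar R) : Prop := {
  weak_modulus_ge0 : forall u, nonneg_fun u -> (0 <= Omega u)%E;
  weak_modulus0 : Omega (fun=> 0) = 0%E;
  weak_modulus_le : forall u v, nonneg_fun u -> nonneg_fun v ->
    (Omega u <= Omega (fun i => (u i + v i)%R))%E;
  weak_modulus_add : forall u v, nonneg_fun u -> nonneg_fun v ->
    (Omega (fun i => (u i + v i)%R) <= Omega u + Omega v)%E;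
  weak_modulus_lsc :
    lower_semicontinuous (Omega : subspace (nonneg_fun (I:=nat)) -> \bar R);
  weak_modulus_sep_continuous : forall u i, nonneg_fun u ->
    {within `[0, +oo[%classic,
      continuous (fun t : R => Omega (update u i t))} }.

Definition extend0 (n : nat) (u : 'I_n -> R) : nat -> R :=
  fun k => if insub k is Some i then u i else 0.

Definition wrestrict (Omega : (nat -> R) -> \bar R) (n : nat) (u : 'I_n -> R) :
  \bar R := Omega (extend0 u).

Definition shift_increasing (Omega : (nat -> R) -> \bar R) : Prop :=
  forall (i : nat -> nat) (u v : nat -> R),
    (forall p q : nat, (p < q)%N -> (i p < i q)%N) ->
    nonneg_fun u ->
    (forall p, v (i p) = u p) ->
    (forall k, (forall p, k <> i p) -> v k = 0) ->
    (Omega u <= Omega v)%E.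

(* A compact interval [[J.1, J.2]] is represented by its endpoints. *)
Definition box (m : nat) (J : 'I_m -> R * R) : set {ptws 'I_m -> R} :=
  [set x | forall i, (J i).1 <= x i <= (J i).2].

Definition function_modulus (m : nat) (J : 'I_m -> R * R)
    (f : ('I_m -> R) -> R) (u : 'I_m -> R) : R :=
  sup [set z | exists x y, [/\ box J x, box J y,
     forall i, `|x i - y i| <= u i & z = `|f x - f y| ] ].

(* The supremum and infimum of a subset [S] of the interval [J], computed in
   [J]: they only differ from [sup S] and [inf S] when [S] is empty. *)
Definition sup_in (J : R * R) (S : set R) : R := sup (J.1 |` S).
Definition inf_in (J : R * R) (S : set R) : R := inf (J.2 |` S).

End Moduli.

Section Signatures.
Variable R : realType.

Record signature := Signature {
  fsym : Type;
  farity : fsym -> nat;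
  fmod : forall F : fsym, ('I_(farity F) -> R) -> R;
  fmodP : forall F, is_modulus (@fmod F);
  (* predicate symbols other than d *)
  rsym : Type;
  rarity : rsym -> nat;
  rmod : forall P : rsym, ('I_(rarity P) -> R) -> R;
  rmodP : forall P, is_modulus (@rmod P);
  rbound : rsym -> R * R;
  rboundP : forall P, (rbound P).1 <= (rbound P).2;
  dbound : R * R;
  dboundP : dbound.1 <= dbound.2 }.

Definition countable_signature (L : signature) : Prop :=
  countable [set: fsym L] /\ countable [set: rsym L].

(* [None] is the distance symbol d. *)
Definition psym (L : signature) : Type := option (rsym L).

Definition parity (L : signature) (P : psym L) : nat :=
  if P is Some Q then rarity Q else 2.

Definition pmod (L : signature) (P : psym L) : ('I_(parity P) -> R) -> R :=
  match P with
  | Some Q => @rmod L Q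
  | None => fun u : 'I_2 -> R => u ord0 + u ord_max
  end.

Definition pbound (L : signature) (P : psym L) : R * R :=
  if P is Some Q then rbound Q else dbound L.

Record structure (L : signature) := Structure {
  carrier :> metricType R;
  carrier_complete : complete_space carrier;
  fint : forall F : fsym L, ('I_(farity F) -> carrier) -> carrier;
  fint_respects : forall (F : fsym L) (x y : 'I_(farity F) -> carrier),
    mdist (fint x) (fint y) <= fmod (fun i => mdist (x i) (y i));
  rint : forall P : rsym L, ('I_(rarity P) -> carrier) -> R;
  rint_bound : forall (P : rsym L) (x : 'I_(rarity P) -> carrier),
    (rbound P).1 <= rint x <= (rbound P).2;
  rint_respects : forall (P : rsym L) (x y : 'I_(rarity P) -> carrier),
    `|rint x - rint y| <= rmod (fun i => mdist (x i) (y i));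
  dint_bound : forall x y : carrier,
    (dbound L).1 <= mdist x y <= (dbound L).2 }.

Definition pint (L : signature) (A : structure L) (P : psym L) :
    ('I_(parity P) -> A) -> R :=
  match P with
  | Some Q => @rint L A Q
  | None => fun x : 'I_2 -> A => mdist (x ord0) (x ord_max)
  end.

End Signatures.

Section Aut.
Variables (R : realType) (L : signature R) (A : structure L).

Record aut := Aut {
  aut_fun :> A -> A;
  aut_bij : bijective aut_fun;
  aut_fint : forall (F : fsym L) (x : 'I_(farity F) -> A),
    aut_fun (fint x) = fint (fun i => aut_fun (x i));
  aut_pint : forall (P : psym L) (x : 'I_(parity P) -> A),
    pint (fun i => aut_fun (x i)) = pint x }.

Lemma aut_eq (g h : aut) : (forall x, g x = h x) -> g = h.
Proof.
case: g h => [g gb gf gp] [h hb hf hp] /= /funext gh.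
case: _ / gh in hb hf hp *; congr Aut; exact: Prop_irrelevance.
Qed.

Lemma aut_dist (g : aut) x y : mdist (g x) (g y) = mdist x y.
Proof.
by have := @aut_pint g None (fun i : 'I_2 => if i == ord0 then x else y).
Qed.

Definition aut1 : aut.
Proof. by exists id => //; exists id. Defined.

Definition aut_mul (g h : aut) : aut.
Proof.
exists (g \o h) => [|F x|P x]; first exact: bij_comp (aut_bij g) (aut_bij h).
- by rewrite /= !aut_fint.
- by rewrite (aut_pint g (fun i => h (x i))) aut_pint.
Defined.

Lemma aut_inv_subproof (g : aut) : exists h, cancel g h /\ cancel h g.
Proof. by case: (aut_bij g) => h; exists h. Qed.

Definition aut_inv_fun (g : aut) : A -> A := projT1 (cid (aut_inv_subproof g)).

Lemma aut_funK (g : aut) : cancel g (aut_inv_fun g).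
Proof. by rewrite /aut_inv_fun; case: cid => h []. Qed.

Lemma aut_inv_funK (g : aut) : cancel (aut_inv_fun g) g.
Proof. by rewrite /aut_inv_fun; case: cid => h []. Qed.

Definition aut_inv (g : aut) : aut.
Proof.
exists (aut_inv_fun g) => [|F x|P x].
- by exists g; [exact: aut_inv_funK|exact: aut_funK].
- apply: (can_inj (aut_funK g)); rewrite aut_inv_funK aut_fint.
  by congr fint; apply/funext => i; rewrite aut_inv_funK.
- rewrite -(aut_pint g); congr pint.
  by apply/funext => i; rewrite aut_inv_funK.
Defined.

HB.instance Definition _ := gen_eqMixin aut.
HB.instance Definition _ := gen_choiceMixin aut.

(* pointwise convergence, for the metric topology of A *)
HB.instance Definition _ := Topological.copy aut
  (initial_topology (fun g : aut => (g : {ptws A -> A}))).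

Lemma aut_cvgP (F : set_system aut) (g : aut) : Filter F ->
  F --> g <-> forall x : A, (fun h : aut => h x) @ F --> g x.
Proof.
move=> FF; pose i (h : aut) : {ptws A -> A} := h.
have -> : (F --> g) <-> {ptws, i @ F --> i g}.
  split=> [Fg|iFg V].
    move=> U iU; apply: Fg.
    exact: (@initial_continuous aut _ (i : aut -> {ptws A -> A}) g U iU).
  rewrite nbhsE => -[W [[O oO OW] Wg] WV].
  have /iFg : nbhs (i g) O.
    by apply: open_nbhs_nbhs; split=> //; move: Wg; rewrite -OW.
  by apply: (@filterS _ F _ (i @^-1` O)); rewrite OW.
exact: pointwise_cvgP.
Qed.

Lemma aut_cvg_distP (F : set_system aut) (g : aut) : Filter F ->
  F --> g <->
  forall (x : A) (e : R), 0 < e -> F [set h : aut | mdist (g x) (h x) < e].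
Proof.
move=> FF; rewrite aut_cvgP; split=> Fg x; last first.
  by apply/cvg_ballP => e e0; have := Fg x e e0; rewrite ballEmdist.
by move=> e e0; move/cvg_ballP : (Fg x) => /(_ e e0); rewrite ballEmdist.
Qed.

Lemma aut_fmap_cvgP (T : Type) (F : set_system T) (f : T -> aut) (g : aut) :
  Filter F ->
  (forall (x : A) (e : R), 0 < e -> F [set t | mdist (g x) (f t x) < e]) ->
  f @ F --> g.
Proof. by move=> FF Ff; exact/(aut_cvg_distP g
  (@fmap_filter T aut f F FF)). Qed.

Lemma aut_nearP (g : aut) (x : A) (e : R) : 0 < e ->
  nbhs g [set h : aut | mdist (g x) (h x) < e].
Proof. by move=> e0; have /aut_cvg_distP : nbhs g --> g by []; exact. Qed.

Lemma aut_mull_continuous (g : aut) : continuous (aut_mul g).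
Proof.
move=> h; apply: (aut_fmap_cvgP (nbhs_filter h)) => x e e0.
by apply: filterS (aut_nearP h x e0) => k /=; rewrite aut_dist.
Qed.

Lemma aut_inv_cvg1 : aut_inv h @[h --> aut1] --> aut1.
Proof.
apply: (aut_fmap_cvgP (nbhs_filter aut1)) => x e e0.
apply: filterS (aut_nearP aut1 x e0) => k /= kx.
by rewrite -(aut_dist k x) aut_inv_funK metric_sym.
Qed.

Lemma aut_mul_cvg1 :
  aut_mul gh.1 gh.2 @[gh --> (aut1, aut1)] --> aut1.
Proof.
apply: (aut_fmap_cvgP (nbhs_filter (aut1, aut1))) => x e e0.
have e20 : 0 < e / 2 by rewrite divr_gt0.
exists ([set g : aut | mdist x (g x) < e / 2],
        [set g : aut | mdist x (g x) < e / 2]).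
  by split; exact: (aut_nearP aut1).
move=> [g h] /= [gx hx]; apply: (le_lt_trans (metric_triangle _ (g x) _)).
by rewrite aut_dist (splitr e) ltrD.
Qed.

Lemma aut_mul1g g : aut_mul aut1 g = g. Proof. exact: aut_eq. Qed.
Lemma aut_mulg1 g : aut_mul g aut1 = g. Proof. exact: aut_eq. Qed.
Lemma aut_mulgA f g h : aut_mul f (aut_mul g h) = aut_mul (aut_mul f g) h.
Proof. exact: aut_eq. Qed.
Lemma aut_mulVg g : aut_mul (aut_inv g) g = aut1.
Proof. by apply: aut_eq => x /=; rewrite aut_funK. Qed.
Lemma aut_mulgV g : aut_mul g (aut_inv g) = aut1.
Proof. by apply: aut_eq => x /=; rewrite aut_inv_funK. Qed.
Lemma aut_invMg g h :
  aut_inv (aut_mul (aut_inv g) h) = aut_mul (aut_inv h) g.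
Proof.
apply: aut_eq => x; apply: (can_inj (aut_funK (aut_mul (aut_inv g) h))).
by rewrite aut_inv_funK /= aut_inv_funK aut_funK.
Qed.

Definition left_entourage : set_system (aut * aut) :=
  filter_from (nbhs aut1)
    (fun U => [set gh | U (aut_mul (aut_inv gh.1) gh.2)]).

Lemma left_entourage_filter : Filter left_entourage.
Proof.
apply: filter_from_filter; first by exists setT; exact: filterT.
by move=> U V nU nV; exists (U `&` V); first exact: filterI.
Qed.

Local Open Scope relation_scope.

Lemma left_entourage_diagonal E : left_entourage E -> diagonal `<=` E.
Proof.
move=> [U nU UE] [g h] /diagonalP ->; apply: UE => /=.
by rewrite aut_mulVg; exact: nbhs_singleton.
Qed.

Lemma left_entourage_inv E : left_entourage E -> left_entourage E^-1.
Proof.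
move=> [U nU UE]; exists (aut_inv @^-1` U); first exact: aut_inv_cvg1.
by move=> [g h] /=; rewrite aut_invMg => Ugh; exact: UE.
Qed.

Lemma left_entourage_split E : left_entourage E ->
  exists2 E', left_entourage E' & E' \; E' `<=` E.
Proof.
move=> [U nU UE]; have [[V W] /= [nV nW] VWU] := aut_mul_cvg1 nU.
exists [set gh | (V `&` W) (aut_mul (aut_inv gh.1) gh.2)].
  by exists (V `&` W) => //; exact: filterI.
move=> [g h] /= [k [Vgk _] [_ Wkh]]; apply: UE => /=.
have := VWU (_, _) (conj Vgk Wkh); rewrite /= -aut_mulgA.
by rewrite (aut_mulgA k) aut_mulgV aut_mul1g.
Qed.

Lemma nbhs_left_entourage : nbhs = nbhs_ left_entourage.
Proof.
apply/funext => g; apply/seteqP; split => V.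
  rewrite -{1}(aut_mulg1 g) => /aut_mull_continuous nV.
  exists [set fh | V (aut_mul g (aut_mul (aut_inv fh.1) fh.2))].
    by exists (aut_mul g @^-1` V).
  move=> h /xsectionP /=.
  by rewrite aut_mulgA aut_mulgV aut_mul1g.
move=> [E [U nU UE] EV].
move: nU; rewrite -(aut_mulVg g) => /aut_mull_continuous nV.
apply: (@filterS _ _ (nbhs_filter g) (aut_mul (aut_inv g) @^-1` U)) => //.
by move=> h Uh; apply/EV/xsectionP/UE.
Qed.

HB.instance Definition _ := Nbhs_isUniform_mixin.Build aut
  left_entourage_filter left_entourage_diagonal left_entourage_inv
  left_entourage_split nbhs_left_entourage.

End Aut.

(* [omega1] is obtained from an arbitrary well-ordering of the uncountable type
   [set nat], by keeping the points that have countably many predecessors. *)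

Section Omega1.

Local Notation T := (set nat).

Definition wle : rel T := sval (wochoice.well_ordering_principle T).
Definition wlt (x y : T) : Prop := wle x y /\ x <> y.

Lemma wlt_min (P : set T) : P !=set0 ->
  exists2 z, P z & forall x, P x -> x = z \/ wlt z x.
Proof.
move=> [x0 Px0].
have [|z [[Pz zP] _]] := svalP (wochoice.well_ordering_principle T) (mem P).
  by exists x0; rewrite inE.
exists z; first by move: Pz; rewrite inE.
move=> x Px; have [->|xz] := pselect (x = z); first by left.
by right; split; [apply: zP; rewrite inE|exact: nesym].
Qed.

Lemma wle_anti x y : wle x y -> wle y x -> x = y.
Proof.
move=> xy yx; pose wo := svalP (wochoice.well_ordering_principle T).
have wxx z : wle z z.
  have [|u [[/eqP uz uP] _]] := wo (pred1 z); first by exists z; rewrite inE.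
  by rewrite -{1}uz; apply: uP; rewrite inE.
have [|u [_ uP]] := wo (pred2 x y); first by exists x; rewrite !inE eqxx.
rewrite -(uP x) ?(uP y)//; split; rewrite ?inE ?eqxx ?orbT// => z;
  by rewrite !inE => /orP[] /eqP ->.
Qed.

Lemma wlt_total x y : [\/ wlt x y, x = y | wlt y x].
Proof.
have [|z zxy zP] := @wlt_min [set x; y]; first by exists x; left.
case: zxy => /= zE; subst z.
  by have [|->|] := zP y; [right|constructor 2|constructor 1].
by have [|->|] := zP x; [left|constructor 2|constructor 3].
Qed.

Lemma wlt_irr x : ~ wlt x x. Proof. by case. Qed.

Lemma wlt_asym x y : wlt x y -> ~ wlt y x.
Proof. by move=> [xy nxy] [yx _]; exact/nxy/wle_anti. Qed.

Lemma wlt_trans y x z : wlt x y -> wlt y z -> wlt x z.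
Proof.
move=> xy yz; have [|m mP mle] := @wlt_min [set x; y; z].
  by exists x; left; left.
case: mP => [[|]|] /= mE; subst m.
- by have [|zx|//] := mle z; [right|case: (wlt_asym xy); rewrite -zx].
- have [|xy'|yx] := mle x; first by left; left.
    by case: (@wlt_irr y); rewrite -{1}xy'.
  by case: (wlt_asym xy).
- have [|yz'|zy] := mle y; first by left; right.
    by case: (@wlt_irr z); rewrite -{1}yz'.
  by case: (wlt_asym yz).
Qed.

Definition omega1 : Type := {x : T | countable [set y | wlt y x]}.

Definition olt (v w : omega1) : Prop := wlt (sval v) (sval w).

Lemma omega1_eq (v w : omega1) : sval v = sval w -> v = w.
Proof. by case: v w => [v pv] [w pw] /= vw; exact: eq_exist. Qed.

Lemma olt_irr w : ~ olt w w. Proof. exact: wlt_irr. Qed.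

Lemma olt_trans v u w : olt u v -> olt v w -> olt u w.
Proof. exact: wlt_trans. Qed.

Lemma olt_total v w : [\/ olt v w, v = w | olt w v].
Proof.
have [vw|vw|wv] := wlt_total (sval v) (sval w).
- by constructor 1.
- by constructor 2; exact: omega1_eq.
- by constructor 3.
Qed.

Lemma olt_min (P : set omega1) : P !=set0 ->
  exists2 w, P w & forall v, P v -> v = w \/ olt w v.
Proof.
move=> [w0 Pw0]; have [|z [w Pw <-] wP] := @wlt_min (@sval _ _ @` P).
  by exists (sval w0), w0.
exists w => // v Pv; have [|vw|wv] := wP (sval v); first by exists v.
  by left; exact: omega1_eq.
by right.
Qed.

Lemma olt_wf : well_founded olt.
Proof.
move=> w; apply: contrapT => nw.
have [|v nv vP] := @olt_min [set v | ~ Acc olt v]; first by exists w.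
apply: nv; constructor => u uv; apply: contrapT => nu.
have [uE|vu] := vP u nu; first by move: uv; rewrite uE => /olt_irr.
exact: (@olt_irr u (olt_trans uv vu)).
Qed.

Lemma countable_sub (X : Type) (P : set X) :
  countable P -> countable [set: {x : X | P x}].
Proof.
move=> /countable_injP[f finj]; apply/countable_injP.
exists (f \o @sval _ _) => -[x Px] [y Py] _ _ /= fxy.
by apply: eq_exist; apply: finj => //; rewrite inE.
Qed.

Lemma countable_olt (w : omega1) : countable [set: {v : omega1 | olt v w}].
Proof.
apply: countable_sub; have /countable_injP[f finj] := svalP w.
apply/countable_injP; exists (f \o @sval _ _) => v u.
rewrite !inE => vw uw /= fvu.
by apply: omega1_eq; apply: finj => //; rewrite inE.
Qed.

Lemma uncountable_set_nat : ~ countable [set: set nat].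
Proof.
move=> /countable_injP[f finj].
pose S : set nat := [set k | exists2 X, f X = k & ~ X k].
have [SfS|nSfS] := pselect (S (f S)); last by apply: (nSfS); exists S.
have [X fXS nX] := SfS; apply: nX.
by rewrite (finj _ _ _ _ fXS) ?inE.
Qed.

Lemma omega1_uncountable : ~ countable [set: omega1].
Proof.
pose C : set T := [set x | countable [set y | wlt y x]].
move=> /countable_injP[f finj].
have cC : countable C.
  apply/countable_injP.
  exists (fun x => if pselect (C x) is left Cx then f (exist _ x Cx) else 0%N).
  move=> x y; rewrite !inE => Cx Cy.
  case: pselect => // Cx'; case: pselect => // Cy' fxy.
  by have := finj _ _ (in_setT _) (in_setT _) fxy => -[].
have [|z nCz zP] := @wlt_min (~` C).
  apply: contrapT => C0; apply: uncountable_set_nat.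
  suff -> : [set: T] = C by [].
  by apply/seteqP; split=> // x _; apply: contrapT => nCx; apply: C0; exists x.
apply: nCz; apply: sub_countable cC; apply: subset_card_le => y yz.
apply: contrapT => nCy; have [yE|zy] := zP y nCy.
  by move: yz; rewrite /= yE => /wlt_irr.
exact: (wlt_asym zy).
Qed.

Definition is_succ (v w : omega1) : Prop :=
  olt v w /\ forall u, olt u w -> ~ olt v u.

Lemma is_succ_ex (v : omega1) : exists w, is_succ v w.
Proof.
have [|w vw wP] := @olt_min [set w | olt v w].
  apply: contrapT => nv; apply: omega1_uncountable.
  have /countable_injP[f finj] := countable_olt v.
  apply/countable_injP.
  exists (fun w =>
    if pselect (olt w v) is left wv then (f (exist _ w wv)).+1 else 0%N).
  have max w : ~ olt w v -> w = v.
    by have [//|//|vw] := olt_total w v; case: nv; exists w.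
  move=> w u _ _; case: pselect => [wv|/max ->];
    case: pselect => [uv|/max ->] //.
  by move=> [] /(finj _ _ (in_setT _) (in_setT _)) [].
exists w; split=> // u uw vu; have [uE|wu] := wP u vu.
  by move: uw; rewrite uE => /olt_irr.
exact: (@olt_irr u (olt_trans uw wu)).
Qed.

Definition osucc (v : omega1) : omega1 := projT1 (cid (is_succ_ex v)).

Lemma osuccP (v : omega1) : is_succ v (osucc v).
Proof. by rewrite /osucc; case: cid. Qed.

Lemma is_succ_inj (u v w : omega1) : is_succ u w -> is_succ v w -> u = v.
Proof.
move=> [uw uP] [vw vP]; have [uv|//|vu] := olt_total u v.
  by case: (uP v vw).
by case: (vP u uw).
Qed.

Lemma ozero_ex : exists w, forall v, ~ olt v w.
Proof.
have [|w _ wP] := @olt_min [set: omega1].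
  apply: contrapT => n0; apply: omega1_uncountable.
  suff -> : [set: omega1] = set0 by exact: countable0.
  by apply/seteqP; split=> // w _; case: n0; exists w.
exists w => v vw; have [//|vE|wv] := wP v.
  by move: vw; rewrite vE => /olt_irr.
exact: (@olt_irr v (olt_trans vw wv)).
Qed.

Definition ozero : omega1 := projT1 (cid ozero_ex).

Lemma ozeroP v : ~ olt v ozero.
Proof. by rewrite /ozero; case: cid => w /= /(_ v). Qed.

Definition is_limit (w : omega1) : Prop :=
  (exists v, olt v w) /\ ~ exists v, is_succ v w.

Section Recursion.
Variables (X : Type) (z : X) (s : X -> X).
Variable l : forall w : omega1, ({v : omega1 | olt v w} -> X) -> X.

Definition transrec_step (w : omega1) (rec : forall v, olt v w -> X) : X :=
  match pselect (exists v, is_succ v w) with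
  | left vw => let: exist v vwP := cid vw in s (rec v (proj1 vwP))
  | right _ =>
    if pselect (exists v, olt v w) then
      l (fun v : {v : omega1 | olt v w} => rec (sval v) (svalP v))
    else z
  end.

Definition transrec : omega1 -> X := Fix olt_wf (fun=> X) transrec_step.

Lemma transrecE w :
  transrec w = transrec_step (fun v (_ : olt v w) => transrec v).
Proof.
rewrite /transrec Fix_eq // => {}w f g fg; congr transrec_step.
by apply: functional_extensionality_dep => v; apply/funext => vw.
Qed.

Lemma transrec0 : transrec ozero = z.
Proof.
rewrite transrecE /transrec_step; case: pselect => [h|_].
  by exfalso; case: h => v [v0 _]; exact: ozeroP v0.
by case: pselect => // h; exfalso; case: h => v; exact: ozeroP.
Qed.

Lemma transrecS v : transrec (osucc v) = s (transrec v).
Proof.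
rewrite transrecE /transrec_step; case: pselect => [h|[]]; last first.
  by exists v; exact: osuccP.
by case: (cid h) => u uP; rewrite (is_succ_inj uP (osuccP v)).
Qed.

Lemma transrec_lim w : is_limit w ->
  transrec w = l (fun v : {v : omega1 | olt v w} => transrec (sval v)).
Proof.
by move=> [w0 nw]; rewrite transrecE /transrec_step;
  case: pselect => // _; case: pselect.
Qed.

End Recursion.

End Omega1.

Section Formulas.
Variables (R : realType) (L : signature R).

Inductive term (n : nat) : Type :=
| Var of 'I_n
| App (F : fsym L) of ('I_(farity F) -> term n).

Fixpoint term_mod (n : nat) (t : term n) (u : 'I_n -> R) : R :=
  match t with
  | Var i => u i
  | App F ts => fmod (fun i => term_mod (ts i) u)
  end.

Fixpoint term_eval (A : structure L) (n : nat) (t : term n) (a : 'I_n -> A) :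
    A :=
  match t with
  | Var i => a i
  | App F ts => fint (fun i => term_eval (ts i) a)
  end.

Record atomic (n : nat) := Atomic {
  atom_sym : psym L;
  atom_args : 'I_(parity atom_sym) -> term n }.

Definition atomic_mod (n : nat) (p : atomic n) (u : 'I_n -> R) : R :=
  pmod (fun i => term_mod (atom_args (a:=p) i) u).

Definition atomic_bound (n : nat) (p : atomic n) : R * R := pbound (atom_sym p).

Definition atomic_eval (A : structure L) (n : nat) (p : atomic n)
  (a : 'I_n -> A) : R := pint (fun i => term_eval (atom_args (a:=p) i) a).

Record basic (n : nat) := Basic {
  basic_size : nat;
  basic_atom : 'I_basic_size -> atomic n;
  basic_fun : ('I_basic_size -> R) -> R;
  basic_continuous : {within box (fun i => atomic_bound (basic_atom i)),
    continuous (basic_fun : {ptws 'I_basic_size -> R} -> R)} }.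

Definition basic_box (n : nat) (p : basic n) :
    set {ptws 'I_(basic_size p) -> R} :=
  box (fun i => atomic_bound (basic_atom (b:=p) i)).

Arguments basic_box [n] p _.

Definition basic_mod (n : nat) (p : basic n) (u : 'I_n -> R) : R :=
  function_modulus (fun i => atomic_bound (basic_atom (b:=p) i))
    (@basic_fun n p) (fun i => atomic_mod (basic_atom (b:=p) i) u).

Definition basic_bound (n : nat) (p : basic n) : set R :=
  @basic_fun n p @` basic_box p.

Definition basic_eval (A : structure L) (n : nat) (p : basic n)
    (a : 'I_n -> A) : R :=
  basic_fun (fun i => atomic_eval (basic_atom (b:=p) i) a).

(* [formula n] consists of the formulas in the variables x_0, .., x_(n-1);
   [Fsup] and [Finf] bind the last variable.  The conjunctions and disjunctions
   carry the common bound of their members.  That the members of a countable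
   family respect a common modulus and lie in that bound is not enforced by the
   syntax; it holds in the Scott formulas below, for the modulus
   min(Omega|_n, 1) and the bound [0, 1]. *)
Inductive formula : nat -> Type :=
| Fbasic n : basic n -> formula n
| Fconn n m (f : ('I_m -> R) -> R) :
    continuous (f : {ptws 'I_m -> R} -> R) -> ('I_m -> formula n) -> formula n
| Fsup n : formula n.+1 -> formula n
| Finf n : formula n.+1 -> formula n
| For n (K : Type) :
    countable [set: K] -> R * R -> (K -> formula n) -> formula n
| Fand n (K : Type) :
    countable [set: K] -> R * R -> (K -> formula n) -> formula n.

Fixpoint bound (n : nat) (p : formula n) : R * R :=
  match p with
  | Fbasic _ q => (inf (basic_bound q), sup (basic_bound q))
  | Fconn _ m f _ q =>
    let S := f @` box (fun i => bound (q i)) in (inf S, sup S)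
  | Fsup _ q => bound q
  | Finf _ q => bound q
  | For _ _ _ J _ => J
  | Fand _ _ _ J _ => J
  end.

Fixpoint eval (A : structure L) (n : nat) (p : formula n) : ('I_n -> A) -> R :=
  match p with
  | Fbasic _ q => fun a => basic_eval q a
  | Fconn _ m f _ q => fun a => f (fun i => eval (q i) a)
  | Fsup _ q => fun a =>
    sup_in (bound q) (range (fun c : A => eval q (snoc a c)))
  | Finf _ q => fun a =>
    inf_in (bound q) (range (fun c : A => eval q (snoc a c)))
  | For _ K _ J q => fun a => sup_in J (range (fun i : K => eval (q i) a))
  | Fand _ K _ J q => fun a => inf_in J (range (fun i : K => eval (q i) a))
  end.

Fixpoint Fsups (n : nat) : formula n -> formula 0 :=
  match n with
  | 0 => id
  | k.+1 => fun p => Fsups (Fsup p)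
  end.

Lemma coord_continuous (m : nat) (i : 'I_m) :
  continuous ((fun x => x i) : {ptws 'I_m -> R} -> R).
Proof. exact: proj_continuous. Qed.

Definition pair2 (T : Type) (x y : T) : 'I_2 -> T :=
  fun i => if i == ord0 then x else y.

Lemma sub_continuous :
  continuous ((fun x => x ord0 - x ord_max) : {ptws 'I_2 -> R} -> R).
Proof.
move=> x; exact (@cvgB R R^o {ptws 'I_2 -> R} (nbhs x) _ _ _ _ _
  (@coord_continuous 2 ord0 x) (@coord_continuous 2 ord_max x)).
Qed.

Definition Fsub (n : nat) (p q : formula n) : formula n :=
  Fconn sub_continuous (pair2 p q).

Lemma max_continuous :
  continuous ((fun x => Num.max (x ord0) (x ord_max)) : {ptws 'I_2 -> R} -> R).
Proof.
move=> x; exact (@continuous_max R _ _ _ x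
  (@coord_continuous 2 ord0 x) (@coord_continuous 2 ord_max x)).
Qed.

Definition Fmax (n : nat) (p q : formula n) : formula n :=
  Fconn max_continuous (pair2 p q).

Lemma absdiff_continuous (c : R) :
  continuous ((fun x => `|c - x ord0|) : {ptws 'I_1 -> R} -> R).
Proof.
move=> x; exact (@cvg_norm _ _ _ (nbhs x) _ _ _
  (@cvgB R R^o {ptws 'I_1 -> R} (nbhs x) _ _ _ _ _ (cvg_cst c)
     (@coord_continuous 1 ord0 x))).
Qed.

Definition Fabsdiff (n : nat) (c : R) (p : formula n) : formula n :=
  Fconn (@absdiff_continuous c) (fun=> p).

Lemma halfdist_continuous :
  continuous ((fun x => 2^-1 * `|x ord0 - x ord_max|) : {ptws 'I_2 -> R} -> R).
Proof.
move=> x; exact (@cvgMl_tmp R {ptws 'I_2 -> R} (nbhs x) _ _ _ _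
  (@cvg_norm _ _ _ (nbhs x) _ _ _ (@sub_continuous x))).
Qed.

Definition Fhalfdist (n : nat) (p q : formula n) : formula n :=
  Fconn halfdist_continuous (pair2 p q).

Definition seminorm (n : nat) (p : formula n) : \bar R :=
  Order.max 0%E (ereal_sup [set z : \bar R |
    exists (A : structure L) (a : 'I_n -> A), z = `|eval p a|%:E]).

End Formulas.

Section Universal.
Variables (R : realType) (L : signature R).

(* The integer called n in the first two clauses is [p + k], where p is the
   number of zeros inserted. *)
Record universal_weak_modulus (Omega : (nat -> R) -> \bar R) : Prop := {
  universal_is_weak : is_weak_modulus Omega;
  universal_atomic : forall (k : nat) (q : atomic L k), exists p : nat,
    forall u : 'I_k -> R, nonneg_fun u ->
    ((atomic_mod q u)%:E <=
      wrestrict Omega (tcat (fun _ : 'I_p => 0%R) u))%E;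
  universal_scale : forall (k : nat) (M : R), 0 < M -> exists p : nat,
    forall u : 'I_k -> R, nonneg_fun u ->
    (M%:E * wrestrict Omega u <=
      wrestrict Omega (tcat (fun _ : 'I_p => 0%R) u))%E;
  universal_add : forall (k n : nat) (u : 'I_k -> R) (v : 'I_n -> R),
    nonneg_fun u -> nonneg_fun v ->
    (wrestrict Omega u + wrestrict Omega v <= wrestrict Omega (tcat u v))%E;
  universal_shift : shift_increasing Omega }.

Variable Omega : (nat -> R) -> \bar R.

Definition basic_respects (n : nat) (p : basic L n) : Prop :=
  forall u : 'I_n -> R, nonneg_fun u ->
    ((basic_mod p u)%:E <= wrestrict Omega u)%E.

(* the basic n-ary (Omega, [0, 1])-formulas *)
Definition basic01 (n : nat) : set (basic L n) :=
  [set p | basic_respects p /\ basic_bound p `<=` `[0, 1]%classic].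

Definition dense_basic01 (n : nat) (E : set (basic L n)) : Prop :=
  E `<=` basic01 (n:=n) /\
  forall p, basic01 p -> forall e : R, 0 < e ->
    exists2 q, E q & (seminorm (Fsub (Fbasic p) (Fbasic q)) < e%:E)%E.

Definition pseudodistance (A B : structure L) : Type :=
  forall n : nat, ('I_n -> A) -> ('I_n -> B) -> \bar R.

Section BackAndForth.
Variables A B : structure L.

Definition bf_zero : pseudodistance A B := fun n a b =>
  ereal_sup [set z : \bar R | exists p : basic L n,
    basic_respects p /\ z = `|basic_eval p a - basic_eval p b|%:E].

(* Suprema are taken in [[0, +oo]], whence the [max] with 0. *)
Definition bf_succ (r : pseudodistance A B) : pseudodistance A B := fun n a b =>
  Order.max 0%E (ereal_sup [set z : \bar R | exists (c : A) (d : B),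
    z = ereal_inf [set y : \bar R | exists (c' : A) (d' : B),
      y = Order.max (r n.+1 (snoc a c) (snoc b d'))
                    (r n.+1 (snoc a c') (snoc b d))]]).

Definition bf_lim (w : omega1)
    (r : {v : omega1 | olt v w} -> pseudodistance A B) :
  pseudodistance A B := fun n a b => ereal_sup (range (fun v => r v n a b)).

(* [bf w a b] is the pseudo-distance r_w(A a, B b). *)
Definition bf : omega1 -> pseudodistance A B := transrec bf_zero bf_succ bf_lim.

End BackAndForth.

Definition bf_stable (A : structure L) : set omega1 :=
  [set w | forall (n : nat) (a b : 'I_n -> A),
    bf w a b = bf (osucc w) a b].

(* The default value [ozero] is never used for a separable [A], whose Scott rank
   is countable. *)
Definition scott_rank (A : structure L) : omega1 :=
  xget ozero
    [set w | bf_stable A w /\ forall v, bf_stable A v -> ~ olt v w].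

Definition scott_family (A : structure L) : Type :=
  forall n : nat, ('I_n -> A) -> formula L n.

Section ScottSentence.
Variables (A : structure L) (D : set A) (cD : countable D).
Variables (E : forall n, set (basic L n)) (cE : forall n, countable (@E n)).

Definition scott_zero : scott_family A := fun n a =>
  For (countable_sub (cE n)) (0, 1)
    (fun p => Fabsdiff (basic_eval (sval p) a) (Fbasic (sval p))).

Definition scott_succ (phi : scott_family A) : scott_family A :=
  fun n a =>
  Fmax
    (For (countable_sub cD) (0, 1) (fun c => Finf (phi n.+1 (snoc a (sval c)))))
    (Fsup (Fand (countable_sub cD) (0, 1)
      (fun c => phi n.+1 (snoc a (sval c))))).

Definition scott_lim (w : omega1)
    (phi : {v : omega1 | olt v w} -> scott_family A) : scott_family A :=
  fun n a =>
  For (countable_olt w) (0, 1) (fun v => phi v n a).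

Definition scott_formula : omega1 -> scott_family A :=
  transrec scott_zero scott_succ scott_lim.

Lemma countable_tuples : countable [set: {n : nat & 'I_n -> {c : A | D c}}].
Proof.
have /countable_injP[f finj] := countable_sub cD.
pose g (t : {n : nat & 'I_n -> {c : A | D c}}) :
    {n : nat & {ffun 'I_n -> nat}} :=
  existT _ (projT1 t) [ffun i => f (projT2 t i)].
apply/countable_injP; exists (pickle \o g) => -[n a] [m b] _ _ /=.
move=> /(pcan_inj pickleK) /eqP; rewrite -tag_eqE /tag_eq /=.
case: eqP => //= nm; case: _ / nm b => b /=.
rewrite tagged_asE => /eqP/ffunP ab.
congr existT; apply/funext => i; have := ab i; rewrite !ffunE.
by apply: finj; rewrite inE.
Qed.

Definition scott_sentence : formula L 0 :=
  let al := scott_rank A in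
  Fmax (scott_formula al (@tnil A))
    (For countable_tuples (0, 1) (fun t =>
      let a i := sval (projT2 t i) in
      Fsups (Fhalfdist (scott_formula al a) (scott_formula (osucc al) a)))).

End ScottSentence.

End Universal.

Definition models (R : realType) (L : signature R) (B : structure L)
    (s : formula L 0) : Prop := eval s (@tnil B) = 0.

(* Main.v *)
Require Import Defs.
From HB Require Import structures.
From mathcomp Require Import all_boot all_order all_algebra.
From mathcomp Require Import all_classical reals ereal topology normedtype.
From mathcomp Require Import lra.

Set Implicit Arguments.
Unset Strict Implicit.
Unset Printing Implicit Defensive.

Import Order.TTheory GRing.Theory Num.Theory.
Import numFieldNormedType.Exports.

Local Open Scope classical_set_scope.
Local Open Scope ring_scope.

(* A left-Cauchy filter of automorphisms converges pointwise to a map [f : A -> A]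
   preserving all the structure, and its limit exists in [aut A] iff [f] is onto. So
   completeness says that every pointwise limit of automorphisms is onto.

   If some limit [f] is not onto, let omega1 copies of [A] be linked by coherent pointwise
   limits of automorphisms, all of them factoring through [f]: at each countable stage the
   direct limit of a cofinal sequence is again [A], because the sequence can be corrected by
   automorphisms so as to converge pointwise. The direct limit of the whole system is not
   separable. Since the linking maps preserve the Scott formulas, so do the inclusions of the
   copies of [A], hence the direct limit satisfies the Scott sentence.

   Conversely, a model [B] of the Scott sentence is in back-and-forth with [A]. A play in which
   every point of a countable set recurs infinitely often yields an embedding of [A] into [B]
   (by the scaling property of a universal weak modulus, late positions are compared with
   arbitrarily small error), and its range can be made to contain any given countable subset of
   [B]. If [B] is not separable, take embeddings [g0], [g1] such that the range of [g1] properly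
   contains that of [g0]. Playing [A] against itself through [B] exhibits the map
   [g1^-1 g0], which is not onto, as a pointwise limit of automorphisms. *)

(** * Metric spaces *)

(** Infima need not be attained, so a play that starts with value 0 cannot be kept at 0, only below
    a fixed threshold. The limit map is nevertheless exact, because any bound [K < 1] on
    [0,1]-valued formulas is enough once positions are late. The constants follow from this: two
    embeddings with error 1/8 give a starting position with errors below 3/8, and comparing two
    tuples of [A] through a common tuple of [B] adds two such errors, giving [K = 3/4]. The length
    omega1 serves two purposes. Each stage has only countably many predecessors, so it can be
    reached by a sequence; and every countable subset of the final limit lies in a single copy of
    [A]. Hence the limit is complete without taking a completion, and no countable set is dense in
    it. The Scott rank is defined through pseudo-distances with values in [0, +oo], while the
    sentence only sees formulas with values in [0, 1]. Stability passes from one to the other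
    because the Scott formulas compute the pseudo-distance truncated at 1. *)

Section MetricSequences.
Variable R : realType.
Implicit Types T U : metricType R.

Definition seq_cvg T (u : nat -> T) (x : T) : Prop :=
  forall e : R, 0 < e -> \forall n \near \oo, mdist (u n) x < e.

Definition seq_cauchy T (u : nat -> T) : Prop :=
  forall e : R, 0 < e ->
    exists N, forall i j, (N <= i)%N -> (N <= j)%N -> mdist (u i) (u j) < e.

Lemma mdist_ler_eq T (x y : T) : (forall e : R, 0 < e -> mdist x y <= e) -> x = y.
Proof.
move=> xy; apply: mdist_positivity; apply/eqP; rewrite eq_le mdist_ge0 andbT.
by apply/ler_addgt0Pr => e e0; rewrite add0r; exact: xy.
Qed.

Lemma mdist_lipschitz T (x x' y y' : T) :
  `|mdist x y - mdist x' y'| <= mdist x x' + mdist y y'.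
Proof.
have h1 := metric_triangle x x' y; have h2 := metric_triangle x' y' y.
have h3 := metric_triangle x' x y'; have h4 := metric_triangle x y y'.
move: h1 h2 h3 h4; rewrite (metric_sym x' x) (metric_sym y' y) => *.
by rewrite ler_norml; apply/andP; split; lra.
Qed.

Lemma seq_cvg_uniq T (u : nat -> T) x y : seq_cvg u x -> seq_cvg u y -> x = y.
Proof.
move=> ux uy; apply: mdist_ler_eq => e e0.
have e2 : 0 < e / 2 by rewrite divr_gt0.
have [n [xn yn]] := filter_ex (filterI (ux _ e2) (uy _ e2)).
have := metric_triangle x (u n) y; move: xn yn => /=.
by rewrite (metric_sym (u n) x); lra.
Qed.

Lemma seq_cvg_shift T (u : nat -> T) x : seq_cvg u x -> seq_cvg (fun n => u n.+1) x.
Proof.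
move=> ux e e0; have [N _ uN] := ux e e0.
by exists N => // n /= Nn; apply: uN => /=; exact: leqW.
Qed.

Lemma seq_cvg_cauchy T (u : nat -> T) x : seq_cvg u x -> seq_cauchy u.
Proof.
move=> ux e e0; have e2 : 0 < e / 2 by rewrite divr_gt0.
have [N _ uN] := ux _ e2; exists N => i j Ni Nj.
have := metric_triangle (u i) x (u j); have := uN _ Ni; have := uN _ Nj.
by rewrite /= (metric_sym (u j) x); lra.
Qed.

Lemma complete_seq_cvg T (u : nat -> T) :
  complete_space T -> seq_cauchy u -> exists x, seq_cvg u x.
Proof.
move=> cT cu; have [|x ux] := cT (u @ \oo) _ _.
  apply/cauchy_ballP => e e0; have [N uN] := cu e e0.
  exists ([set y | exists2 n, (N <= n)%N & y = u n],
    [set y | exists2 n, (N <= n)%N & y = u n]) => /=.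
    by split; exists N => // n /= Nn; exists n.
  by move=> [_ _] /= [[i Ni ->] [j Nj ->]]; rewrite ballEmdist /=; exact: uN.
exists x => e e0; have xe : \forall n \near \oo, ball x e (u n).
  exact: ux _ (@nbhsx_ballx _ _ x e e0).
by apply: filterS xe => n; rewrite ballEmdist /= metric_sym.
Qed.

Lemma invS_lt (e : R) : 0 < e -> exists N, forall n, (N <= n)%N -> n.+1%:R^-1 < e.
Proof.
move=> e0; exists (Num.bound e^-1) => n Nn.
rewrite -(invrK e) ltf_pV2 ?posrE ?invr_gt0//.
have := archi_boundP (ltW (_ : 0 < e^-1)); rewrite invr_gt0 => /(_ e0) /lt_le_trans.
by apply; rewrite ler_nat; exact: leqW.
Qed.

(** Countably many members of the filter, of diameter below 1/(n+1), determine its limit: points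
    chosen in their finite intersections form a Cauchy sequence. This makes completeness of the
    direct limit a question about sequences. *)
Lemma seq_complete T :
  (forall u : nat -> T, seq_cauchy u -> exists x, seq_cvg u x) -> complete_space T.
Proof.
move=> cT F PF /cauchy_ballP cF.
have /choice[V VP] : forall n : nat, exists V : set T, F V /\
    forall x y, V x -> V y -> mdist x y < n.+1%:R^-1.
  move=> n; have [|[V W] /= [FV FW] VW] := cF n.+1%:R^-1 _; first by rewrite invr_gt0.
  exists (V `&` W); split; first exact: filterI.
  by move=> x y [Vx _] [_ Wy]; have := VW (x, y) (conj Vx Wy); rewrite ballEmdist.
have FV n : F [set x | forall i : 'I_n, V i x].
  by apply: filter_forall => i; have [] := VP i.
have /choice[u uP] : forall n : nat, exists x, forall i : 'I_n.+1, V i x.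
  by move=> n; exact: filter_ex (FV n.+1).
have Vu i n : (i <= n)%N -> V i (u n) by move=> ni; exact: (uP n (Ordinal (ni : (i < n.+1)%N))).
have [|x ux] := cT u.
  move=> e /invS_lt[N NP]; exists N => i j Ni Nj; apply: lt_trans (NP N (leqnn N)).
  by apply: (VP N).2; exact: Vu.
exists x; apply/cvg_ballP => e e0; have e2 : 0 < e / 2 by rewrite divr_gt0.
have [N NP] := invS_lt e2; have [M _ uM] := ux _ e2.
apply: filterS (VP N).1 => y Vy; rewrite ballEmdist /=.
pose n := maxn N M; have := VP N; move=> [_ /(_ _ _ (Vu N n (leq_maxl _ _)) Vy)].
have := uM n (leq_maxr _ _); have := NP N (leqnn N).
have := metric_triangle x (u n) y; rewrite /= (metric_sym x (u n)).
by move: (N.+1%:R^-1) => q; lra.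
Qed.

Lemma dense_approx T (D : set T) (x : T) (e : R) :
  dense D -> 0 < e -> exists2 y, D y & mdist x y < e.
Proof.
move=> dD e0; have [|y [xy Dy]] := dD (ball x e)^° _ (open_interior _).
  by exists x; exact: nbhsx_ballx.
by exists y => //; have := interior_subset xy; rewrite ballEmdist.
Qed.

Lemma approx_dense T (D : set T) :
  (forall (x : T) (e : R), 0 < e -> exists2 y, D y & mdist x y < e) -> dense D.
Proof.
move=> aD O [x Ox] oO; have : nbhs x O by exact: open_nbhs_nbhs.
move=> /nbhs_ballP[e /= e0 eO]; have [y Dy xy] := aD x e e0.
by exists y; split => //; apply: eO; rewrite ballEmdist.
Qed.

Definition isometric T U (f : T -> U) : Prop := forall x y, mdist (f x) (f y) = mdist x y.

Lemma isometric_inj T U (f : T -> U) : isometric f -> injective f.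
Proof.
by move=> fi x y fxy; apply: mdist_positivity; rewrite -fi fxy mdistxx.
Qed.

(** The range is closed, since preimages of a convergent sequence are again Cauchy. Every
    surjectivity argument below goes through this. *)
Lemma isometric_complete_range T U (f : T -> U) (y : U) : complete_space T -> isometric f ->
  (forall e : R, 0 < e -> exists x, mdist y (f x) < e) -> exists x, f x = y.
Proof.
move=> cT fi yf.
have /choice[u uP] : forall n : nat, exists x, mdist y (f x) < n.+1%:R^-1.
  by move=> n; apply: yf; rewrite invr_gt0.
have fu : seq_cvg (f \o u) y.
  move=> e /invS_lt[N NP]; exists N => // n /= /NP ne; rewrite metric_sym.
  exact: lt_trans (uP n) ne.
have [|x ux] := complete_seq_cvg cT (_ : seq_cauchy u).
  move=> e /(seq_cvg_cauchy fu)[N NP]; exists N => i j Ni Nj.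
  by rewrite -fi; exact: NP.
exists x; apply: seq_cvg_uniq fu => e /ux; apply: filterS => n /=.
by rewrite fi.
Qed.

Lemma seq_cvg_dense T U (D : set T) (w : nat -> T -> U) : dense D ->
  complete_space U -> (forall n, isometric (w n)) ->
  (forall x, D x -> seq_cauchy (w ^~ x)) ->
  forall x, exists y, seq_cvg (w ^~ x) y.
Proof.
move=> dD cU wi wc x; apply: complete_seq_cvg => // e e0.
have e3 : 0 < e / 3 by rewrite divr_gt0.
have [y Dy xy] := dense_approx x dD e3.
have [N NP] := wc y Dy _ e3; exists N => i j Ni Nj.
have := NP _ _ Ni Nj; have := metric_triangle (w i x) (w i y) (w j x).
have := metric_triangle (w i y) (w j y) (w j x); rewrite !wi (metric_sym y x).
lra.
Qed.

Lemma isometric_extension T U (D : set T) (g : T -> U) : dense D -> complete_space U ->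
  (forall x y, D x -> D y -> mdist (g x) (g y) = mdist x y) ->
  exists2 f, isometric f & forall x, D x -> f x = g x.
Proof.
move=> dD cU gi.
have /choice[v vP] : forall x, exists v : nat -> T, (forall n, D (v n)) /\ seq_cvg v x.
  move=> x; have /choice[v vP] : forall n : nat, exists y, D y /\ mdist x y < n.+1%:R^-1.
    move=> n; have [|y Dy xy] := @dense_approx T D x n.+1%:R^-1 dD; first by rewrite invr_gt0.
    by exists y.
  exists v; split=> [n|e /invS_lt[N NP]]; first exact: (vP n).1.
  by exists N => // n /= /NP; rewrite metric_sym; apply: lt_trans (vP n).2.
have /choice[f fP] : forall x, exists y, seq_cvg (g \o v x) y.
  move=> x; apply: complete_seq_cvg => // e /(seq_cvg_cauchy (vP x).2)[N NP].
  by exists N => i j Ni Nj; rewrite /= gi ?NP//; exact: (vP x).1.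
(* Comparing [f x] with the points [g y] serves twice: with [y = x] it shows that [f] extends [g],
   and in general that [f] is isometric. *)
have gf x y (e : R) : D y -> 0 < e -> `|mdist (g y) (f x) - mdist y x| <= e.
  move=> Dy e0; have e2 : 0 < e / 2 by rewrite divr_gt0.
  have [n [/= xn yn]] := filter_ex (filterI ((vP x).2 _ e2) (fP x _ e2)).
  have := mdist_lipschitz (g y) (g y) (f x) (g (v x n)); have := mdist_lipschitz y y x (v x n).
  rewrite !mdistxx !add0r (gi y) //; last exact: (vP x).1.
  rewrite (metric_sym x) (metric_sym (f x)) => h1 h2.
  have := ler_distD (mdist y (v x n)) (mdist (g y) (f x)) (mdist y x).
  by rewrite (distrC (mdist y _)); lra.
have fD x : D x -> f x = g x.
  move=> Dx; apply: mdist_ler_eq => e /(gf x x _ Dx).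
  by rewrite mdistxx subr0 (ger0_norm (mdist_ge0 _ _)) metric_sym.
exists f => // x y; apply/eqP; rewrite -subr_eq0 -normr_le0.
apply/ler_addgt0Pr => e e0; rewrite add0r.
have e3 : 0 < e / 3 by rewrite divr_gt0.
have [n [/= xn yn]] := filter_ex (filterI ((vP x).2 _ e3) (fP x _ e3)).
have := gf y _ _ ((vP x).1 n) e3.
have := mdist_lipschitz (f x) (g (v x n)) (f y) (f y); have := mdist_lipschitz (v x n) x y y.
rewrite !mdistxx !addr0 (metric_sym (f x) (g (v x n))) => h1 h2 h3.
have := ler_distD (mdist (g (v x n)) (f y)) (mdist (f x) (f y)) (mdist x y).
have := ler_distD (mdist (v x n) y) (mdist (g (v x n)) (f y)) (mdist x y).
lra.
Qed.

End MetricSequences.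
(** * Ordinals, bounded suprema and moduli *)

Lemma omega1_ind (P : omega1 -> Prop) :
  P ozero -> (forall v, P v -> P (osucc v)) ->
  (forall w, is_limit w -> (forall v, olt v w -> P v) -> P w) ->
  forall w, P w.
Proof.
move=> P0 PS Pl; apply: (well_founded_ind olt_wf) => w IH.
have [[v vw]|nS] := pselect (exists v, is_succ v w).
  suff -> : w = osucc v by apply/PS/IH; case: vw.
  have [vS vSP] := osuccP v; case: vw => vw vwP.
  have [wS|//|Sw] := olt_total w (osucc v); first by case: (vSP w wS).
  by case: (vwP _ Sw).
have [w0|n0] := pselect (exists v, olt v w); first exact: Pl.
suff -> : w = ozero by [].
have [wz|//|zw] := olt_total w ozero; first by case: (ozeroP wz).
by case: n0; exists ozero.
Qed.

Lemma countable_below (w : omega1) : countable [set v | olt v w].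
Proof.
have /countable_injP[f finj] := countable_olt w; apply/countable_injP.
exists (fun v => if pselect (olt v w) is left vw then f (exist _ v vw) else 0%N).
move=> u v; rewrite !inE => uw vw; case: pselect => // uw'; case: pselect => // vw' fuv.
by have := finj _ _ (in_setT _) (in_setT _) fuv => -[].
Qed.

(** Otherwise omega1 would be a countable union of countable initial segments. This is what puts any
    countable part of the direct limit into one copy of [A]. *)
Lemma countable_omega1_bounded (g : nat -> omega1) : exists w, forall n, olt (g n) w.
Proof.
apply: contrapT => nw; apply: omega1_uncountable.
have -> : [set: omega1] = \bigcup_n [set v | olt v (osucc (g n))].
  apply/seteqP; split=> // w _; apply: contrapT => ngw; apply: nw; exists w => n.
  have [gS _] := osuccP (g n); have [//|gw|wg] := olt_total (g n) w; case: ngw; exists n => //=.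
    by rewrite -gw.
  exact: olt_trans wg gS.
by apply: bigcup_countable => // n _; exact: countable_below.
Qed.

Section BoundedExtrema.
Variable R : realType.
Implicit Types (J : R * R) (S : set R).

Lemma sup_in_le J S (t : R) : has_ubound S ->
  sup_in J S <= t <-> J.1 <= t /\ forall z, S z -> z <= t.
Proof.
move=> [u uS]; have ubJ : has_ubound (J.1 |` S).
  exists (Num.max u J.1) => z [->|/uS zu]; rewrite le_max ?lexx ?orbT//.
  by rewrite zu.
split=> [St|[Jt St]]; last first.
  by apply: ge_sup; [exists J.1; left|move=> z [->|/St]].
split=> [|z Sz]; apply: le_trans St; apply: ub_le_sup => //; first by left.
by right.
Qed.

Lemma inf_in_ge J S (t : R) : has_lbound S ->
  t <= inf_in J S <-> t <= J.2 /\ forall z, S z -> t <= z.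
Proof.
move=> [u uS]; have lbJ : has_lbound (J.2 |` S).
  exists (Num.min u J.2) => z [->|/uS zu]; rewrite ge_min ?lexx ?orbT//.
  by rewrite zu.
split=> [St|[Jt St]]; last first.
  by apply: lb_le_inf; [exists J.2; left|move=> z [->|/St]].
split=> [|z Sz]; apply: (le_trans St); apply: ge_inf => //; first by left.
by right.
Qed.

Lemma sup_le0 (S : set R) (t : R) : 0 <= t -> (forall z, S z -> z <= t) -> sup S <= t.
Proof.
move=> t0 St; have [->|/set0P S0] := eqVneq S set0; first by rewrite sup0.
exact: ge_sup.
Qed.

End BoundedExtrema.

Lemma snocE (T : Type) (n : nat) (a : nat -> T) :
  snoc (fun i : 'I_n => a i) (a n) = (fun i : 'I_n.+1 => a i).
Proof.
apply/funext => i; rewrite /snoc; case: unliftP => [j ->|->] //.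
by rewrite lift_max.
Qed.

Lemma snoc_comp (T U : Type) (f : T -> U) n (a : 'I_n -> T) c :
  (fun i => f (snoc a c i)) = snoc (fun i => f (a i)) (f c).
Proof. by apply/funext => i; rewrite /snoc; case: unlift. Qed.

Lemma snoc_lift (T : Type) n (a : 'I_n -> T) c j : snoc a c (lift ord_max j) = a j.
Proof. by rewrite /snoc liftK. Qed.

Lemma snoc_max (T : Type) n (a : 'I_n -> T) c : snoc a c ord_max = c.
Proof. by rewrite /snoc unlift_none. Qed.

Lemma snoc_eta (T : Type) n (a : 'I_n.+1 -> T) :
  a = snoc (fun i => a (lift ord_max i)) (a ord_max).
Proof. by apply/funext => i; rewrite /snoc; case: unliftP => [j ->|->]. Qed.

Lemma tuple0_eq (T : Type) (a b : 'I_0 -> T) : a = b.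
Proof. by apply/funext => -[]. Qed.

Section Modulus.
Variable R : realType.

Lemma modulus_mono (I : Type) (D : (I -> R) -> R) (u v : I -> R) : is_modulus D ->
  nonneg_fun u -> (forall i, u i <= v i) -> D u <= D v.
Proof.
move=> mD u0 uv; have -> : v = (fun i => u i + (v i - u i)).
  by apply/funext => i; rewrite addrC subrK.
by apply: (modulus_le mD) => // i; rewrite subr_ge0.
Qed.

End Modulus.

Section WeakModulus.
Variables (R : realType) (Omega : (nat -> R) -> \bar R).
Hypothesis wO : is_weak_modulus Omega.

Lemma weak_modulus_mono (u v : nat -> R) :
  nonneg_fun u -> (forall i, u i <= v i) -> (Omega u <= Omega v)%E.
Proof.
move=> u0 uv; have -> : v = (fun i => u i + (v i - u i)).
  by apply/funext => i; rewrite addrC subrK.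
by apply: (weak_modulus_le wO) => // i; rewrite subr_ge0.
Qed.

Lemma extend0_ge0 n (u : 'I_n -> R) : nonneg_fun u -> nonneg_fun (extend0 u).
Proof. by move=> u0 i; rewrite /extend0; case: insub. Qed.

Lemma wrestrict_ge0 n (u : 'I_n -> R) : nonneg_fun u -> (0 <= wrestrict Omega u)%E.
Proof. by move=> u0; apply: (weak_modulus_ge0 wO); exact: extend0_ge0. Qed.

Lemma wrestrict_mono n (u v : 'I_n -> R) :
  nonneg_fun u -> (forall i, u i <= v i) -> (wrestrict Omega u <= wrestrict Omega v)%E.
Proof.
move=> u0 uv; apply: weak_modulus_mono; first exact: extend0_ge0.
by move=> i; rewrite /extend0; case: insub.
Qed.

Lemma wrestrict_snoc n (u : 'I_n -> R) :
  wrestrict Omega (snoc u 0) = wrestrict Omega u.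
Proof.
congr Omega; apply/funext => i; rewrite /extend0; case: insubP => [j _ <-|ni].
  rewrite /snoc; case: unliftP => [k ->|->].
    by have -> : \val (lift ord_max k) = k :> nat; [exact: lift_max|rewrite valK].
  by rewrite insubF ?ltnn.
by rewrite insubF//; apply: contraNF ni => /leqW.
Qed.

(** Separate continuity at 0 becomes joint continuity in finitely many coordinates by subadditivity:
    split off the last coordinate and give each part half of the error. *)
Lemma weak_modulus_small (n : nat) (e : R) : 0 < e -> exists2 d : R, 0 < d &
  forall u, nonneg_fun u -> (forall i, (i < n)%N -> u i <= d) ->
    (forall i, (n <= i)%N -> u i = 0) -> (Omega u <= e%:E)%E.
Proof.
elim: n e => [|n IH] e e0.
  exists 1 => // u _ _ u0; have -> : u = fun=> 0 by apply/funext => i; rewrite u0.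
  by rewrite (weak_modulus0 wO) lee_fin ltW.
have e2 : 0 < e / 2 by rewrite divr_gt0.
have [d d0 dP] := IH _ e2.
have z0 : nonneg_fun (fun _ : nat => 0 : R) by move=> i /=.
have uz : update (fun=> 0) n 0 = fun=> 0 :> R.
  by apply/funext => i; rewrite /update; case: ifP.
have /subspace_continuousP/(_ 0) := weak_modulus_sep_continuous wO (i:=n) z0.
rewrite /= in_itv /= lexx => /(_ isT) /(_ [set y | (y < (e / 2)%:E)%E]).
case.
  apply: open_nbhs_nbhs; split; first exact: open_ereal_lt_ereal.
  by rewrite /from_subspace /= uz (weak_modulus0 wO) lte_fin.
move=> c /= c0 cP; exists (Num.min d (c / 2)); first by rewrite lt_min d0 divr_gt0.
move=> u u0 ud un.
pose u1 := update u n 0; pose u2 := update (fun=> 0) n (u n).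
have -> : u = fun i => u1 i + u2 i.
  by apply/funext => i; rewrite /u1 /u2 /update; case: eqP => [->|]; rewrite ?add0r ?addr0.
have u10 : nonneg_fun u1 by move=> i; rewrite /u1 /update; case: ifP.
have u20 : nonneg_fun u2 by move=> i; rewrite /u2 /update; case: ifP.
apply: (le_trans (weak_modulus_add wO u10 u20)).
rewrite (splitr e) EFinD; apply: leeD.
  apply: dP => // i ni; rewrite /u1 /update; case: eqP => //.
  - by rewrite ltW.
  - by move=> _; have := ud i (leqW ni); rewrite le_min => /andP[].
  - by move=> /eqP ni'; apply: un; rewrite ltn_neqAle eq_sym ni'.
apply/ltW/cP => /=; last by rewrite in_itv /= u0.
rewrite /ball_ /= sub0r normrN ger0_norm //.
apply: (@le_lt_trans _ _ (c / 2)); last by rewrite ltr_pdivrMr // ltr_pMr // ltr1n.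
by have := ud n (leqnn _); rewrite le_min => /andP[].
Qed.

Lemma wrestrict_small (n : nat) (e : R) : 0 < e -> exists2 d : R, 0 < d &
  forall u : 'I_n -> R, nonneg_fun u -> (forall i, u i <= d) -> (wrestrict Omega u <= e%:E)%E.
Proof.
move=> e0; have [d d0 dP] := weak_modulus_small n e0; exists d => // u u0 ud.
apply: dP; first exact: extend0_ge0.
- by move=> i ni; rewrite /extend0; case: insub => //; exact: ltW.
- by move=> i ni; rewrite /extend0 insubF // ltnNge ni.
Qed.

End WeakModulus.
(** * Basic formulas *)

Section BasicFormulas.
Variables (R : realType) (L : signature R).

Lemma term_mod_ge0 n (t : term L n) (u : 'I_n -> R) : nonneg_fun u -> 0 <= term_mod t u.
Proof.
move=> u0; elim: t => [i|F ts IH] /=; first exact: u0.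
by apply: (modulus_ge0 (fmodP F)) => i; exact: IH.
Qed.

Lemma term_respects (A : structure L) n (t : term L n) (a b : 'I_n -> A) :
  mdist (term_eval t a) (term_eval t b) <= term_mod t (fun i => mdist (a i) (b i)).
Proof.
elim: t => [i|F ts IH] //=; apply: (le_trans (fint_respects _ _)).
by apply: (modulus_mono (fmodP F)) => // i; exact: mdist_ge0.
Qed.

Lemma pmod_mono (P : psym L) (u v : 'I_(parity P) -> R) :
  nonneg_fun u -> (forall i, u i <= v i) -> pmod u <= pmod v.
Proof.
case: P u v => [P|] u v u0 uv; first exact: (modulus_mono (rmodP P)).
by rewrite /= lerD.
Qed.

Lemma pmod_ge0 (P : psym L) (u : 'I_(parity P) -> R) : nonneg_fun u -> 0 <= pmod u.
Proof.
case: P u => [P|] u u0; first exact: (modulus_ge0 (rmodP P)).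
by rewrite /= addr_ge0.
Qed.

Lemma pint_respects (A : structure L) (P : psym L) (x y : 'I_(parity P) -> A) :
  `|pint x - pint y| <= pmod (fun i => mdist (x i) (y i)).
Proof. by case: P x y => [P|] x y; [exact: rint_respects|exact: mdist_lipschitz]. Qed.

Lemma pint_bound (A : structure L) (P : psym L) (x : 'I_(parity P) -> A) :
  (pbound P).1 <= pint x <= (pbound P).2.
Proof. by case: P x => [P|] x; [exact: rint_bound|exact: dint_bound]. Qed.

Lemma pboundP (P : psym L) : (pbound P).1 <= (pbound P).2.
Proof. by case: P => [P|]; [exact: rboundP|exact: dboundP]. Qed.

Lemma atomic_mod_ge0 n (q : atomic L n) (u : 'I_n -> R) :
  nonneg_fun u -> 0 <= atomic_mod q u.
Proof. by move=> u0; apply: pmod_ge0 => i; exact: term_mod_ge0. Qed.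

Lemma atomic_respects (A : structure L) n (q : atomic L n) (a b : 'I_n -> A) :
  `|atomic_eval q a - atomic_eval q b| <= atomic_mod q (fun i => mdist (a i) (b i)).
Proof.
apply: (le_trans (pint_respects _ _)); apply: pmod_mono => i; first exact: mdist_ge0.
exact: term_respects.
Qed.

Fixpoint term_rename n m (s : 'I_n -> 'I_m) (t : term L n) : term L m :=
  match t with
  | Var i => Var L (s i)
  | App F ts => App (fun i => term_rename s (ts i))
  end.

Lemma term_rename_mod n m (s : 'I_n -> 'I_m) (t : term L n) (u : 'I_m -> R) :
  term_mod (term_rename s t) u = term_mod t (u \o s).
Proof. by elim: t => [i|F ts IH] //=; congr fmod; apply/funext. Qed.

Lemma term_rename_eval (A : structure L) n m (s : 'I_n -> 'I_m) (t : term L n)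
    (a : 'I_m -> A) : term_eval (term_rename s t) a = term_eval t (a \o s).
Proof. by elim: t => [i|F ts IH] //=; congr fint; apply/funext. Qed.

Definition atomic_rename n m (s : 'I_n -> 'I_m) (q : atomic L n) : atomic L m :=
  Atomic (fun i => term_rename s (atom_args (a:=q) i)).

Lemma atomic_rename_mod n m (s : 'I_n -> 'I_m) (q : atomic L n) (u : 'I_m -> R) :
  atomic_mod (atomic_rename s q) u = atomic_mod q (u \o s).
Proof. by congr pmod; apply/funext => i; exact: term_rename_mod. Qed.

Lemma atomic_rename_eval (A : structure L) n m (s : 'I_n -> 'I_m) (q : atomic L n)
    (a : 'I_m -> A) : atomic_eval (atomic_rename s q) a = atomic_eval q (a \o s).
Proof. by congr pint; apply/funext => i; exact: term_rename_eval. Qed.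

Definition basic_rename n m (s : 'I_n -> 'I_m) (p : basic L n) : basic L m :=
  @Basic R L m (basic_size p) (fun i => atomic_rename s (basic_atom (b:=p) i))
    (@basic_fun R L n p) (@basic_continuous R L n p).

Lemma basic_rename_mod n m (s : 'I_n -> 'I_m) (p : basic L n) (u : 'I_m -> R) :
  basic_mod (basic_rename s p) u = basic_mod p (u \o s).
Proof.
by congr function_modulus; apply/funext => i; exact: atomic_rename_mod.
Qed.

Lemma basic_rename_eval (A : structure L) n m (s : 'I_n -> 'I_m) (p : basic L n)
    (a : 'I_m -> A) : basic_eval (basic_rename s p) a = basic_eval p (a \o s).
Proof. by congr basic_fun; apply/funext => i; exact: atomic_rename_eval. Qed.

Lemma box_compact m (J : 'I_m -> R * R) : compact (box J).
Proof.
have := @tychonoff 'I_m (fun=> R) (fun i => `[(J i).1, (J i).2]%classic)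
  (fun i => @segment_compact R _ _).
rewrite (_ : [set f | _] = box J) //.
Qed.

Lemma basic_box_image_bounded n (p : basic L n) : exists M : R,
  forall x, basic_box (p:=p) x -> `|basic_fun (b:=p) x| <= M.
Proof.
have := @compact_bounded R R^o _ (continuous_compact (@basic_continuous R L n p) (@box_compact _
  _)).
move=> [M [_ MP]]; exists (M + 1) => x px; apply: MP; first by rewrite ltrDl.
by exists x.
Qed.

Lemma function_modulus_has_ubound n (p : basic L n) (u : 'I_(basic_size p) -> R) :
  has_ubound [set z | exists x y, [/\ basic_box (p:=p) x, basic_box (p:=p) y,
     forall i, `|x i - y i| <= u i & z = `|basic_fun (b:=p) x - basic_fun (b:=p) y| ] ].
Proof.
have [M MP] := basic_box_image_bounded p; exists (M + M) => _ [x [y [px py _ ->]]].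
by apply: (le_trans (ler_normB _ _)); rewrite lerD ?MP.
Qed.

Lemma atomic_eval_box (A : structure L) n (p : basic L n) (a : 'I_n -> A) :
  basic_box (p:=p) (fun i => atomic_eval (basic_atom (b:=p) i) a).
Proof. by move=> i; exact: pint_bound. Qed.

Lemma basic_respects_mod (A : structure L) n (p : basic L n) (a b : 'I_n -> A) :
  `|basic_eval p a - basic_eval p b| <= basic_mod p (fun i => mdist (a i) (b i)).
Proof.
apply: (ub_le_sup (@function_modulus_has_ubound n p _)).
exists (fun i => atomic_eval (basic_atom (b:=p) i) a).
exists (fun i => atomic_eval (basic_atom (b:=p) i) b).
by split=> //; [exact: atomic_eval_box|exact: atomic_eval_box|move=> i; exact: atomic_respects].
Qed.

Lemma truncate_continuous n (p : basic L n) (c : R) :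
  {within basic_box (p:=p), continuous
    ((fun x => Num.min `|basic_fun (b:=p) x - c| 1) : {ptws 'I_(basic_size p) -> R} -> R)}.
Proof.
move=> x; have cp := @basic_continuous R L n p x.
exact: (@continuous_min R _ _ _ x (@cvg_norm _ _ _ (nbhs x) _ _ _
  (@cvgB R R^o _ (nbhs x) _ _ _ _ _ cp (cvg_cst c))) (cvg_cst (1 : R))).
Qed.

(** Turns a formula of arbitrary bound into a [0,1]-formula. With [c] the value of [p] at one tuple
    it vanishes there, so a difference of truncations that is below 1 is a genuine difference of
    values of [p]. *)
Definition truncate n (p : basic L n) (c : R) : basic L n := Basic (@truncate_continuous n p c).

Lemma truncate_eval (A : structure L) n (p : basic L n) (c : R) (a : 'I_n -> A) :
  basic_eval (truncate p c) a = Num.min `|basic_eval p a - c| 1.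
Proof. by []. Qed.

Lemma truncation_lipschitz (x y c : R) :
  `|Num.min `|x - c| 1 - Num.min `|y - c| 1| <= `|x - y|.
Proof.
have h := ler_distD c x y; have h1 := ler_distD y x c; have h2 := ler_distD x y c.
move: h h1 h2; rewrite (distrC y x) (distrC c y).
move: `|x - y| `|x - c| `|y - c| (normr_ge0 (x - c)) (normr_ge0 (y - c)) => r s t s0 t0 *.
by rewrite ler_norml /Num.min; case: ltP => h3; case: ltP => h4; apply/andP; split; lra.
Qed.

Lemma basic_mod_ge0 n (p : basic L n) (u : 'I_n -> R) : nonneg_fun u -> 0 <= basic_mod p u.
Proof.
move=> u0; apply: le_trans (ub_le_sup (@function_modulus_has_ubound n p _) _); last first.
  exists (fun i => (atomic_bound (basic_atom (b:=p) i)).1).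
  exists (fun i => (atomic_bound (basic_atom (b:=p) i)).1).
  split => [||i|//].
  - by move=> i; rewrite lexx pboundP.
  - by move=> i; rewrite lexx pboundP.
  - by rewrite subrr normr0 atomic_mod_ge0.
by rewrite normr_ge0.
Qed.

Lemma truncate_mod n (p : basic L n) (c : R) (u : 'I_n -> R) : nonneg_fun u ->
  basic_mod (truncate p c) u <= basic_mod p u.
Proof.
move=> u0; apply: sup_le0; first exact: basic_mod_ge0.
move=> _ [x [y [px py xy ->]]]; apply: (le_trans (truncation_lipschitz _ _ _)).
by apply: (ub_le_sup (@function_modulus_has_ubound n p _)); exists x, y; split.
Qed.

Lemma truncate_bound n (p : basic L n) (c : R) : basic_bound (truncate p c) `<=` `[0, 1].
Proof. by move=> _ [x _ <-]; rewrite /= in_itv /= le_min normr_ge0 ler01 ge_min lexx orbT. Qed.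

Lemma atomic_scaled_continuous n (q : atomic L n) (M : R) :
  {within box (fun _ : 'I_1 => atomic_bound q), continuous
    ((fun x => M * x ord0) : {ptws 'I_1 -> R} -> R)}.
Proof.
apply: continuous_subspaceT => x.
exact (@cvgMl_tmp R {ptws 'I_1 -> R} (nbhs x) _ _ _ _ (@Defs.coord_continuous R 1 ord0 x)).
Qed.

Definition atomic_scaled n (q : atomic L n) (M : R) : basic L n :=
  Basic (@atomic_scaled_continuous n q M).

Lemma atomic_scaled_mod n (q : atomic L n) (M : R) (u : 'I_n -> R) : 0 <= M ->
  nonneg_fun u -> basic_mod (atomic_scaled q M) u <= M * atomic_mod q u.
Proof.
move=> M0 u0; apply: sup_le0; first by rewrite mulr_ge0 ?atomic_mod_ge0.
move=> _ [x [y [_ _ /(_ ord0) xy ->]]].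
by rewrite /= -mulrBr normrM ger0_norm // ler_wpM2l.
Qed.

Section Respects.
Variable Omega : (nat -> R) -> \bar R.
Hypothesis wO : is_weak_modulus Omega.

Lemma basic_respects_dist (A : structure L) n (p : basic L n) (a b : 'I_n -> A) :
  basic_respects Omega p ->
  (`|basic_eval p a - basic_eval p b|%:E <=
    wrestrict Omega (fun i => mdist (a i) (b i)))%E.
Proof.
move=> pO; apply: le_trans (pO _ _); last by move=> i; exact: mdist_ge0.
by rewrite lee_fin; exact: basic_respects_mod.
Qed.

Lemma truncate_basic01 n (p : basic L n) (c : R) :
  basic_respects Omega p -> basic01 Omega (n:=n) (truncate p c).
Proof.
move=> pO; split; last exact: truncate_bound.
by move=> u u0; apply: le_trans (pO u u0); rewrite lee_fin; exact: truncate_mod.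
Qed.

Definition strictly_increasing k n (s : 'I_k -> 'I_n) : Prop :=
  forall i j : 'I_k, (i < j)%N -> (s i < s j)%N.

Hypothesis sO : shift_increasing Omega.

Lemma wrestrict_shift k n (s : 'I_k -> 'I_n) (u : 'I_n -> R) : strictly_increasing s ->
  nonneg_fun u -> (wrestrict Omega (u \o s) <= wrestrict Omega u)%E.
Proof.
move=> si u0.
(* [t] extends [s] to an increasing map on all naturals: the positions from [k] on go beyond [n],
   where nothing is left to compare. *)
pose t p := if insub p is Some i then s i : nat else (n + p)%N.
have tE (i : 'I_k) : t i = s i by rewrite /t valK.
(* [v] is [u] restricted to the range of [s]: shift-increasingness compares [u \o s] with [v], and
   monotonicity compares [v] with [u]. *)
pose v (q : nat) := if pselect (exists i : 'I_k, q = s i :> nat) then extend0 u q else 0.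
have v0 : nonneg_fun v by move=> q; rewrite /v; case: pselect => /= _; last exact: lexx;
  exact: extend0_ge0.
apply: (@le_trans _ _ (Omega v)).
  apply: (sO (i:=t)).
  - move=> p q pq; rewrite /t; case: insubP => [i _ ip|np].
      case: insubP => [j _ jq|nq]; first by apply: si; rewrite ip jq.
      exact: ltn_addr.
    case: insubP => [j jk jq|nq]; last by rewrite ltn_add2l.
    by case/negP: np; exact: ltn_trans pq jk.
  - by apply: extend0_ge0 => i; exact: u0.
  - move=> p; rewrite /v /t /extend0; case: insubP => [i _ _|np].
      by case: pselect => /= [_|[]]; [rewrite valK|exists i].
    case: pselect => //= -[i e]; have := ltn_ord (s i).
    by rewrite -e ltnNge leq_addr.
  - move=> q nq; rewrite /v; case: pselect => //= -[i e].
    by case: (nq i); rewrite tE.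
apply: weak_modulus_mono => // q; rewrite /v; case: pselect => //= _.
exact: extend0_ge0.
Qed.

Lemma basic_respects_rename k n (s : 'I_k -> 'I_n) (p : basic L k) : strictly_increasing s ->
  basic_respects Omega p -> basic_respects Omega (basic_rename s p).
Proof.
move=> si pO u u0; rewrite basic_rename_mod; apply: le_trans (wrestrict_shift si u0).
by apply: pO => i; exact: u0.
Qed.

End Respects.
End BasicFormulas.
(** * Scott formulas *)

Section ScottLike.
Variables (R : realType) (L : signature R) (Omega : (nat -> R) -> \bar R).

(* Arbitrary formulas need not respect any modulus, so the invariance and continuity arguments
   are carried out for this class. *)
Inductive scott_like : forall n, formula L n -> Prop :=
| SLbasic n (K : Type) (cK : countable [set: K]) (p : K -> basic L n) (c : K -> R) :
    (forall k, basic01 Omega (n:=n) (p k)) -> (forall k, 0 <= c k <= 1) ->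
    scott_like (For cK (0, 1) (fun k => Fabsdiff (c k) (Fbasic (p k))))
| SLmax n (p q : formula L n) : scott_like p -> scott_like q -> scott_like (Fmax p q)
| SLsup n (p : formula L n.+1) : scott_like p -> scott_like (Fsup p)
| SLinf n (p : formula L n.+1) : scott_like p -> scott_like (Finf p)
| SLor n (K : Type) (cK : countable [set: K]) (p : K -> formula L n) :
    (forall k, scott_like (p k)) -> scott_like (For cK (0, 1) p)
| SLand n (K : Type) (cK : countable [set: K]) (p : K -> formula L n) :
    (forall k, scott_like (p k)) -> scott_like (Fand cK (0, 1) p).

Lemma basic01_eval (A : structure L) n (p : basic L n) (a : 'I_n -> A) :
  basic01 Omega (n:=n) p -> 0 <= basic_eval p a <= 1.
Proof.
move=> [_ /(_ (basic_eval p a))]; rewrite /= in_itv /=; apply.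
by exists (fun i => atomic_eval (basic_atom (b:=p) i) a) => //; exact: atomic_eval_box.
Qed.

Lemma eval_Fmax (A : structure L) n (p q : formula L n) (a : 'I_n -> A) :
  Defs.eval (Fmax p q) a = Num.max (Defs.eval p a) (Defs.eval q a).
Proof. by []. Qed.

Lemma eval_Fabsdiff (A : structure L) n (c : R) (p : formula L n) (a : 'I_n -> A) :
  Defs.eval (Fabsdiff c p) a = `|c - Defs.eval p a|.
Proof. by []. Qed.

Lemma inf_sup01 (S : set R) : S `<=` `[0, 1] -> S 0 -> S 1 -> (inf S, sup S) = (0, 1).
Proof.
move=> S01 S0 S1; congr pair; apply/eqP; rewrite eq_le; apply/andP; split.
- apply: ge_inf => //; exists 0 => z /S01; rewrite /= in_itv /=; by case/andP.
- apply: lb_le_inf; first by exists 0.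
  by move=> z /S01; rewrite /= in_itv /=; case/andP.
- apply: ge_sup; first by exists 0.
  by move=> z /S01; rewrite /= in_itv /=; case/andP.
- apply: ub_le_sup => //; exists 1 => z /S01; rewrite /= in_itv /=; by case/andP.
Qed.

Lemma bound_Fmax n (p q : formula L n) :
  bound p = (0, 1) -> bound q = (0, 1) -> bound (Fmax p q) = (0, 1).
Proof.
move=> bp bq; rewrite /= ; apply: inf_sup01.
- move=> _ [x xb <-]; rewrite /= in_itv /=.
  have := xb ord0; have := xb ord_max; rewrite /pair2 /= bp bq /=.
  by move=> /andP[h1 h2] /andP[h3 h4]; rewrite le_max h3 ge_max h4 h2.
- exists (fun=> 0); last by rewrite /= maxxx.
  by move=> i; rewrite /pair2; case: ifP => _; rewrite ?bp ?bq /= lexx ler01.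
- exists (fun=> 1); last by rewrite /= maxxx.
  by move=> i; rewrite /pair2; case: ifP => _; rewrite ?bp ?bq /= lexx ler01.
Qed.

Lemma scott_like_bound n (p : formula L n) : scott_like p -> bound p = (0, 1).
Proof. by elim=> // {}n {}p q _ bp _ bq; exact: bound_Fmax. Qed.

Lemma eval_For_le (A : structure L) n K (cK : countable [set: K]) (p : K -> formula L n)
    (a : 'I_n -> A) (t : R) : (forall k, Defs.eval (p k) a <= 1) ->
  Defs.eval (For cK (0, 1) p) a <= t <-> 0 <= t /\ forall k, Defs.eval (p k) a <= t.
Proof.
move=> p1; rewrite /= sup_in_le; last by exists 1 => _ [k _ <-].
by split=> -[t0 pt]; split=> //; [move=> k; apply: pt; exists k|move=> _ [k _ <-]].
Qed.

Lemma eval_Fand_ge (A : structure L) n K (cK : countable [set: K]) (p : K -> formula L n)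
    (a : 'I_n -> A) (t : R) : (forall k, 0 <= Defs.eval (p k) a) ->
  t <= Defs.eval (Fand cK (0, 1) p) a <-> t <= 1 /\ forall k, t <= Defs.eval (p k) a.
Proof.
move=> p1; rewrite /= inf_in_ge; last by exists 0 => _ [k _ <-].
by split=> -[t0 pt]; split=> //; [move=> k; apply: pt; exists k|move=> _ [k _ <-]].
Qed.

Lemma eval_Fsup_le (A : structure L) n (p : formula L n.+1) (a : 'I_n -> A) (t M : R) :
  (forall b : 'I_n.+1 -> A, Defs.eval p b <= M) ->
  Defs.eval (Fsup p) a <= t <-> (bound p).1 <= t /\ forall c, Defs.eval p (snoc a c) <= t.
Proof.
move=> p1; rewrite /= sup_in_le; last by exists M => _ [k _ <-].
by split=> -[t0 pt]; split=> //; [move=> k; apply: pt; exists k|move=> _ [k _ <-]].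
Qed.

Lemma eval_Finf_ge (A : structure L) n (p : formula L n.+1) (a : 'I_n -> A) (t M : R) :
  (forall b : 'I_n.+1 -> A, M <= Defs.eval p b) ->
  t <= Defs.eval (Finf p) a <-> t <= (bound p).2 /\ forall c, t <= Defs.eval p (snoc a c).
Proof.
move=> p1; rewrite /= inf_in_ge; last by exists M => _ [k _ <-].
by split=> -[t0 pt]; split=> //; [move=> k; apply: pt; exists k|move=> _ [k _ <-]].
Qed.

Lemma absdiff01 (c x : R) : 0 <= c <= 1 -> 0 <= x <= 1 -> `|c - x| <= 1.
Proof. by move=> ? ?; rewrite ler_norml; apply/andP; split; lra. Qed.

Lemma scott_like_eval (A : structure L) n (p : formula L n) : scott_like p ->
  forall a : 'I_n -> A, 0 <= Defs.eval p a <= 1.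
Proof.
elim=> {n p}.
- move=> n K cK p c p01 c01 a.
  have h k : Defs.eval (Fabsdiff (c k) (Fbasic (p k))) a <= 1.
    by rewrite eval_Fabsdiff absdiff01 //=; exact: basic01_eval.
  apply/andP; split; last by apply/eval_For_le.
  by have /(eval_For_le _ _ h)[] := lexx (Defs.eval (For cK (0, 1) (fun k => Fabsdiff (c k)
    (Fbasic (p k)))) a).
- move=> n p q _ pP _ qP a; rewrite eval_Fmax.
  have /andP[h1 h2] := pP a; have /andP[h3 h4] := qP a.
  by rewrite le_max h1 ge_max h2 h4.
- move=> n p sp pP a; have h b := (andP (pP b)).2.
  apply/andP; split; last by apply/(eval_Fsup_le _ _ h); rewrite scott_like_bound.
  by have /(eval_Fsup_le _ _ h)[] := lexx (Defs.eval (Fsup p) a); rewrite scott_like_bound.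
- move=> n p sp pP a; have h b := (andP (pP b)).1.
  apply/andP; split; first by apply/(eval_Finf_ge _ _ h); rewrite scott_like_bound.
  by have /(eval_Finf_ge _ _ h)[] := lexx (Defs.eval (Finf p) a); rewrite scott_like_bound.
- move=> n K cK p sp pP a; have h k := (andP (pP k a)).2.
  apply/andP; split; last exact/(eval_For_le _ _ h).
  by have /(eval_For_le _ _ h)[] := lexx (Defs.eval (For cK (0, 1) p) a).
- move=> n K cK p sp pP a; have h k := (andP (pP k a)).1.
  apply/andP; split; first exact/(eval_Fand_ge _ _ h).
  by have /(eval_Fand_ge _ _ h)[] := lexx (Defs.eval (Fand cK (0, 1) p) a).
Qed.

Lemma scott_like_ge0 (A : structure L) n (p : formula L n) (a : 'I_n -> A) :
  scott_like p -> 0 <= Defs.eval p a.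
Proof. by move=> sp; case/andP: (scott_like_eval sp a). Qed.

Lemma scott_like_le1 (A : structure L) n (p : formula L n) (a : 'I_n -> A) :
  scott_like p -> Defs.eval p a <= 1.
Proof. by move=> sp; case/andP: (scott_like_eval sp a). Qed.

Lemma scott_like_sup_le (A : structure L) n (p : formula L n.+1) (a : 'I_n -> A) (t : R) :
  scott_like p ->
  Defs.eval (Fsup p) a <= t <-> 0 <= t /\ forall c, Defs.eval p (snoc a c) <= t.
Proof.
move=> sp; rewrite (@eval_Fsup_le A n p a t 1) ?scott_like_bound//.
by move=> b; exact: scott_like_le1.
Qed.

Lemma scott_like_inf_ge (A : structure L) n (p : formula L n.+1) (a : 'I_n -> A) (t : R) :
  scott_like p ->
  t <= Defs.eval (Finf p) a <-> t <= 1 /\ forall c, t <= Defs.eval p (snoc a c).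
Proof.
move=> sp; rewrite (@eval_Finf_ge A n p a t 0) ?scott_like_bound//.
by move=> b; exact: scott_like_ge0.
Qed.

Lemma scott_like_For_le (A : structure L) n K (cK : countable [set: K])
    (p : K -> formula L n) (a : 'I_n -> A) (t : R) : (forall k, scott_like (p k)) ->
  Defs.eval (For cK (0, 1) p) a <= t <-> 0 <= t /\ forall k, Defs.eval (p k) a <= t.
Proof. by move=> sp; apply: eval_For_le => k; exact: scott_like_le1. Qed.

Lemma scott_like_Fand_ge (A : structure L) n K (cK : countable [set: K])
    (p : K -> formula L n) (a : 'I_n -> A) (t : R) : (forall k, scott_like (p k)) ->
  t <= Defs.eval (Fand cK (0, 1) p) a <-> t <= 1 /\ forall k, t <= Defs.eval (p k) a.
Proof. by move=> sp; apply: eval_Fand_ge => k; exact: scott_like_ge0. Qed.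

Hypothesis wO : is_weak_modulus Omega.

Lemma mdist_snoc (A : structure L) n (a b : 'I_n -> A) (c : A) :
  (fun i => mdist (snoc a c i) (snoc b c i)) = snoc (fun i => mdist (a i) (b i)) 0.
Proof. by apply/funext => i; rewrite /snoc; case: unlift => //; rewrite mdistxx. Qed.

Lemma wrestrict_mdist_snoc (A : structure L) n (a b : 'I_n -> A) (c : A) :
  wrestrict Omega (fun i => mdist (snoc a c i) (snoc b c i)) =
  wrestrict Omega (fun i => mdist (a i) (b i)).
Proof. by rewrite mdist_snoc wrestrict_snoc. Qed.

Lemma wrestrict_mdist_ge0 (A : structure L) n (a b : 'I_n -> A) (e : R) :
  (wrestrict Omega (fun i => mdist (a i) (b i)) <= e%:E)%E -> 0 <= e.
Proof.
move=> h; rewrite -lee_fin; apply: le_trans h; apply: wrestrict_ge0 => // i.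
exact: mdist_ge0.
Qed.

Lemma wrestrict_mdist_sym (A : structure L) n (a b : 'I_n -> A) :
  wrestrict Omega (fun i => mdist (a i) (b i)) = wrestrict Omega (fun i => mdist (b i) (a i)).
Proof. by congr wrestrict; apply/funext => i; exact: metric_sym. Qed.

(** All these formulas share the modulus [Omega], whatever their quantifiers: a quantifier appends
    the same element to both tuples, which only adds a zero coordinate. *)
Lemma scott_like_continuous (A : structure L) n (p : formula L n) : scott_like p ->
  forall (a b : 'I_n -> A) (e : R),
  (wrestrict Omega (fun i => mdist (a i) (b i)) <= e%:E)%E ->
  Defs.eval p a <= Defs.eval p b + e.
Proof.
elim=> {n p}.
- move=> n K cK p c p01 c01 a b e abe.
  have h (d : 'I_n -> A) k : Defs.eval (Fabsdiff (c k) (Fbasic (p k))) d <= 1.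
    by rewrite eval_Fabsdiff absdiff01 //=; exact: basic01_eval.
  apply/(eval_For_le _ _ (h a)).
  have /(eval_For_le _ _ (h b))[s0 sk] :=
    lexx (Defs.eval (For cK (0, 1) (fun k => Fabsdiff (c k) (Fbasic (p k)))) b).
  split; first by rewrite addr_ge0 // (wrestrict_mdist_ge0 abe).
  move=> k; apply: le_trans (lerD (sk k) (lexx e)).
  rewrite !eval_Fabsdiff /=; have := basic_respects_dist a b (p01 k).1.
  move=> /le_trans/(_ abe); rewrite lee_fin.
  have := ler_distD (basic_eval (p k) b) (c k) (basic_eval (p k) a).
  rewrite (distrC (basic_eval _ b) (basic_eval _ a)); lra.
- move=> n p q _ pP _ qP a b e abe; rewrite !eval_Fmax ge_max addr_maxl.
  by rewrite !le_max pP // qP // orbT.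
- move=> n p sp pP a b e abe; apply/(scott_like_sup_le _ _ sp).
  have /(scott_like_sup_le _ _ sp)[s0 sk] := lexx (Defs.eval (Fsup p) b).
  split; first by rewrite addr_ge0 // (wrestrict_mdist_ge0 abe).
  move=> c; apply: le_trans (lerD (sk c) (lexx e)); apply: pP.
  by rewrite wrestrict_mdist_snoc.
- move=> n p sp pP a b e abe; rewrite -lerBlDr; apply/(scott_like_inf_ge _ _ sp).
  have /(scott_like_inf_ge _ _ sp)[s0 sk] := lexx (Defs.eval (Finf p) a).
  have e0 := wrestrict_mdist_ge0 abe; split; first by lra.
  move=> c; rewrite lerBlDr; apply: (le_trans (sk c)); apply: pP.
  by rewrite wrestrict_mdist_snoc.
- move=> n K cK p sp pP a b e abe; apply/(scott_like_For_le _ _ _ sp).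
  have /(scott_like_For_le _ _ _ sp)[s0 sk] := lexx (Defs.eval (For cK (0, 1) p) b).
  split; first by rewrite addr_ge0 // (wrestrict_mdist_ge0 abe).
  by move=> k; apply: le_trans (lerD (sk k) (lexx e)); exact: pP.
- move=> n K cK p sp pP a b e abe; rewrite -lerBlDr; apply/(scott_like_Fand_ge _ _ _ sp).
  have /(scott_like_Fand_ge _ _ _ sp)[s0 sk] := lexx (Defs.eval (Fand cK (0, 1) p) a).
  have e0 := wrestrict_mdist_ge0 abe; split; first by lra.
  by move=> k; rewrite lerBlDr; apply: (le_trans (sk k)); exact: pP.
Qed.

End ScottLike.

Section ScottFormula.
Variables (R : realType) (L : signature R) (Omega : (nat -> R) -> \bar R).
Variables (A : structure L) (D : set A) (cD : countable D).
Variables (E : forall n, set (basic L n)) (cE : forall n, countable (@E n)).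
Hypothesis dE : forall n, dense_basic01 Omega (@E n).
Hypothesis wO : is_weak_modulus Omega.
Hypothesis sO : shift_increasing Omega.

Local Notation phi := (scott_formula cD cE).

Definition scott_value (w : omega1) (B : structure L) n (a : 'I_n -> A) (b : 'I_n -> B) : R :=
  Defs.eval (phi w a) b.

Local Notation value := scott_value.

Lemma scott_formula0 : phi ozero = scott_zero cE.
Proof. exact: transrec0. Qed.

Lemma scott_formulaS w : phi (osucc w) = scott_succ cD (phi w).
Proof. exact: transrecS. Qed.

Lemma scott_formula_lim w : is_limit w ->
  phi w = scott_lim (fun v : {v : omega1 | olt v w} => phi (sval v)).
Proof. by move=> lw; exact: transrec_lim. Qed.

Lemma scott_formula_like w n (a : 'I_n -> A) : scott_like Omega (phi w a).
Proof.
elim/omega1_ind: w n a => [|w IH|w lw IH] n a.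
- rewrite scott_formula0; apply: SLbasic => p; first exact: (dE n).1 (svalP p).
  by apply: (@basic01_eval _ _ Omega); exact: (dE n).1 (svalP p).
- rewrite scott_formulaS; apply: SLmax.
    by apply: SLor => c; exact/SLinf/IH.
  by apply: SLsup; apply: SLand => c; exact: IH.
- by rewrite scott_formula_lim //; apply: SLor => v; exact/IH/(svalP v).
Qed.

Variable B : structure L.

Lemma value_ge0 w n (a : 'I_n -> A) (b : 'I_n -> B) : 0 <= value w a b.
Proof. exact/scott_like_ge0/scott_formula_like. Qed.

Lemma value_le1 w n (a : 'I_n -> A) (b : 'I_n -> B) : value w a b <= 1.
Proof. exact/scott_like_le1/scott_formula_like. Qed.

Lemma value_continuousr w n (a : 'I_n -> A) (b b' : 'I_n -> B) (e : R) :
  (wrestrict Omega (fun i => mdist (b i) (b' i)) <= e%:E)%E ->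
  value w a b <= value w a b' + e.
Proof. by apply: scott_like_continuous => //; exact: scott_formula_like. Qed.

(** The seminorm bounds the difference of two formulas uniformly over all structures, hence at [a]
    in [A] and at [b] in [B] together. A supremum over a dense family is thus the supremum over all
    [0,1]-formulas. *)
Lemma value0_le n (a : 'I_n -> A) (b : 'I_n -> B) (t : R) :
  value ozero a b <= t <->
  0 <= t /\ forall p, basic01 Omega (n:=n) p -> `|basic_eval p a - basic_eval p b| <= t.
Proof.
rewrite /scott_value scott_formula0; rewrite eval_For_le; last first.
  move=> [p Ep]; rewrite eval_Fabsdiff absdiff01 //=; apply: (@basic01_eval _ _ Omega);
    exact: (dE n).1.
split=> -[t0 pt]; split=> // p; last by have := pt (sval p) ((dE n).1 _ (svalP p)).
move=> p01; apply/ler_addgt0Pr => e e0; have e2 : 0 < e / 2 by rewrite divr_gt0.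
have [q Eq] := (dE n).2 p p01 _ e2; rewrite /seminorm gt_max => /andP[_ pq].
have {}pq (C : structure L) (c : 'I_n -> C) : `|basic_eval p c - basic_eval q c| < e / 2.
  rewrite -lte_fin; apply: le_lt_trans pq; apply: ereal_sup_ubound.
  by exists C, c.
have := pt (exist _ q Eq); rewrite eval_Fabsdiff /=.
have := ler_distD (basic_eval q a) (basic_eval p a) (basic_eval p b).
have := ler_distD (basic_eval q b) (basic_eval q a) (basic_eval p b).
have := pq _ a; have := pq _ b; rewrite (distrC (basic_eval p b)); lra.
Qed.

Lemma valueS_le w n (a : 'I_n -> A) (b : 'I_n -> B) (t : R) :
  value (osucc w) a b <= t <->
  [/\ 0 <= t, forall c, D c -> Defs.eval (Finf (phi w (snoc a c))) b <= t &
    forall x, Defs.eval (Fand (countable_sub cD) (0, 1)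
      (fun c => phi w (snoc a (sval c)))) (snoc b x) <= t].
Proof.
have spc c : scott_like Omega (Finf (phi w (snoc a c))) by exact/SLinf/scott_formula_like.
have spa : scott_like Omega (Fand (countable_sub cD) (0, 1)
      (fun c => phi w (snoc a (sval c)))) by apply: SLand => c; exact: scott_formula_like.
rewrite /scott_value scott_formulaS eval_Fmax ge_max; split.
  move=> /andP[/(scott_like_For_le _ _ _ (fun c : {x | D x} => spc (sval c)))[t0 h1]].
  by move=> /(scott_like_sup_le _ _ spa)[_ h2]; split=> // c Dc; exact: (h1 (exist _ c Dc)).
move=> [t0 h1 h2]; apply/andP; split; last exact/(scott_like_sup_le _ _ spa).
apply/(scott_like_For_le _ _ _ (fun c : {x | D x} => spc (sval c))); split => // c.
exact/h1/(svalP c).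
Qed.

Lemma eval_Finf_lt n (p : formula L n.+1) (b : 'I_n -> B) (t : R) : scott_like Omega p ->
  t <= 1 -> Defs.eval (Finf p) b < t <-> exists x, Defs.eval p (snoc b x) < t.
Proof.
move=> sp t1; split=> [h|[x xt]].
  apply: contrapT => nx; move: h; rewrite ltNge => /negP; apply.
  by apply/(scott_like_inf_ge _ _ sp); split => // x; rewrite leNgt; apply/negP => xt; apply: nx;
    exists x.
apply: le_lt_trans xt.
by have /(scott_like_inf_ge _ _ sp)[_ ] := lexx (Defs.eval (Finf p) b).
Qed.

Lemma eval_Fand_lt n K (cK : countable [set: K]) (p : K -> formula L n) (b : 'I_n -> B) (t : R) :
  (forall k, scott_like Omega (p k)) ->
  t <= 1 -> Defs.eval (Fand cK (0, 1) p) b < t <-> exists k, Defs.eval (p k) b < t.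
Proof.
move=> sp t1; split=> [h|[x xt]].
  apply: contrapT => nx; move: h; rewrite ltNge => /negP; apply.
  by apply/(scott_like_Fand_ge _ _ _ sp); split => // x; rewrite leNgt; apply/negP => xt;
    apply: nx; exists x.
apply: le_lt_trans xt.
by have /(scott_like_Fand_ge _ _ _ sp)[_ ] := lexx (Defs.eval (Fand cK (0, 1) p) b).
Qed.

Lemma valueS_forth w n (a : 'I_n -> A) (b : 'I_n -> B) (t : R) c : t <= 1 ->
  value (osucc w) a b < t -> D c -> exists x, value w (snoc a c) (snoc b x) < t.
Proof.
move=> t1 abt Dc; apply/(@eval_Finf_lt _ (phi w (snoc a c)) b t) => //.
  exact: scott_formula_like.
by apply: le_lt_trans abt; have /valueS_le[_ + _] := lexx (value (osucc w) a b); exact.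
Qed.

Lemma valueS_back w n (a : 'I_n -> A) (b : 'I_n -> B) (t : R) x : t <= 1 ->
  value (osucc w) a b < t -> exists2 c, D c & value w (snoc a c) (snoc b x) < t.
Proof.
move=> t1 abt; have /valueS_le[_ _ /(_ x) h] := lexx (value (osucc w) a b).
have sp k : scott_like Omega (phi w (snoc a (@sval _ D k))) by exact: scott_formula_like.
have /(eval_Fand_lt _ _ sp t1)[[c Dc] ct] := le_lt_trans h abt.
by exists c.
Qed.

(** If one of the infima exceeded [t], it would itself be an admissible [s], being at most 1, and no
    witness can lie strictly below it. *)
Lemma valueS_leP w n (a : 'I_n -> A) (b : 'I_n -> B) (t : R) : 0 <= t ->
  (forall c s, D c -> t < s -> s <= 1 -> exists x, value w (snoc a c) (snoc b x) < s) ->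
  (forall x s, t < s -> s <= 1 -> exists2 c, D c & value w (snoc a c) (snoc b x) < s) ->
  value (osucc w) a b <= t.
Proof.
move=> t0 forth back; apply/valueS_le; split => // [c Dc|x]; rewrite leNgt; apply/negP => lt.
- have sp : scott_like Omega (phi w (snoc a c)) by exact: scott_formula_like.
  have [|x] := forth c _ Dc lt; first exact: (scott_like_le1 _ (SLinf sp)).
  have /(scott_like_inf_ge _ _ sp)[_ /(_ x)] := lexx (Defs.eval (Finf (phi w (snoc a c))) b).
  by rewrite leNgt => /negP.
- set q := Fand _ _ _ in lt; have sp k : scott_like Omega (phi w (snoc a (@sval _ D k))) by
  exact: scott_formula_like.
  have [|c Dc] := back x _ lt; first exact: (scott_like_le1 _ (SLand _ sp)).
  have /(scott_like_Fand_ge _ _ _ sp)[_ /(_ (exist _ c Dc))] := lexx (Defs.eval q (snoc b x)).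
  by rewrite leNgt => /negP.
Qed.

Lemma value_lim_le w n (a : 'I_n -> A) (b : 'I_n -> B) (t : R) : is_limit w ->
  value w a b <= t <-> 0 <= t /\ forall v, olt v w -> value v a b <= t.
Proof.
move=> lw; rewrite /scott_value scott_formula_lim // scott_like_For_le; last first.
  by move=> v; exact: scott_formula_like.
by split=> -[t0 h]; split => // v; [move=> vw; exact: (h (exist _ v vw))|exact/h/(svalP v)].
Qed.

End ScottFormula.

Definition lift_increasing k n (s : 'I_k -> 'I_n) : 'I_k.+1 -> 'I_n.+1 :=
  snoc (fun i => lift ord_max (s i)) ord_max.

Lemma lift_increasingP k n (s : 'I_k -> 'I_n) :
  strictly_increasing s -> strictly_increasing (lift_increasing s).
Proof.
move=> si i j; rewrite /lift_increasing /snoc.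
case: unliftP => [i' ->|->]; case: unliftP => [j' ->|->] ; rewrite ?lift_max //=.
- exact: si.
- by rewrite ltnNge (ltnW (ltn_ord _)).
- by rewrite ltnn.
Qed.

Lemma snoc_lift_increasing (T : Type) k n (s : 'I_k -> 'I_n) (a : 'I_n -> T) c :
  snoc (fun i => a (s i)) c = (fun i => snoc a c (lift_increasing s i)).
Proof.
apply/funext => i; rewrite /lift_increasing [in LHS]/snoc [X in snoc a c X]/snoc.
by case: unlift => [j|]; rewrite ?snoc_lift ?snoc_max.
Qed.

Lemma lift_max_increasing n : strictly_increasing (fun i : 'I_n => lift ord_max i).
Proof. by move=> i j; rewrite !lift_max. Qed.

Section ScottFormulaMonotone.
Variables (R : realType) (L : signature R) (Omega : (nat -> R) -> \bar R).
Variables (A : structure L) (D : set A) (cD : countable D).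
Variables (E : forall n, set (basic L n)) (cE : forall n, countable (@E n)).
Hypothesis dE : forall n, dense_basic01 Omega (@E n).
Hypothesis wO : is_weak_modulus Omega.
Hypothesis sO : shift_increasing Omega.
Variable B : structure L.

Local Notation value := (scott_value cD cE).

(** Dummy variables may be inserted into basic formulas because [Omega] is shift-increasing. At
    successors, an answer found for the long tuples also serves the short ones. This allows
    subtuples to be extracted from a play. *)
Lemma value_reindex w k n (s : 'I_k -> 'I_n) (a : 'I_n -> A) (b : 'I_n -> B) :
  strictly_increasing s -> value w (fun i => a (s i)) (fun i => b (s i)) <= value w a b.
Proof.
elim/omega1_ind: w k n s a b => [|w IH|w lw IH] k n s a b si.
- apply/(value0_le _ _ dE); split=> [|p [pO pb]]; first exact: (value_ge0 _ _ dE).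
  have /(value0_le _ _ dE)[_ /(_ (basic_rename s p))] := lexx (value ozero a b).
  by rewrite !basic_rename_eval; apply; split=> //; exact: basic_respects_rename.
- apply: (valueS_leP dE) => [|c t Dc abt t1|x t abt t1]; first exact: (value_ge0 _ _ dE).
    have [x xt] := valueS_forth dE t1 abt Dc; exists x; apply: le_lt_trans xt.
    have := IH _ _ _ (snoc a c) (snoc b x) (lift_increasingP si).
    by rewrite -!snoc_lift_increasing.
  have [c Dc ct] := valueS_back dE x t1 abt; exists c => //; apply: le_lt_trans ct.
  have := IH _ _ _ (snoc a c) (snoc b x) (lift_increasingP si).
  by rewrite -!snoc_lift_increasing.
- apply/(value_lim_le _ _ dE) => //; split=> [|v vw]; first exact: (value_ge0 _ _ dE).
  apply: le_trans (IH v vw _ _ _ _ _ si) _.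
  by have /(value_lim_le _ _ dE _ _ _ lw)[_] := lexx (value w a b); exact.
Qed.

(** A successor step is informative only if some move can be played: the point [x] is answered in
    [D], and then the last position is forgotten. *)
Lemma value0_le_value (x : B) w n (a : 'I_n -> A) (b : 'I_n -> B) :
  value ozero a b <= value w a b.
Proof.
elim/omega1_ind: w n a b => [|w IH|w lw IH] n a b //.
  rewrite leNgt; apply/negP => lt.
  have [|c Dc] := valueS_back dE x _ lt; first exact: (value_le1 _ _ dE).
  rewrite ltNge => /negP; apply; apply: le_trans (IH _ _ _).
  have := value_reindex ozero (snoc a c) (snoc b x) (@lift_max_increasing n).
  by under eq_fun do rewrite snoc_lift; under [X in value _ _ X]eq_fun do rewrite snoc_lift.
have /(value_lim_le _ _ dE _ _ _ lw)[_ h] := lexx (value w a b).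
by have [v vw] := lw.1; apply: le_trans (h v vw); exact: IH.
Qed.

Lemma value_basic01 (x : B) w n (a : 'I_n -> A) (b : 'I_n -> B) p :
  basic01 Omega (n:=n) p -> `|basic_eval p a - basic_eval p b| <= value w a b.
Proof.
move=> p01; apply: le_trans (value0_le_value x w a b).
by have /(value0_le _ _ dE)[_] := lexx (value ozero a b); exact.
Qed.

(** Here [a] is a parameter from which the formula is built, not a value of its variables, so
    continuity of formulas does not apply and an induction on [w] is made. The error does not grow
    with [w], since both tuples receive the same new entry. *)
Lemma value_continuousl w n (a a' : 'I_n -> A) (b : 'I_n -> B) (e : R) :
  (wrestrict Omega (fun i => mdist (a i) (a' i)) <= e%:E)%E ->
  value w a b <= value w a' b + e.
Proof.
elim/omega1_ind: w n a a' b => [|w IH|w lw IH] n a a' b aae.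
all: have e0 := wrestrict_mdist_ge0 wO aae.
- apply/(value0_le _ _ dE); split=> [|p p01]; first by rewrite addr_ge0 // (value_ge0 _ _ dE).
  have /(value0_le _ _ dE)[_ /(_ p p01)] := lexx (value ozero a' b).
  have := basic_respects_dist a a' p01.1; move=> /le_trans/(_ aae); rewrite lee_fin.
  have := ler_distD (basic_eval p a') (basic_eval p a) (basic_eval p b); lra.
- apply: (valueS_leP dE) => [|c t Dc abt t1|x t abt t1].
  + by rewrite addr_ge0 // (value_ge0 _ _ dE).
  + have [||x xt] := @valueS_forth _ _ _ _ _ cD _ cE dE _ w n a' b (t - e) c _ _ Dc; [lra|lra|].
    exists x; apply: le_lt_trans (IH _ _ (snoc a' c) _ _) _; last by lra.
    by rewrite wrestrict_mdist_snoc.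
  + have [||c Dc ct] := @valueS_back _ _ _ _ _ cD _ cE dE _ w n a' b (t - e) x; [lra|lra|].
    exists c => //; apply: le_lt_trans (IH _ _ (snoc a' c) _ _) _; last by lra.
    by rewrite wrestrict_mdist_snoc.
- apply/(value_lim_le _ _ dE) => //; split=> [|v vw];
  first by rewrite addr_ge0 // (value_ge0 _ _ dE).
  apply: le_trans (IH v vw _ _ _ _ aae) _; rewrite lerD2r.
  by have /(value_lim_le _ _ dE _ _ _ lw)[_] := lexx (value w a' b); exact.
Qed.

End ScottFormulaMonotone.

(** * Plays in which every listed point recurs infinitely often *)

Section Game.
Variables (A B : Type) (S : forall n, ('I_n -> A) -> ('I_n -> B) -> Prop).
Variables (X : nat -> A) (Y : nat -> B).
Hypothesis forth : forall n (a : 'I_n -> A) (b : 'I_n -> B) j,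
  S a b -> exists y, S (snoc a (X j)) (snoc b y).
Hypothesis back : forall n (a : 'I_n -> A) (b : 'I_n -> B) j,
  S a b -> exists x, S (snoc a x) (snoc b (Y j)).

(** A map from the naturals onto themselves with infinite fibres: [k.+1 = 2 ^ j * p.*2.+1] is sent
    to [j]. *)
Definition bookkeeping (k : nat) : nat := logn 2 k.+1.

Lemma bookkeepingP j p : exists2 k, (p <= k)%N & bookkeeping k = j.
Proof.
exists (2 ^ j * p.*2.+1).-1%N.
  rewrite -ltnS prednK ?muln_gt0 ?expn_gt0//.
  by rewrite (leq_trans _ (leq_pmull _ _)) ?expn_gt0// ltnS -addnn leq_addr.
rewrite /bookkeeping prednK ?muln_gt0 ?expn_gt0// lognM ?expn_gt0// pfactorK//.
by rewrite logn_coprime ?addn0// coprime2n /= odd_double.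
Qed.

Lemma game_sequences n0 (a0 : nat -> A) (b0 : nat -> B) :
  S (fun i : 'I_n0 => a0 i) (fun i : 'I_n0 => b0 i) ->
  exists (a : nat -> A) (b : nat -> B),
  [/\ forall i, (i < n0)%N -> a i = a0 i /\ b i = b0 i,
      forall m, (n0 <= m)%N -> S (fun i : 'I_m => a i) (fun i : 'I_m => b i),
      forall j p, exists2 i, (p <= i)%N & a i = X j &
      forall j p, exists2 i, (p <= i)%N & b i = Y j].
Proof.
move=> S0.
(* A state consists of total sequences of which only the first [k + n0] entries count, which avoids
   tuples of varying length. Even moves play from [X], odd moves from [Y]. *)
have /choice[F FP] : forall st : nat * ((nat -> A) * (nat -> B)),
  let m := (st.1 + n0)%N in
  exists st' : (nat -> A) * (nat -> B),
  S (fun i : 'I_m => st.2.1 i) (fun i : 'I_m => st.2.2 i) ->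
  [/\ S (fun i : 'I_m.+1 => st'.1 i) (fun i : 'I_m.+1 => st'.2 i),
    forall i, (i < m)%N -> st'.1 i = st.2.1 i /\ st'.2 i = st.2.2 i &
    if odd st.1 then st'.2 m = Y (bookkeeping st.1./2)
    else st'.1 m = X (bookkeeping st.1./2)].
  move=> [k [a b]] /=; set m := (k + n0)%N.
  have [Sab|] := pselect (S (fun i : 'I_m => a i) (fun i : 'I_m => b i)); last by exists (a, b).
  have ext c d : S (snoc (fun i : 'I_m => a i) c) (snoc (fun i : 'I_m => b i) d) ->
      exists st : (nat -> A) * (nat -> B), [/\
      S (fun i : 'I_m.+1 => st.1 i) (fun i : 'I_m.+1 => st.2 i),
      forall i, (i < m)%N -> st.1 i = a i /\ st.2 i = b i,
      st.1 m = c & st.2 m = d].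
    pose a' i := if (i < m)%N then a i else c; pose b' i := if (i < m)%N then b i else d.
    have a'm : (fun i : 'I_m => a i) = (fun i : 'I_m => a' i).
      by apply/funext => i; rewrite /a' ltn_ord.
    have b'm : (fun i : 'I_m => b i) = (fun i : 'I_m => b' i).
      by apply/funext => i; rewrite /b' ltn_ord.
    have {1}-> : c = a' m by rewrite /a' ltnn.
    have {1}-> : d = b' m by rewrite /b' ltnn.
    rewrite a'm b'm !snocE => S'; exists (a', b') => /=; split=> //.
    - by move=> i im; rewrite /a' /b' im.
    - by rewrite /a' ltnn.
    - by rewrite /b' ltnn.
  have [ok|ek] := boolP (odd k).
    have [c /ext[st [h1 h2 h3 h4]]] := back (bookkeeping k./2) Sab.
    by exists st.
  have [d /ext[st [h1 h2 h3 h4]]] := forth (bookkeeping k./2) Sab.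
  by exists st.
pose st := fix st k := if k is k'.+1 then F (k', st k') else (a0, b0).
have Sst k : S (fun i : 'I_(k + n0) => (st k).1 i) (fun i : 'I_(k + n0) => (st k).2 i).
  elim: k => [//|k IH]; by have [] := FP (k, st k) IH.
have agree k l i : (k <= l)%N -> (i < k + n0)%N ->
    (st l).1 i = (st k).1 i /\ (st l).2 i = (st k).2 i.
  move=> kl ik; elim: l kl => [|l IH]; first by rewrite leqn0 => /eqP ->.
  rewrite leq_eqVlt => /predU1P[->//|]; rewrite ltnS => kl.
  have [h1 h2] := IH kl; have [_ /(_ i) + _] := FP (l, st l) (Sst l).
  rewrite -h1 -h2; apply => /=.
  by apply: leq_trans ik _; rewrite leq_add2r.
(* Position [i] is settled by stage [i.+1] even when [n0 = 0], and later stages do not change it. *)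
pose a i := (st i.+1).1 i; pose b i := (st i.+1).2 i.
have ab k i : (i < k + n0)%N -> (st k).1 i = a i /\ (st k).2 i = b i.
  move=> ik; rewrite /a /b; have ii : (i < i.+1 + n0)%N by rewrite ltn_addr.
  have [h1 h2] := agree k (maxn k i.+1) i (leq_maxl _ _) ik.
  have [h3 h4] := agree i.+1 (maxn k i.+1) i (leq_maxr _ _) ii.
  by rewrite -h1 -h2 -h3 -h4.
exists a, b; split=> [i in0|m n0m|j p|j p].
- by have [<- <-] := ab 0%N i in0.
- have := Sst (m - n0)%N; rewrite subnK //.
  set f := fun _ => _; set g := fun _ => _.
  have -> : f = (fun i : 'I_m => a i).
    by apply/funext => i; rewrite /f (ab _ _ _).1 // subnK.
  have -> // : g = (fun i : 'I_m => b i).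
  by apply/funext => i; rewrite /g (ab _ _ _).2 // subnK.
- have [k pk kj] := bookkeepingP j p; exists (k.*2 + n0)%N.
    by apply: leq_trans pk _; rewrite -addnn -addnA leq_addr.
  have [_ _] := FP (k.*2, st k.*2) (Sst _); rewrite /= odd_double doubleK kj => <-.
  by rewrite -(ab k.*2.+1 _ _).1.
- have [k pk kj] := bookkeepingP j p; exists (k.*2.+1 + n0)%N.
    by apply: leq_trans pk _; rewrite -addnn addSn leqW // -addnA leq_addr.
  have [_ _] := FP (k.*2.+1, st k.*2.+1) (Sst _).
  rewrite /= odd_double uphalf_double kj => <-.
  by rewrite -(ab k.*2.+2 _ _).2.
Qed.

End Game.
(** * Back-and-forth sequences and embeddings *)

(** Weak moduli depend on the order of the variables, so a tuple must be located in the play at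
    increasing positions. Infinite recurrence allows each entry to be found after the preceding
    ones. *)
Lemma increasing_occurrences (T : Type) (a : nat -> T) (P : T -> Prop) :
  (forall x, P x -> forall p, exists2 i, (p <= i)%N & a i = x) ->
  forall k (x : 'I_k -> T) p, (forall i, P (x i)) -> exists s : 'I_k -> nat,
  [/\ forall i j : 'I_k, (i < j)%N -> (s i < s j)%N, forall i, (p <= s i)%N &
    forall i, a (s i) = x i].
Proof.
move=> aP; elim=> [|k IH] x p Px.
  by exists (fun=> 0%N); split=> -[].
have [s [si sp sx]] := IH (fun i => x (lift ord_max i)) p (fun i => Px _).
have [q pq qx] := aP _ (Px ord_max) (p + \sum_(i < k) (s i).+1)%N.
have sq i : (s i < q)%N.
  apply: leq_trans pq; apply: leq_trans (leq_addl _ _).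
  by rewrite (bigD1 i) //= leq_addr.
exists (snoc s q); split=> [i j|i|i]; rewrite /snoc.
- case: unliftP => [i' ->|->]; case: unliftP => [j' ->|->]; rewrite ?lift_max /= ?ltnn //.
    exact: si.
  by rewrite ltnNge (ltnW (ltn_ord _)).
- by case: unliftP => [i' _|_]; rewrite ?sp// (leq_trans (leq_addr _ _) pq).
- by case: unliftP => [i' ->|->].
Qed.

Section Embeddings.
Variables (R : realType) (L : signature R).

Definition embedding (A B : structure L) (g : A -> B) : Prop :=
  [/\ isometric g,
    forall F (x : 'I_(farity F) -> A), g (fint x) = fint (fun i => g (x i)) &
    forall (P : psym L) (x : 'I_(parity P) -> A), pint (fun i => g (x i)) = pint x].

Definition dist_atom : atomic L 2 := @Atomic R L 2 None (fun i => Var L i).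

Lemma dist_atom_eval (A : structure L) (c : 'I_2 -> A) :
  atomic_eval dist_atom c = mdist (c ord0) (c ord_max).
Proof. by []. Qed.

(** The formula d(F(x), y). It vanishes at y = F(x), so a map preserving its values commutes with
    [F]. *)
Definition graph_atom (F : Defs.fsym L) : atomic L (farity F).+1 :=
  @Atomic R L (farity F).+1 None
    (fun i : 'I_2 => if i == ord0 then App (fun j => Var L (lift ord_max j)) else Var L ord_max).

Lemma graph_atom_eval (F : Defs.fsym L) (A : structure L) (x : 'I_(farity F) -> A) y :
  atomic_eval (graph_atom F) (snoc x y) = mdist (fint x) y.
Proof.
rewrite /atomic_eval /= snoc_max; congr mdist; congr fint.
by apply/funext => i; rewrite snoc_lift.
Qed.

Lemma atomic_embedding (A B : structure L) (g : A -> B) : isometric g ->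
  (forall k (q : atomic L k) (x : 'I_k -> A), atomic_eval q (fun i => g (x i)) = atomic_eval q x) ->
  embedding g.
Proof.
move=> gi gq; split=> // [F x|P x];
  last by have := gq _ (Atomic (fun i : 'I_(parity P) => Var L i)) x.
apply/esym/mdist_positivity.
have := gq _ (graph_atom F) (snoc x (fint x)).
by rewrite snoc_comp !graph_atom_eval mdistxx.
Qed.

Lemma embedding_aut (A : structure L) (g : A -> A) : embedding g ->
  (forall y, exists x, g x = y) -> exists h : aut A, forall x, h x = g x.
Proof.
move=> [gi gF gP] gs; have gb : bijective g.
  have [h hP] := choice gs; exists h => // x.
  by apply: (isometric_inj gi); rewrite hP.
by exists (@Aut R L A g gb gF gP).
Qed.

Lemma tcat_comp (T U : Type) (f : T -> U) k n (a : 'I_k -> T) (b : 'I_n -> T) :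
  (fun i => f (tcat a b i)) = tcat (fun i => f (a i)) (fun i => f (b i)).
Proof. by apply/funext => i; rewrite /tcat; case: fintype.split. Qed.

Lemma tcat_increasing m k n (f : 'I_k -> 'I_m) (g : 'I_n -> 'I_m) :
  strictly_increasing f -> strictly_increasing g -> (forall i j, (f i < g j)%N) ->
  strictly_increasing (tcat f g).
Proof.
move=> fi gi fg i j; rewrite /tcat.
case: splitP => i' ->; case: splitP => j' ->.
- exact: fi.
- by move=> _; exact: fg.
- by rewrite ltnNge (leq_trans (ltnW (ltn_ord j')) (leq_addr _ _)).
- by rewrite ltn_add2l; exact: gi.
Qed.

Lemma tcat0_ge0 k n (u : 'I_n -> R) : nonneg_fun u -> nonneg_fun (tcat (fun _ : 'I_k => 0) u).
Proof. by move=> u0 i; rewrite /tcat; case: fintype.split. Qed.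

Variable Omega : (nat -> R) -> \bar R.
Hypothesis hO : universal_weak_modulus L Omega.

Let wO := universal_is_weak hO.
Let sO := universal_shift hO.

Lemma atomic_small k (q : atomic L k) (e : R) : 0 < e ->
  exists2 d : R, 0 < d & forall u, nonneg_fun u -> (forall i, u i <= d) -> atomic_mod q u <= e.
Proof.
move=> e0; have [p pP] := universal_atomic hO q.
have [d d0 dP] := wrestrict_small wO (p + k) e0; exists d => // u u0 ud.
rewrite -lee_fin; apply: le_trans (pP u u0) _; apply: dP; first exact: tcat0_ge0.
by move=> i; rewrite /tcat; case: fintype.split => // _; exact: ltW.
Qed.

(** [p1] zeros bring the modulus of [q] under [Omega], and [p2] further zeros absorb the factor [M].
    Since [Omega] is shift-increasing, the variables may then be spread out to any increasing
    positions past [p2 + p1]. *)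
Lemma atomic_scaled_respects k (q : atomic L k) (M : R) : 0 < M ->
  exists p, forall m (s : 'I_k -> 'I_m), strictly_increasing s -> (p <= m)%N ->
    (forall i, (p <= s i)%N) ->
    basic_respects Omega (atomic_scaled (atomic_rename s q) M).
Proof.
move=> M0; have [p1 p1P] := universal_atomic hO q.
have [p2 p2P] := universal_scale hO (p1 + k) M0.
exists (p2 + p1)%N => m s si pm ps u u0.
apply: (@le_trans _ _ (M%:E * (atomic_mod q (u \o s))%:E)%E).
  by rewrite -EFinM lee_fin -atomic_rename_mod; apply: atomic_scaled_mod => //; exact: ltW.
have us0 : nonneg_fun (u \o s) by move=> i; exact: u0.
apply: (@le_trans _ _ (M%:E * wrestrict Omega (tcat (fun _ : 'I_p1 => 0%R) (u \o s)))%E).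
  by apply: lee_wpmul2l; [rewrite lee_fin ltW|exact: p1P].
apply: le_trans (p2P _ _) _; first exact: tcat0_ge0.
have h1 (i : 'I_p1) : (p2 + i < m)%N by rewrite (leq_trans _ pm)// ltn_add2l.
have h2 (i : 'I_p2) : (i < m)%N by rewrite (leq_trans _ pm)// ltn_addr.
pose s1 : 'I_(p1 + k) -> 'I_m := tcat (fun i => Ordinal (h1 i)) s.
have s1i : strictly_increasing s1.
  apply: tcat_increasing => // [i j /=|i j]; first by rewrite ltn_add2l.
  by rewrite /= (leq_trans _ (ps j))// ltn_add2l.
pose s2 : 'I_(p2 + (p1 + k)) -> 'I_m := tcat (fun i => Ordinal (h2 i)) s1.
have s2i : strictly_increasing s2.
  apply: tcat_increasing => // i j; rewrite /= /s1 /tcat.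
  case: fintype.split => [j'|j'] /=; first by rewrite ltn_addr.
  by rewrite (leq_trans _ (ps j')) // ltn_addr.
(* The inserted zeros are placed in the first [p2 + p1] positions, so the padded tuple is [v] read
   along [s2], and [v] is below [u]. *)
pose v (i : 'I_m) := if (i < p2 + p1)%N then 0 else u i.
have v0 : nonneg_fun v by move=> i; rewrite /v; case: ifP.
have -> : tcat (fun _ : 'I_p2 => 0) (tcat (fun _ : 'I_p1 => 0) (u \o s)) = v \o s2.
  rewrite /s2 /s1 [RHS](tcat_comp v) (tcat_comp v); congr tcat.
    by apply/funext => i; rewrite /v /= ltn_addr.
  congr tcat; apply/funext => i; rewrite /v /=; first by rewrite ltn_add2l ltn_ord.
  by rewrite ltnNge ps.
apply: le_trans (wrestrict_shift wO sO s2i v0) _.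
by apply: wrestrict_mono => // i; rewrite /v; case: ifP.
Qed.

Definition basic_close K (A B : structure L) m (a : 'I_m -> A) (b : 'I_m -> B) : Prop :=
  forall p, basic01 Omega (n:=m) p -> `|basic_eval p a - basic_eval p b| <= K.

Variable K : R.
Hypothesis K1 : K < 1.

(* Applied to min(|q - c| / e, 1), where c is the value of q at the first tuple: an error
   K < 1 of this formula is an error of at most e K for q. *)
Lemma atomic_tail k (q : atomic L k) (e : R) : 0 < e -> exists p,
  forall (A B : structure L) (a : nat -> A) (b : nat -> B) N,
  (forall m, (N <= m)%N -> basic_close K (fun i : 'I_m => a i) (fun i : 'I_m => b i)) ->
  forall s : 'I_k -> nat, (forall i j : 'I_k, (i < j)%N -> (s i < s j)%N) ->
  (forall i, (p <= s i)%N) ->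
  `|atomic_eval q (fun i => a (s i)) - atomic_eval q (fun i => b (s i))| <= e.
Proof.
move=> e0; have M0 : 0 < e^-1 by rewrite invr_gt0.
have [p pP] := atomic_scaled_respects q M0.
exists p => A B a b N ab s si sp.
pose m := (N + p + \sum_(i < k) (s i).+1)%N.
have sm i : (s i < m)%N.
  apply: leq_trans (leq_addl _ _).
  by rewrite (bigD1 i) //= leq_addr.
have := ab m (leq_trans (leq_addr _ _) (leq_addr _ _)).
pose t i := Ordinal (sm i); have ti : strictly_increasing t by move=> i j /si.
have pm : (p <= m)%N by rewrite -[m]addnA addnCA leq_addr.
move=> /(_ (truncate (atomic_scaled (atomic_rename t q) e^-1) (e^-1 * atomic_eval q (fun i => a
  (s i))))).
move=> /(_ (truncate_basic01 _ (pP m t ti pm sp))).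
rewrite !truncate_eval /basic_eval /= !atomic_rename_eval /comp /= subrr normr0.
rewrite (min_l ler01) sub0r normrN -mulrBr normrM (gtr0_norm M0) distrC.
set z := `|_ - _|; have z0 : 0 <= z by exact: normr_ge0.
rewrite ger0_norm => [h|]; last by rewrite le_min ler01 mulr_ge0 // ltW.
have : e^-1 * z <= 1.
  by move: h; rewrite /Num.min; case: ltP => [/ltW//|_ /le_lt_trans/(_ K1)]; rewrite ltxx.
by rewrite mulrC ler_pdivrMr // mul1r.
Qed.

Lemma atomic_extend (A B : structure L) (D : set A) (g : A -> B) : isometric g -> dense D ->
  (forall k (q : atomic L k) (x : 'I_k -> A), (forall i, D (x i)) ->
    atomic_eval q (fun i => g (x i)) = atomic_eval q x) ->
  embedding g.
Proof.
move=> gi dD gD; apply: atomic_embedding => // k q x.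
apply/eqP; rewrite -subr_eq0 -normr_le0; apply/ler_addgt0Pr => e e0; rewrite add0r.
have e2 : 0 < e / 2 by rewrite divr_gt0.
have [d d0 dP] := atomic_small q e2.
have /choice[y yP] : forall i, exists y, D y /\ mdist (x i) y < d.
  by move=> i; have [y Dy xy] := dense_approx (x i) dD d0; exists y.
have h1 := atomic_respects q x y.
have h2 := atomic_respects q (fun i => g (x i)) (fun i => g (y i)).
have /dP h : nonneg_fun (fun i => mdist (x i) (y i)) by move=> i; exact: mdist_ge0.
have {}h := h (fun i => ltW (yP i).2).
have e1 : (fun i => mdist (g (x i)) (g (y i))) = (fun i => mdist (x i) (y i)).
  by apply/funext => i; exact: gi.
move: h2; rewrite e1 (gD _ q y (fun i => (yP i).1)) => h2.
have := ler_distD (atomic_eval q y) (atomic_eval q (fun i => g (x i))) (atomic_eval q x).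
rewrite (distrC (atomic_eval q y)); lra.
Qed.

(** By [atomic_tail] for the distance, the partners in [B] of the late occurrences of one point of
    [A] are close to each other; their limit is its image. The rate [p] depends neither on the
    structures nor on the play, so a pair can be placed at a late position before the play starts,
    with control over its image. *)
Lemma limit_embedding : exists p : R -> nat,
  forall (A B : structure L) (D : set A) (a : nat -> A) (b : nat -> B) N,
  dense D -> (forall i, D (a i)) ->
  (forall x, D x -> forall p, exists2 i, (p <= i)%N & a i = x) ->
  (forall m, (N <= m)%N -> basic_close K (fun i : 'I_m => a i) (fun i : 'I_m => b i)) ->
  exists g : A -> B, [/\ embedding g,
    forall e, 0 < e -> forall i, (p e <= i)%N -> mdist (b i) (g (a i)) <= e &
    forall y, (forall p, exists2 i, (p <= i)%N & b i = y) -> exists x, g x = y].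
Proof.
have /choice[p pP] : forall e : R, exists p : nat, 0 < e ->
    forall (A B : structure L) (a : nat -> A) (b : nat -> B) N,
    (forall m, (N <= m)%N -> basic_close K (fun i : 'I_m => a i) (fun i : 'I_m => b i)) ->
    forall i j, (p <= i)%N -> (i < j)%N -> `|mdist (a i) (a j) - mdist (b i) (b j)| <= e.
  move=> e; have [e0|] := pselect (0 < e); last by exists 0%N.
  have [p pP] := atomic_tail dist_atom e0; exists p => _ A B a b N ab i j pi ij.
  have := pP A B a b N ab (pair2 i j); rewrite !dist_atom_eval; apply.
    by move=> [[|[|//]] ?] [[|[|//]] ?].
  by move=> [[|[|//]] ?]; rewrite /pair2 /= ?(leq_trans pi)// ltnW.
exists p => A B D a b N dD aD aX ab.
have {}pP e (e0 : 0 < e) := pP e e0 A B a b N ab.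
have cB := @carrier_complete R L B.
have /choice[g0 g0P] : forall x, exists y, D x ->
    forall e, 0 < e -> forall i, (p e <= i)%N -> a i = x -> mdist (b i) y <= e.
  move=> x; have [Dx|] := pselect (D x); last by exists (b 0%N).
  (* One sequence of occurrences of [x] defines the limit; [close] then shows that all late
     occurrences approach it. *)
  have /choice[o oP] : forall n, exists i, (n <= i)%N /\ a i = x.
    by move=> n; have [i ni ix] := aX x Dx n; exists i.
  have close e i j : 0 < e -> (p e <= i)%N -> (p e <= j)%N -> a i = x -> a j = x ->
      mdist (b i) (b j) <= e.
    move=> e0; wlog ij : i j / (i < j)%N => [hw|] pi pj ix jx.
      have [ij|ji|->] := ltngtP i j; first exact: hw.
        by rewrite metric_sym; exact: hw.
      by rewrite mdistxx ltW.
    have := pP e e0 i j pi ij; rewrite ix jx mdistxx sub0r normrN.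
    by rewrite ger0_norm // mdist_ge0.
  have [|y yP] := @complete_seq_cvg _ _ (b \o o) cB.
    move=> e e0; have e2 : 0 < e / 2 by rewrite divr_gt0.
    exists (p (e / 2)) => i j pi pj; apply: le_lt_trans (close _ _ _ e2 _ _ _ _) _.
    - exact: leq_trans pi (oP i).1.
    - exact: leq_trans pj (oP j).1.
    - exact: (oP i).2.
    - exact: (oP j).2.
    - by rewrite ltr_pdivrMr // ltr_pMr // ltr1n.
  exists y => _ e e0 i pi ix; apply/ler_addgt0Pr => d d0.
  have [n [/= nd pn]] := filter_ex (filterI (yP d d0) (nbhs_infty_ge (p e))).
  apply: (le_trans (metric_triangle _ (b (o n)) _)); apply: lerD; last exact: ltW.
  by apply: close => //; [exact: leq_trans pn (oP n).1|exact: (oP n).2].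
have g0i x y : D x -> D y -> mdist (g0 x) (g0 y) = mdist x y.
  move=> Dx Dy; apply/eqP; rewrite -subr_eq0 -normr_le0.
  apply/ler_addgt0Pr => e e0; rewrite add0r.
  have e3 : 0 < e / 3 by rewrite divr_gt0.
  (* The occurrence of [y] is taken after that of [x], because positions are only compared in
     increasing order. *)
  have [i pi ix] := aX x Dx (p (e / 3)); have [j ij jy] := aX y Dy i.+1.
  have := pP _ e3 i j pi ij; rewrite ix jy.
  have := g0P x Dx _ e3 i pi ix; have := g0P y Dy _ e3 j (leq_trans pi (ltnW ij)) jy.
  have := mdist_lipschitz (b i) (g0 x) (b j) (g0 y).
  have := ler_distD (mdist (b i) (b j)) (mdist (g0 x) (g0 y)) (mdist x y).
  rewrite (distrC (mdist (g0 x) (g0 y)) (mdist (b i) (b j))) (distrC (mdist x y)); lra.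
have [g gi gD] := isometric_extension dD cB g0i.
have ga e : 0 < e -> forall i, (p e <= i)%N -> mdist (b i) (g (a i)) <= e.
  by move=> e0 i pi; rewrite gD //; exact: g0P.
exists g; split=> //.
  apply: (atomic_extend gi dD) => k q x Dx.
  apply/eqP; rewrite -subr_eq0 -normr_le0; apply/ler_addgt0Pr => e e0; rewrite add0r.
  have e2 : 0 < e / 2 by rewrite divr_gt0.
  have [r rP] := atomic_tail q e2.
  have [d d0 dP] := atomic_small q e2.
  have [s [si sp sx]] := increasing_occurrences aX (maxn r (p d)) Dx.
  have := rP A B a b N ab s si (fun i => leq_trans (leq_maxl _ _) (sp i)).
  have -> : (fun i => a (s i)) = x by apply/funext.
  have h1 := atomic_respects q (fun i => b (s i)) (fun i => g (x i)).
  have /dP h : nonneg_fun (fun i => mdist (b (s i)) (g (x i))) by move=> i; exact: mdist_ge0.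
  have {}h : atomic_mod q (fun i => mdist (b (s i)) (g (x i))) <= e / 2.
    by apply: h => i; rewrite -sx; apply: ga => //; exact: leq_trans (leq_maxr _ _) (sp i).
  set qb := atomic_eval q (fun i => b (s i)) in h1 *.
  set qg := atomic_eval q (fun i => g (x i)) in h1 *.
  have := ler_distD qb qg (atomic_eval q x).
  rewrite (distrC qg qb) (distrC qb (atomic_eval q x)); lra.
(* A point of [B] that recurs at arbitrarily late positions is a limit of points of the range, which
   is closed. *)
move=> y yb; apply: (isometric_complete_range (@carrier_complete R L A) gi) => e e0.
have e2 : 0 < e / 2 by rewrite divr_gt0.
have [i pi <-] := yb (p (e / 2)); exists (a i).
by apply: le_lt_trans (ga _ e2 i pi) _; rewrite ltr_pdivrMr // ltr_pMr // ltr1n.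
Qed.

End Embeddings.
(** * Models of the Scott sentence *)

Lemma countable_enumeration (T : Type) (D : set T) (x0 : T) : countable D -> D x0 ->
  exists X : nat -> T, (forall j, D (X j)) /\ forall x, D x -> exists j, X j = x.
Proof.
move=> /countable_injP[f finj] Dx0.
have /choice[X XP] : forall j, exists x, D x /\ ((exists2 y, D y & f y = j) -> f x = j).
  move=> j; have [[y Dy yj]|n] := pselect (exists2 y, D y & f y = j); first by exists y.
  by exists x0.
exists X; split=> [j|x Dx]; first exact: (XP j).1.
exists (f x); apply: finj; rewrite ?inE //; first exact: (XP _).1.
by apply: (XP _).2; exists x.
Qed.

Section SupSentence.
Variables (R : realType) (L : signature R).

Lemma eval_Fsups_le (A : structure L) n (p : formula L n) (M t : R) :
  (forall b : 'I_n -> A, Defs.eval p b <= M) -> (bound p).1 <= t ->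
  Defs.eval (Fsups p) (@tnil A) <= t <-> forall b : 'I_n -> A, Defs.eval p b <= t.
Proof.
elim: n p M => [|n IH] p M pM pt /=.
  by split=> [h b|]; [rewrite (tuple0_eq b (@tnil A))|exact].
have pM' (b : 'I_n -> A) : Defs.eval (Fsup p) b <= Num.max M (bound p).1.
  apply/(eval_Fsup_le _ _ pM); split; first by rewrite le_max lexx orbT.
  by move=> c; rewrite le_max pM.
rewrite (IH (Fsup p) _ pM' pt); split=> h b.
  by rewrite (snoc_eta b); have /(eval_Fsup_le _ _ pM)[_] := h (fun i => b (lift ord_max i)); exact.
by apply/(eval_Fsup_le _ _ pM); split.
Qed.

Lemma eval_Fhalfdist (A : structure L) n (p q : formula L n) (a : 'I_n -> A) :
  Defs.eval (Fhalfdist p q) a = 2^-1 * `|Defs.eval p a - Defs.eval q a|.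
Proof. by []. Qed.

Lemma bound_Fhalfdist n (p q : formula L n) :
  bound p = (0, 1) -> bound q = (0, 1) -> (bound (Fhalfdist p q)).1 <= 0.
Proof.
move=> bp bq /=; apply: ge_inf; first by exists 0 => _ [x _ <-]; rewrite mulr_ge0.
exists (fun=> 0); last by rewrite /= subrr normr0 mulr0.
by move=> i; rewrite /pair2; case: ifP => _; rewrite ?bp ?bq /= lexx ler01.
Qed.

End SupSentence.

Section ScottSentenceModels.
Variables (R : realType) (L : signature R) (Omega : (nat -> R) -> \bar R).
Variables (A : structure L) (D : set A) (cD : countable D).
Variables (E : forall n, set (basic L n)) (cE : forall n, countable (@E n)).
Hypothesis dE : forall n, dense_basic01 Omega (@E n).
Variable B : structure L.

Local Notation value := (scott_value cD cE).

(** All components are nonnegative, so the maximum vanishes iff each one is at most 0. The auxiliary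
    bounds [p1] and [s1] ensure that the suprema are taken over bounded sets. *)
Lemma models_scott_sentence : models B (scott_sentence Omega cD cE) <->
  let w := scott_rank Omega A in
  value w (@tnil A) (@tnil B) = 0 /\
  forall n (a : 'I_n -> A) (b : 'I_n -> B), (forall i, D (a i)) ->
    value w a b = value (osucc w) a b.
Proof.
rewrite /models /scott_sentence eval_Fmax; set w := scott_rank Omega A => /=.
pose p (t : {n : nat & 'I_n -> {c : A | D c}}) :=
  Fhalfdist (scott_formula cD cE w (fun i => sval (projT2 t i)))
    (scott_formula cD cE (osucc w) (fun i => sval (projT2 t i))).
have p0 t : (bound (p t)).1 <= 0.
  by apply: bound_Fhalfdist; apply: (@scott_like_bound _ _ Omega); exact: scott_formula_like.
have p1 t (b : 'I__ -> B) : Defs.eval (p t) b <= 1.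
  rewrite eval_Fhalfdist ler_pdivrMl // mulr1.
  have := absdiff01 (_ : 0 <= value w (fun i => sval (projT2 t i)) b <= 1)
    (_ : 0 <= value (osucc w) (fun i => sval (projT2 t i)) b <= 1).
  rewrite !(value_ge0 _ _ dE) !(value_le1 _ _ dE) => /(_ isT isT) /le_trans; apply.
  by rewrite ler1n.
have s1 t : Defs.eval (Fsups (p t)) (@tnil B) <= 1.
  by apply/(eval_Fsups_le (p1 t)) => //; apply: le_trans (p0 t) ler01.
have pE n (a : 'I_n -> {c | D c}) : let a' := fun i => sval (a i) in
    (forall b : 'I_n -> B, Defs.eval (p (existT _ n a)) b <= 0) <->
    forall b : 'I_n -> B, value w a' b = value (osucc w) a' b.
  move=> a'; split=> h b; have := h b; rewrite eval_Fhalfdist /=.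
    rewrite pmulr_rle0 // normr_le0 subr_eq0 => /eqP; exact.
  by rewrite /scott_value => ->; rewrite subrr normr0 mulr0.
split=> [m0|[m0 m1]].
  have : Num.max (value w (@tnil A) (@tnil B)) (Defs.eval (For (countable_tuples cD) (0, 1) (fun
    t => Fsups (p t))) (@tnil B)) <= 0.
    by rewrite -[X in _ <= X]m0.
  rewrite ge_max => /andP[h0 /(eval_For_le _ _ s1)[_ h1]]; split.
    by apply/eqP; rewrite eq_le h0 (value_ge0 _ _ dE).
  move=> n a b Da; pose a' i : {c | D c} := exist _ (a i) (Da i).
  by apply: (pE n a').1 => b'; exact: ((eval_Fsups_le (p1 (existT _ n a')) (p0 _)).1 (h1 _) b').
apply/eqP; rewrite eq_le; apply/andP; split; last first.
  by rewrite le_max; apply/orP; left; exact: (value_ge0 _ _ dE).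
rewrite ge_max; apply/andP; split; first by rewrite -[X in _ <= X]m0.
apply: ((eval_For_le (countable_tuples cD) 0 s1).2); split=> // -[n a];
  apply: (eval_Fsups_le (p1 _) (p0 _)).2.
by apply/pE => b; apply: m1 => i; exact: svalP.
Qed.

End ScottSentenceModels.

Section AutCauchy.
Variables (R : realType) (L : signature R) (A : structure L).

(** The distance from [x] to its image under the inverse of [h i] composed with [h j] equals the
    distance between [h i x] and [h j x]. So pointwise Cauchy sequences are exactly what the left
    uniformity calls Cauchy. *)
Lemma aut_complete_seq (h : nat -> aut A) : complete_space (aut A) ->
  (forall x, seq_cauchy (fun k => h k x)) ->
  exists g : aut A, forall x, seq_cvg (fun k => h k x) (g x).
Proof.
move=> cA hc; have [|g hg] := cA (h @ \oo) _ _.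
  move=> V [U nU UV].
  pose f (t : nat * nat) := aut_mul (aut_inv (h t.1)) (h t.2).
  have ft : f @ filter_prod \oo \oo --> aut1 A.
    apply: aut_fmap_cvgP => x e e0; have [N NP] := hc x e e0.
    exists ([set n | (N <= n)%N], [set n | (N <= n)%N]) => /=.
      by split; exists N.
    move=> [i j] /= [Ni Nj].
    by rewrite -(aut_dist (h i)) aut_inv_funK; exact: NP.
  have [[P Q] /= [hP hQ] PQ] := ft _ nU.
  exists ([set h n | n in P], [set h n | n in Q]) => /=.
    by split; [apply: filterS hP|apply: filterS hQ] => n Pn; exists n.
  by move=> [_ _] /= [[i Pi <-] [j Qj <-]]; apply: UV; exact: (PQ (i, j)).
exists g => x e e0.
have /aut_cvg_distP/(_ x e e0) hge : h @ \oo --> g by exact: hg.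
have : \forall n \near \oo, mdist (g x) (h n x) < e by exact: hge.
by apply: filterS => n /=; rewrite metric_sym.
Qed.

Lemma dense_isometric_surjective (D : set A) (g : A -> A) : dense D -> isometric g ->
  (forall y, D y -> exists x, g x = y) -> forall y, exists x, g x = y.
Proof.
move=> dD gi gD y; apply: (isometric_complete_range (@carrier_complete R L A) gi) => e e0.
by have [z Dz yz] := dense_approx y dD e0; have [x xz] := gD z Dz; exists x; rewrite xz.
Qed.

End AutCauchy.

(** * Complete automorphism group: every model of the Scott sentence is separable *)

Section CompleteToSeparable.
Variables (R : realType) (L : signature R) (Omega : (nat -> R) -> \bar R).
Hypothesis hO : universal_weak_modulus L Omega.
Variables (A : structure L) (D : set A) (cD : countable D).
Hypothesis dD : dense D.
Variables (E : forall n, set (basic L n)) (cE : forall n, countable (@E n)).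
Hypothesis dE : forall n, dense_basic01 Omega (@E n).

Let wO := universal_is_weak hO.
Let sO := universal_shift hO.
Local Notation value := (scott_value cD cE).

Section Model.
Variables (B : structure L) (w : omega1).
Hypothesis stable : forall n (a : 'I_n -> A) (b : 'I_n -> B), (forall i, D (a i)) ->
  value w a b = value (osucc w) a b.
Hypothesis start : value w (@tnil A) (@tnil B) = 0.

(** A position from which the play can go on forever: stability replaces [w] by its successor, so a
    move does not lower the rank. The inequality is strict so that infima yield answers, and [a]
    stays in [D], where stability is assumed. *)
Definition similar (t : R) n (a : 'I_n -> A) (b : 'I_n -> B) : Prop :=
  (forall i, D (a i)) /\ value w a b < t.

Lemma similar_forth t n (a : 'I_n -> A) (b : 'I_n -> B) c : t <= 1 ->
  similar t a b -> D c -> exists x, similar t (snoc a c) (snoc b x).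
Proof.
move=> t1 [Da ab] Dc; have [|x xt] := @valueS_forth _ _ _ _ _ cD _ cE dE _ w n a b t c t1 _ Dc.
  by rewrite -stable.
by exists x; split=> // i; rewrite /snoc; case: unlift.
Qed.

Lemma similar_back t n (a : 'I_n -> A) (b : 'I_n -> B) x : t <= 1 ->
  similar t a b -> exists2 c, D c & similar t (snoc a c) (snoc b x).
Proof.
move=> t1 [Da ab]; have [|c Dc ct] := @valueS_back _ _ _ _ _ cD _ cE dE _ w n a b t x t1 _.
  by rewrite -stable.
by exists c => //; split=> // i; rewrite /snoc; case: unlift.
Qed.

Lemma model_embedding (t : R) (Y : nat -> B) : 0 < t < 1 -> exists g : A -> B,
  [/\ embedding g, forall j, exists x, g x = Y j &
    forall n (x : 'I_n -> A), (forall i, D (x i)) -> value w x (fun i => g (x i)) <= t].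
Proof.
move=> /andP[t0 t1]; have similar0 : similar t (@tnil A) (@tnil B).
  by split; [case|rewrite start].
(* An answer to the first point of [Y] shows that [D] is nonempty, as an enumeration requires. *)
have [c Dc _] := similar_back (Y 0%N) (ltW t1) similar0.
have [X [DX XD]] := countable_enumeration cD Dc.
have [|||a [b [_ ab aX bY]]] := @game_sequences A B (similar t) X Y _ _ 0 (fun=> c) Y _.
- by move=> n a b j sab; apply: similar_forth => //; exact: ltW.
- by move=> n a b j /(similar_back (Y j) (ltW t1))[c' _ ?]; exists c'.
- have -> : (fun _ : 'I_0 => c) = @tnil A by exact: tuple0_eq.
  by have -> : (fun i : 'I_0 => Y i) = @tnil B by exact: tuple0_eq.
have Da i : D (a i) by have [/(_ ord_max)] := ab i.+1 isT.
have aD x : D x -> forall p, exists2 i, (p <= i)%N & a i = x.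
  by move=> /XD[j <-]; exact: aX.
have ab_close m : (0 <= m)%N -> basic_close Omega t (fun i : 'I_m => a i) (fun i : 'I_m => b i).
  move=> _ p p01; have [_ /ltW] := ab m isT; apply: le_trans.
  exact: (value_basic01 cD cE dE wO sO (Y 0%N)).
have [p /(_ A B D a b 0%N dD Da aD ab_close)[g [ge gp gY]]] := limit_embedding hO t1.
exists g; split=> [//|j|n x Dx]; first by apply: gY => q; exact: bY.
(* A late increasing occurrence of [x] has value below [t] against its partners, and replacing these
   by the images under [g] costs at most [e]. *)
apply/ler_addgt0Pr => e e0; have [d d0 dP] := wrestrict_small wO n e0.
have [s [si sp sx]] := increasing_occurrences aD (p d) Dx.
pose m := (\sum_(i < n) (s i).+1)%N.
have sm i : (s i < m)%N by rewrite /m (bigD1 i) //= leq_addr.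
pose s' i := Ordinal (sm i).
have s'i : strictly_increasing s' by move=> i j /si.
have := value_reindex cD cE dE wO sO w (fun i : 'I_m => a i) (fun i : 'I_m => b i) s'i.
rewrite /=; have -> : (fun i => a (s i)) = x by apply/funext.
move=> h; have := (ab m isT).2.
have : value w x (fun i => g (x i)) <= value w x (fun i => b (s i)) + e.
  apply: (value_continuousr _ _ dE wO); apply: dP => i; first exact: mdist_ge0.
  by rewrite metric_sym -sx; exact: gp.
lra.
Qed.

(** [A] is played against itself, a position being kept alive by a common similar tuple in [B]: each
    move is answered first in [B], then in [A]. Both sides exhaust [D], so the limit map is onto,
    hence an automorphism. *)
Lemma automorphism_approximation (g0 g1 : A -> B) (f : A -> A) (X : nat -> A) :
  isometric f -> isometric g1 -> (forall x, g1 (f x) = g0 x) ->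
  (forall j, D (X j)) -> (forall x, D x -> exists j, X j = x) ->
  (forall n (x : 'I_n -> A), (forall i, D (x i)) -> value w x (fun i => g0 (x i)) <= 8^-1) ->
  (forall n (x : 'I_n -> A), (forall i, D (x i)) -> value w x (fun i => g1 (x i)) <= 8^-1) ->
  forall k (e : R), 0 < e ->
  exists h : aut A, forall i, (i < k)%N -> mdist (h (X i)) (f (X i)) < e.
Proof.
move=> fi gi1 gf DX XD g0w g1w k e e0.
have K1 : 3 / 4 < 1 :> R by lra.
have [p pP] := limit_embedding hO K1.
have e2 : 0 < e / 2 by rewrite divr_gt0.
pose N := (p (e / 2) + k)%N.
have e8 : 0 < 8^-1 :> R by rewrite invr_gt0.
have [d d0 dP] := wrestrict_small wO N e8.
have /choice[y yP] : forall j, exists y, D y /\ mdist (f (X j)) y < Num.min d (e / 2).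
  by move=> j; have [|y Dy fy] := dense_approx (f (X j)) dD (_ : 0 < Num.min d (e / 2));
    [rewrite lt_min d0|exists y].
(* 1/8 for the embedding and 1/8 for moving [f (X j)] into [D] stay below 3/8; two errors 3/8 give
   the bound 3/4. *)
pose t : R := 3 / 8; have t1 : t <= 1 by rewrite /t; lra.
pose S n (a a' : 'I_n -> A) := exists b : 'I_n -> B, similar t a b /\ similar t a' b.
(* The pairs to be controlled start at position [p (e / 2)]. By truncated subtraction, the positions
   before it are filled with copies of the first pair. *)
pose a0 i := X (i - p (e / 2)%R)%N; pose b0 i := y (i - p (e / 2)%R)%N.
have [||| a [b [ab0 ab aX bX]]] := @game_sequences A A S X X _ _ N a0 b0 _.
- move=> n a b j [c [ac bc]]; have [x acx] := similar_forth t1 ac (DX j).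
  by have [z _ bcz] := similar_back x t1 bc; exists z, (snoc c x).
- move=> n a b j [c [ac bc]]; have [x bcx] := similar_forth t1 bc (DX j).
  by have [z _ acz] := similar_back x t1 ac; exists z, (snoc c x).
- have Db0 (i : 'I_N) : D (b0 i) by exact: (yP _).1.
  have Da0 (i : 'I_N) : D (a0 i) by exact: DX.
  exists (fun i => g1 (b0 i)); split; split=> //.
    apply: le_lt_trans (_ : 8^-1 + 8^-1 < t); last by rewrite /t; lra.
    apply: le_trans (lerD (g0w _ _ Da0) (lexx _)).
    apply: (value_continuousr _ _ dE wO); apply: dP => i; first exact: mdist_ge0.
    rewrite -gf gi1 metric_sym; apply/ltW/(lt_le_trans (yP _).2).
    by rewrite ge_min lexx.
  by apply: le_lt_trans (g1w _ _ Db0) _; rewrite /t; lra.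
have DS n (a' b' : 'I_n -> A) : S n a' b' -> forall i, D (a' i) by case=> c [[]].
have Da i : D (a i).
  by have := DS _ _ _ (ab (N + i.+1)%N (leq_addr _ _)) (Ordinal (leq_addl N i.+1)).
have aD x : D x -> forall p, exists2 i, (p <= i)%N & a i = x.
  by move=> /XD[j <-]; exact: aX.
have ab_close m : (N <= m)%N -> basic_close Omega (3 / 4) (fun i : 'I_m => a i) (fun i : 'I_m =>
  b i).
  move=> Nm q q01; have [c [[_ ac] [_ bc]]] := ab m Nm.
  have [x0 _] : exists x0 : B, True by exists (g1 (X 0%N)).
  have := value_basic01 cD cE dE wO sO x0 w (fun i : 'I_m => a i) c q01.
  have := value_basic01 cD cE dE wO sO x0 w (fun i : 'I_m => b i) c q01.
  have := ler_distD (basic_eval q c) (basic_eval q (fun i : 'I_m => a i)) (basic_eval q (fun i :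
    'I_m => b i)).
  rewrite (distrC (basic_eval q c)); move: ac bc; rewrite /t; lra.
have [g [ge gp gX]] := pP A A D a b N dD Da aD ab_close.
have [gi _ _] := ge.
have gs : forall y, exists x, g x = y.
  by apply: (dense_isometric_surjective dD gi) => _ /XD[j <-]; apply: gX => q; exact: bX.
have [h hg] := embedding_aut ge gs; exists h => i ik; rewrite hg.
have iN : (p (e / 2) + i < N)%N by rewrite ltn_add2l.
have := gp _ e2 _ (leq_addr i (p (e / 2))); have [-> ->] := ab0 _ iN.
rewrite /a0 /b0 addKn; have := (yP i).2; rewrite lt_min => /andP[_].
have := metric_triangle (g (X i)) (y i) (f (X i)).
rewrite (metric_sym (y i) (g _)) (metric_sym (y i) (f _)); lra.
Qed.

End Model.

Lemma complete_models_separable (B : structure L) : complete_space (aut A) ->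
  models B (scott_sentence Omega cD cE) -> separable B.
Proof.
move=> cA /(models_scott_sentence cD cE dE)[start stable].
have [x0|nB] := pselect (exists x : B, True); last first.
  exists set0; split=> //; apply: approx_dense => x; by case: nB; exists x.
case: x0 => x0 _; have t01 : 0 < (8^-1 : R) < 1 by apply/andP; split; lra.
apply: contrapT => nsep.
have [g0 [[gi0 _ _] _ g0w]] := model_embedding stable start (fun=> x0) t01.
(* If [g0] were onto, the image of [D] would be countable and dense in [B]. *)
have [p pg0] : exists p, ~ exists x, g0 x = p.
  apply: contrapT => allg; apply: nsep; exists (g0 @` D); split.
    exact: sub_countable (card_image_le _ _) cD.
  apply: approx_dense => y e e0.
  have [x <-] : exists x, g0 x = y by apply: contrapT => h; apply: allg; exists y.
  by have [z Dz xz] := dense_approx x dD e0; exists (g0 z); [exists z|rewrite gi0].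
have [|c Dc _] := @similar_back _ _ stable 1 0 (@tnil A) (@tnil B) x0 (lexx _).
  by split; [case|rewrite start].
have [X [DX XD]] := countable_enumeration cD Dc.
(* The range of [g1] is closed and contains [g0] of a dense set, hence the whole range of [g0], and
   [p] besides. *)
pose Y j := if j is j'.+1 then g0 (X j') else p.
have [g1 [[gi1 _ _] g1Y g1w]] := model_embedding stable start Y t01.
have cA0 := @carrier_complete R L A.
have /choice[f gf] : forall x, exists y, g1 y = g0 x.
  move=> x; apply: (isometric_complete_range cA0 gi1) => e e0.
  have [z Dz xz] := dense_approx x dD e0; have [j zj] := XD z Dz.
  by have [y gy] := g1Y j.+1; exists y; rewrite gy /Y zj gi0.
have fi : isometric f by move=> x y; rewrite -gi1 !gf gi0.
have /choice[h hP] : forall k, exists h : aut A,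
    forall i, (i < k)%N -> mdist (h (X i)) (f (X i)) < k.+1%:R^-1.
  move=> k; apply: (automorphism_approximation stable fi gi1 gf DX XD g0w g1w).
  by rewrite invr_gt0.
have hX i : seq_cvg (fun k => h k (X i)) (f (X i)).
  move=> e /invS_lt[N NP]; exists (maxn N i.+1) => // n /=; rewrite geq_max => /andP[Nn iN].
  exact: lt_trans (hP n i iN) (NP n Nn).
have hi n : isometric (h n) by move=> x y; exact: aut_dist.
have [|g hg] := aut_complete_seq cA (h:=h).
  move=> x; have [|y hy] := seq_cvg_dense dD cA0 hi _ x; last exact: seq_cvg_cauchy hy.
  by move=> z /XD[j <-]; exact: seq_cvg_cauchy (hX j).
have fg x : f x = g x.
  apply: mdist_ler_eq => e e0; have e2 : 0 < e / 2 by rewrite divr_gt0.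
  have [z Dz xz] := dense_approx x dD e2; have [j zj] := XD z Dz.
  have fgz : f z = g z by rewrite -zj; apply: seq_cvg_uniq (hX j) (hg _).
  have := metric_triangle (f x) (f z) (g x).
  rewrite fi fgz aut_dist (metric_sym z x); lra.
(* Since [f] agrees with the automorphism [g], it is onto, so [g0] and [g1] have the same range,
   contrary to the choice of [p]. *)
have [z gz] := g1Y 0%N; apply: pg0; exists (aut_inv_fun g z).
by rewrite -gf fg aut_inv_funK.
Qed.

End CompleteToSeparable.
(** * Pointwise limits of automorphisms *)

Section EmbeddingEval.
Variables (R : realType) (L : signature R) (A B : structure L) (g : A -> B).
Hypothesis ge : embedding g.

Lemma embedding_term n (t : term L n) (a : 'I_n -> A) :
  term_eval t (fun i => g (a i)) = g (term_eval t a).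
Proof.
have [_ gF _] := ge; elim: t => [i|F ts IH] //=; rewrite gF; congr fint.
by apply/funext.
Qed.

Lemma embedding_atomic n (q : atomic L n) (a : 'I_n -> A) :
  atomic_eval q (fun i => g (a i)) = atomic_eval q a.
Proof.
have [_ _ gP] := ge; rewrite /atomic_eval -gP; congr pint.
by apply/funext => i; exact: embedding_term.
Qed.

Lemma embedding_basic n (p : basic L n) (a : 'I_n -> A) :
  basic_eval p (fun i => g (a i)) = basic_eval p a.
Proof. by congr basic_fun; apply/funext => i; exact: embedding_atomic. Qed.

End EmbeddingEval.

Lemma seq_cauchy_geometric (R : realType) (T : metricType R) (u : nat -> T) (N : nat) :
  (forall j, (N <= j)%N -> mdist (u j) (u j.+1) <= 2^-1 ^+ j) -> seq_cauchy u.
Proof.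
move=> uN.
have h0 n : 0 < 2^-1 ^+ n :> R by rewrite exprn_gt0 // invr_gt0.
(* The exact geometric sum makes the induction on [k] close without loss. *)
have tail i k : (N <= i)%N -> mdist (u i) (u (i + k)%N) <= 2 * 2^-1 ^+ i - 2 * 2^-1 ^+ (i + k).
  move=> Ni; elim: k => [|k IH]; first by rewrite addn0 mdistxx subrr.
  have := metric_triangle (u i) (u (i + k)%N) (u (i + k).+1).
  have := uN (i + k)%N (leq_trans Ni (leq_addr _ _)).
  by move: IH; rewrite !addnS (exprS _ (i + k)%N); lra.
have bnd i j : (N <= i)%N -> (i <= j)%N -> mdist (u i) (u j) <= 2 * 2^-1 ^+ i.
  by move=> Ni /subnKC <-; have := tail i (j - i)%N Ni; have := h0 (i + (j - i))%N; lra.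
have small (e : R) : 0 < e -> exists n, forall i, (n <= i)%N -> 2 * 2^-1 ^+ i < e.
  move=> e0; have e4 : 0 < e / 2 by rewrite divr_gt0.
  have [n nP] := invS_lt e4; exists n => i ni.
  have : 2^-1 ^+ i <= i.+1%:R^-1 :> R.
    rewrite exprVn lef_pV2 ?posrE ?exprn_gt0//.
    by rewrite -natrX ler_nat ltn_expl.
  by have := nP i ni; move: (i.+1%:R^-1) => r; lra.
move=> e /small[n nP]; exists (maxn N n) => i j.
rewrite !geq_max => /andP[Ni ni] /andP[Nj nj].
have [ij|/ltnW ji] := leqP i j; first exact: le_lt_trans (bnd _ _ Ni ij) (nP i ni).
by rewrite metric_sym; exact: le_lt_trans (bnd _ _ Nj ji) (nP j nj).
Qed.

Section AutLimits.
Variables (R : realType) (L : signature R) (A : structure L).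

(** The closure of the automorphism group among all self-maps of [A], for pointwise convergence. An
    arbitrary finite index type is allowed so that pairs of indices can be used directly. *)
Definition aut_limit (f : A -> A) : Prop :=
  forall (T : finType) (x : T -> A) (e : R), 0 < e ->
    exists g : aut A, forall t, mdist (f (x t)) (g (x t)) < e.

Lemma aut_embedding (g : aut A) : embedding g.
Proof. by split; [exact: aut_dist|exact: aut_fint|exact: aut_pint]. Qed.

Lemma aut_limit_aut (g : aut A) : aut_limit g.
Proof. by move=> T x e e0; exists g => t; rewrite mdistxx. Qed.

Lemma aut_limit_id : aut_limit id.
Proof. exact: (aut_limit_aut (aut1 A)). Qed.

Lemma aut_limit_isometric f : aut_limit f -> isometric f.
Proof.
move=> fl x y; apply/eqP; rewrite -subr_eq0 -normr_le0.
apply/ler_addgt0Pr => e e0; rewrite add0r; have e2 : 0 < e / 2 by rewrite divr_gt0.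
have [g gP] := fl _ (fun b : bool => if b then x else y) _ e2.
have := gP true; have := gP false; rewrite /= -(aut_dist g x y).
have := mdist_lipschitz (f x) (g x) (f y) (g y); lra.
Qed.

Lemma aut_limit_comp f f' : aut_limit f -> aut_limit f' -> aut_limit (f \o f').
Proof.
move=> fl fl' T x e e0; have e2 : 0 < e / 2 by rewrite divr_gt0.
have [g' gP'] := fl' T x _ e2; have [g gP] := fl T (f' \o x) _ e2.
exists (aut_mul g g') => t /=.
have := metric_triangle (f (f' (x t))) (g (f' (x t))) (g (g' (x t))).
by rewrite aut_dist; have := gP t; have := gP' t; rewrite /=; lra.
Qed.

Lemma aut_limit_seq (w : nat -> A -> A) (u : A -> A) : (forall n, aut_limit (w n)) ->
  (forall x, seq_cvg (w ^~ x) (u x)) -> aut_limit u.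
Proof.
move=> wl wu T x e e0; have e2 : 0 < e / 2 by rewrite divr_gt0.
have : \forall n \near \oo, forall t, mdist (w n (x t)) (u (x t)) < e / 2.
  by apply: filter_forall => t; exact: wu.
move=> /filter_ex[n nP]; have [g gP] := wl n T x _ e2; exists g => t.
have := metric_triangle (u (x t)) (w n (x t)) (g (x t)).
by have := nP t; have := gP t; rewrite (metric_sym (u _) (w _ _)); lra.
Qed.

Lemma aut_limit_embedding Omega (hO : universal_weak_modulus L Omega) f :
  aut_limit f -> embedding f.
Proof.
move=> fl; apply: atomic_embedding; first exact: aut_limit_isometric.
move=> k q x; apply/eqP; rewrite -subr_eq0 -normr_le0.
apply/ler_addgt0Pr => e e0; rewrite add0r; have [d d0 dP] := atomic_small hO q e0.
have [g gP] := fl _ x d d0; rewrite -(embedding_atomic (aut_embedding g) q x).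
apply: (le_trans (atomic_respects _ _ _)); apply: dP => i; first exact: mdist_ge0.
exact/ltW/gP.
Qed.

Lemma incomplete_aut_limit Omega (hO : universal_weak_modulus L Omega) :
  ~ complete_space (aut A) ->
  exists2 f, aut_limit f & ~ forall y, exists x, f x = y.
Proof.
move=> nc; apply: contrapT => nf; apply: nc => F PF cF.
have /choice[f fP] : forall x, exists y, forall e : R, 0 < e ->
    F [set h : aut A | mdist y (h x) < e].
  move=> x; have [|y yF] := @carrier_complete R L A ((fun h : aut A => h x) @ F) _ _.
    apply/cauchy_ballP => e e0.
    (* Evaluation at [x] is uniformly continuous for the left uniformity, again because
       automorphisms are isometric. *)
    have /cF[[P Q] /= [FP FQ] PQ] :
        entourage [set gh : aut A * aut A | mdist x (aut_mul (aut_inv gh.1) gh.2 x) < e].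
      by exists [set h : aut A | mdist x (h x) < e] => //; exact: (aut_nearP (aut1 A) x e0).
    exists ([set h x | h in P], [set h x | h in Q]) => /=.
      by split; [apply: filterS FP|apply: filterS FQ] => h Ph /=; exists h.
    move=> [_ _] /= [[g Pg <-] [h Qh <-]]; rewrite ballEmdist /=.
    by have := PQ (g, h) (conj Pg Qh); rewrite /= -(aut_dist g) aut_inv_funK.
  exists y => e e0; have := yF _ (@nbhsx_ballx _ _ y e e0).
  by rewrite ballEmdist.
have fl : aut_limit f.
  move=> T x e e0; have : \forall h \near F, forall t, mdist (f (x t)) ((h : aut A) (x t)) < e.
    by apply: filter_forall => t; exact: fP.
  by move=> /filter_ex[h hP]; exists h.
have [fs|] := pselect (forall y, exists x, f x = y); last by move=> ns; case: nf; exists f.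
have [g gf] := embedding_aut (aut_limit_embedding hO fl) fs.
by exists g; apply/aut_cvg_distP => x e e0; rewrite gf; exact: fP.
Qed.

(* Composing the chain with automorphisms [g l] such that [g l.+1 (m l z)] is
   close to [g l z] makes it converge pointwise to its direct limit. *)
Lemma aut_limit_direct_limit (X : nat -> A) (m : nat -> A -> A) : dense (range X) ->
  (forall k, aut_limit (m k)) ->
  exists u : nat -> A -> A, (forall k, aut_limit (u k)) /\
    forall k x, u k.+1 (m k x) = u k x.
Proof.
move=> dX ml.
(* [c k j] is the composite map from stage [k] to stage [k + j]. *)
pose c k := fix c j (x : A) := if j is j'.+1 then m (k + j')%N (c j' x) else x.
have cl k j : aut_limit (c k j).
  by elim: j => [|j IH]; [exact: aut_limit_id|exact: (aut_limit_comp (ml _) IH)].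
have cS k j x : c k.+1 j (m k x) = c k j.+1 x.
  by elim: j => [|j IH] /=; [rewrite addn0|rewrite IH /= addSnnS].
(* At stage [l] only finitely many points matter: the images of the first [l.+1] points of the dense
   sequence, coming from each of the stages up to [l]. Every given point and stage is eventually
   covered, which gives a geometric Cauchy estimate. *)
have /choice[h hP] : forall l : nat, exists h : aut A, forall t : 'I_l.+1 * 'I_l.+1,
    let z := c t.2 (l - t.2)%N (X t.1) in mdist (m l z) (h z) < 2^-1 ^+ l.
  move=> l; apply: (ml l _ (fun t : 'I_l.+1 * 'I_l.+1 => c t.2 (l - t.2)%N (X t.1))).
  by rewrite exprn_gt0 // invr_gt0.
pose g := fix g l := if l is l'.+1 then aut_mul (g l') (aut_inv (h l')) else aut1 A.
pose w k j x := g (k + j)%N (c k j x).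
have wl k j : aut_limit (w k j) by exact: aut_limit_comp (aut_limit_aut _) (cl k j).
have wc k x : range X x -> seq_cauchy (w k ^~ x).
  move=> [i _ <-]; apply: (@seq_cauchy_geometric _ _ _ i) => j ij.
  rewrite /w addnS /= aut_dist -(aut_dist (h (k + j)%N)) aut_inv_funK.
  have ik : (i < (k + j).+1)%N by rewrite ltnS (leq_trans ij) // leq_addl.
  have kk : (k < (k + j).+1)%N by rewrite ltnS leq_addr.
  have := hP (k + j)%N (Ordinal ik, Ordinal kk); rewrite /= addKn metric_sym => /ltW/le_trans.
  by apply; rewrite ler_wiXn2l // ?leq_addl // ?invr_ge0 // invf_le1 // ler1n.
have cA := @carrier_complete R L A.
have /choice[u uP] : forall k, exists u, forall x, seq_cvg (w k ^~ x) (u x).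
  move=> k; have /choice[u uP] : forall x, exists y, seq_cvg (w k ^~ x) y.
    by apply: (seq_cvg_dense dX cA) => [n|x Xx]; [exact/aut_limit_isometric/wl|exact: wc].
  by exists u.
exists u; split=> [k|k x]; first exact: aut_limit_seq (wl k) (uP k).
have := seq_cvg_shift (uP k x); rewrite /w; under eq_fun do rewrite -cS addnS -addSn.
by move=> ux; exact: seq_cvg_uniq (uP k.+1 (m k x)) ux.
Qed.

End AutLimits.
(** * Coherent systems indexed by omega1 *)

Definition ole (v w : omega1) : Prop := v = w \/ olt v w.

Lemma ole_refl v : ole v v. Proof. by left. Qed.

Lemma olt_ole v w : olt v w -> ole v w. Proof. by right. Qed.

Lemma ole_trans v u w : ole u v -> ole v w -> ole u w.
Proof.
by move=> [->//|uv] [<-|vw]; right => //; exact: olt_trans vw.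
Qed.

Lemma ole_total v w : ole v w \/ ole w v.
Proof.
by have [vw|->|wv] := olt_total v w; [left; right|left; left|right; right].
Qed.

(** Transfinite recursion with a choice at each stage. The row below [w] is only a partial function,
    completed by [x0]; as [good w] looks only below [w], the completion does not affect it. *)
Lemma olt_recursion (X : Type) (x0 : X) (good : omega1 -> (omega1 -> X) -> X -> Prop) :
  (forall w P P' x, (forall v, olt v w -> P v = P' v) -> good w P x -> good w P' x) ->
  exists row : omega1 -> X, forall w, (exists x, good w row x) -> good w row (row w).
Proof.
move=> goodE.
pose total w (rec : forall v, olt v w -> X) v :=
  if pselect (olt v w) is left vw then rec v vw else x0.
pose step w (rec : forall v, olt v w -> X) : X :=
  if pselect (exists x, good w (total w rec) x) is left e then projT1 (cid e) else x0.
pose row := Fix olt_wf (fun=> X) step.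
have rowE w : row w = step w (fun v _ => row v).
  rewrite /row Fix_eq // => {}w f g fg; congr step.
  by apply: functional_extensionality_dep => v; apply/funext => vw.
have totE w v : olt v w -> total w (fun v _ => row v) v = row v.
  by move=> vw; rewrite /total; case: pselect.
exists row => w [x gx]; rewrite rowE /step; case: pselect => [e|[]]; last first.
  by exists x; apply: goodE gx => v vw; rewrite totE.
by case: cid => y /=; apply: goodE => v vw; rewrite totE.
Qed.

Section CoherentSystem.
Variables (R : realType) (L : signature R) (A : structure L).

Definition with_id (F : omega1 -> omega1 -> A -> A) v w : A -> A :=
  if pselect (v = w) then id else F v w.

Lemma with_id_refl F v : with_id F v v = id.
Proof. by rewrite /with_id; case: pselect. Qed.

Lemma with_id_lt F v w : olt v w -> with_id F v w = F v w.
Proof. by rewrite /with_id; case: pselect => //= vw; rewrite vw => /olt_irr. Qed.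

Record coherent_system := CoherentSystem {
  trans :> omega1 -> omega1 -> A -> A;
  trans_id : forall v x, trans v v x = x;
  trans_comp : forall u v w x, ole u v -> ole v w -> trans v w (trans u v x) = trans u w x;
  trans_limit : forall v w, ole v w -> aut_limit (trans v w);
  trans_strict : forall v w, olt v w -> exists y, forall x, trans v w x <> y }.

Section Extension.
Variables (w : omega1) (P : omega1 -> omega1 -> A -> A).
Hypothesis Pl : forall u v, olt u v -> olt v w -> aut_limit (P u v).
Hypothesis Pc : forall s u v x, olt s u -> olt u v -> olt v w -> P u v (P s u x) = P s v x.

Let Q := with_id P.

Let Ql u v : ole u v -> olt v w -> aut_limit (Q u v).
Proof.
move=> [<- _|uv vw]; first by rewrite /Q with_id_refl; exact: aut_limit_id.
by rewrite /Q with_id_lt //; exact: Pl.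
Qed.

Let Qc s u v x : ole s u -> ole u v -> olt v w -> Q u v (Q s u x) = Q s v x.
Proof.
move=> [->|su]; first by rewrite /Q with_id_refl.
move=> [<-|uv] vw; first by rewrite /Q with_id_refl.
rewrite /Q !with_id_lt //; [exact: Pc|exact: olt_trans uv].
Qed.

(* Only countably many stages precede [w], so the direct limit can be taken along a cofinal
   sequence [d] of them. *)
Lemma extend_system (X : nat -> A) (f : A -> A) : dense (range X) -> aut_limit f ->
  exists r : omega1 -> A -> A, forall v, olt v w ->
    (exists r', aut_limit r' /\ forall x, r v x = f (r' x)) /\
    forall u, olt u v -> forall x, r v (P u v x) = r u x.
Proof.
move=> dX fl; have [[v0 v0w]|nw] := pselect (exists v, olt v w); last first.
  by exists (fun=> id) => v vw; case: nw; exists v.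
have [en [enw enP]] := countable_enumeration (countable_below w) v0w.
(* [d] is the running maximum of the enumeration: weakly increasing and cofinal below [w]. When [w]
   is a successor it is eventually constant, which is why identity maps are included in [Q]. *)
pose d := fix d k := if k is k'.+1 then
  (if pselect (olt (d k') (en k'.+1)) then en k'.+1 else d k') else en 0%N.
have dw k : olt (d k) w.
  by elim: k => [|k IH] /=; [exact: enw|case: pselect => dk; [exact: enw|exact: IH]].
have dS k : ole (d k) (d k.+1) by rewrite /=; case: pselect => dk; [right|left].
have en_le_d k : ole (en k) (d k).
  case: k => [|k] /=; first by left.
  case: pselect => /= dk; first by left.
  by have [//|<-|] := olt_total (d k) (en k.+1); [left|right].
have [u [ul uc]] := aut_limit_direct_limit dX (fun k => Ql (dS k) (dw k.+1)).
have dmono v k l : ole v (d k) -> (k <= l)%N -> ole v (d l).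
  move=> vk; elim: l => [|l IH]; first by rewrite leqn0 => /eqP <-.
  rewrite leq_eqVlt => /predU1P[<-//|]; rewrite ltnS => /IH vl.
  exact: ole_trans vl (dS l).
have uQ v k l x : ole v (d k) -> (k <= l)%N -> u l (Q v (d l) x) = u k (Q v (d k) x).
  move=> vk; elim: l => [|l IH]; first by rewrite leqn0 => /eqP <-.
  rewrite leq_eqVlt => /predU1P[<-//|]; rewrite ltnS => kl; rewrite -IH // -(uc l) Qc //.
  exact: dmono vk kl.
have /choice[k kP] : forall v, exists k, olt v w -> ole v (d k).
  by move=> v; have [/enP[k <-]|] := pselect (olt v w); [exists k|exists 0%N].
(* Composing last with [f] keeps every map into [w] from being onto. The choice of the index [k v]
   does not matter, by [uQ]. *)
exists (fun v x => f (u (k v) (Q v (d (k v)) x))) => v vw; split.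
  exists (u (k v) \o Q v (d (k v))); split => //.
  by apply: aut_limit_comp (ul _) _; apply: Ql => //; exact: kP.
move=> s sv x; congr f; have sw := olt_trans sv vw.
pose l := maxn (k v) (k s).
rewrite -(uQ v (k v) l) ?leq_maxl //; last exact: kP.
rewrite -(uQ s (k s) l) ?leq_maxr //; last exact: kP.
rewrite -(with_id_lt P sv) Qc //; first exact: olt_ole.
by apply: dmono (kP _ vw) _; exact: leq_maxl.
Qed.

End Extension.

Lemma coherent_system_exists (X : nat -> A) (f : A -> A) : dense (range X) ->
  aut_limit f -> (exists y, forall x, f x <> y) -> inhabited coherent_system.
Proof.
move=> dX fl [y0 fy0].
(* [row w v] is the map from stage [v] to stage [w]: the target comes first, so that one recursion
   step chooses all maps into [w] at once. *)
pose good w (row : omega1 -> omega1 -> A -> A) (r : omega1 -> A -> A) :=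
  forall v, olt v w -> (exists r', aut_limit r' /\ forall x, r v x = f (r' x)) /\
    forall u, olt u v -> forall x, r v (row v u x) = r u x.
have [w P P' r PP' g v vw|row rowP] := @olt_recursion _ (fun _ : omega1 => id : A -> A) good.
  by rewrite /good -PP' //; exact: g.
have rowG w : good w row (row w).
  elim/(well_founded_ind olt_wf): w => w IH; apply: rowP.
  apply: (@extend_system w (fun u v => row v u) _ _ X f dX fl) => [u v uv vw|s u v x su uv vw].
    have [[r' [r'l rE]] _] := IH v vw u uv.
    have -> : row v u = f \o r' by apply/funext.
    exact: (aut_limit_comp fl r'l).
  by have [_ h] := IH v vw u uv; exact: h.
pose F := with_id (fun u v => row v u).
have Fl v w : ole v w -> aut_limit (F v w).
  move=> [<-|vw]; first by rewrite /F with_id_refl; exact: aut_limit_id.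
  rewrite /F with_id_lt //; have [[r' [r'l rE]] _] := rowG w v vw.
  have -> : row w v = f \o r' by apply/funext.
  exact: (aut_limit_comp fl r'l).
split; apply: (@CoherentSystem F) => //.
- by move=> v x; rewrite /F with_id_refl.
- move=> u v w x [->|uv]; first by rewrite /F with_id_refl.
  move=> [<-|vw]; first by rewrite /F with_id_refl.
  rewrite /F !with_id_lt //; last exact: olt_trans vw.
  by have [_ h] := rowG w v vw; exact: h.
- move=> v w vw; exists y0 => x; rewrite /F with_id_lt //.
  by have [[r' [_ ->]] _] := rowG w v vw; exact: fy0.
Qed.

End CoherentSystem.
(** * The direct limit of a coherent system *)

Section Colimit.
Variables (R : realType) (L : signature R) (A : structure L) (S : coherent_system A).

(* Instead of forming a quotient, represent a point of the direct limit by its first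
   occurrence, which is unique. *)
Record colimit := Colimit {
  stage : omega1;
  germ : A;
  first_stage : forall v x, olt v stage -> S v stage x <> germ }.

Lemma colimit_eq (p q : colimit) : stage p = stage q -> germ p = germ q -> p = q.
Proof.
case: p q => [v x vx] [w y wy] /= vw xy; subst w y.
by congr Colimit; exact: Prop_irrelevance.
Qed.

HB.instance Definition _ := gen_eqMixin colimit.
HB.instance Definition _ := gen_choiceMixin colimit.

Lemma trans_isometric v w : ole v w -> isometric (S v w).
Proof. by move=> vw; exact/aut_limit_isometric/trans_limit. Qed.

Definition omax (v w : omega1) := if pselect (ole v w) then w else v.

Lemma ole_omaxl v w : ole v (omax v w).
Proof. by rewrite /omax; case: pselect => //= _; exact: ole_refl. Qed.

Lemma ole_omaxr v w : ole w (omax v w).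
Proof.
rewrite /omax; case: pselect => //= vw; first exact: ole_refl.
by have [] := ole_total v w.
Qed.

Definition colimit_dist (p q : colimit) : R :=
  let w := omax (stage p) (stage q) in
  mdist (S (stage p) w (germ p)) (S (stage q) w (germ q)).

Lemma colimit_distE (p q : colimit) w : ole (stage p) w -> ole (stage q) w ->
  colimit_dist p q = mdist (S (stage p) w (germ p)) (S (stage q) w (germ q)).
Proof.
move=> pw qw; rewrite /colimit_dist; set m := omax _ _.
have pm : ole (stage p) m by exact: ole_omaxl.
have qm : ole (stage q) m by exact: ole_omaxr.
have mw : ole m w by rewrite /m /omax; case: pselect.
by rewrite -(trans_isometric mw) !trans_comp.
Qed.

Lemma colimit_distxx p : colimit_dist p p = 0.
Proof. exact: mdistxx. Qed.

Lemma colimit_dist_sym p q : colimit_dist p q = colimit_dist q p.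
Proof.
have pm := ole_omaxl (stage p) (stage q); have qm := ole_omaxr (stage p) (stage q).
by rewrite (colimit_distE pm qm) (colimit_distE qm pm) metric_sym.
Qed.

Lemma colimit_dist_triangle q p r :
  colimit_dist p r <= colimit_dist p q + colimit_dist q r.
Proof.
pose w := omax (stage p) (omax (stage q) (stage r)).
have pw : ole (stage p) w by exact: ole_omaxl.
have qw : ole (stage q) w by apply: ole_trans (ole_omaxr _ _); exact: ole_omaxl.
have rw : ole (stage r) w by apply: ole_trans (ole_omaxr _ _); exact: ole_omaxr.
by rewrite (colimit_distE pw rw) (colimit_distE pw qw) (colimit_distE qw rw) metric_triangle.
Qed.

(** At distance 0 the germ at the earlier stage maps to the germ at the later one. By [first_stage]
    the stages cannot differ, and then the germs agree. *)
Lemma colimit_dist_eq0 p q : colimit_dist p q = 0 -> p = q.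
Proof.
have [pq|] := ole_total (stage p) (stage q); last first.
  move=> qp; rewrite colimit_dist_sym (colimit_distE qp (ole_refl _)) trans_id.
  move=> /mdist_positivity qpE; case: qp => [qp|/(@first_stage p)/(_ qpE)//].
  by apply: colimit_eq => //; rewrite -qpE qp trans_id.
rewrite (colimit_distE pq (ole_refl _)) trans_id.
move=> /mdist_positivity pqE; case: pq => [pq|/(@first_stage q)/(_ pqE)//].
by apply: colimit_eq => //; rewrite -pqE pq trans_id.
Qed.

HB.instance Definition _ := isMetric.Build R colimit
  colimit_distxx colimit_dist_eq0 colimit_dist_sym colimit_dist_triangle.

Lemma colimit_mdist (p q : colimit) : mdist p q = colimit_dist p q.
Proof. by []. Qed.

Lemma inclusion_ex w x : exists p : colimit, ole (stage p) w /\ S (stage p) w (germ p) = x.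
Proof.
have [|v [vw [y yx]] vP] := @olt_min [set v | ole v w /\ exists y, S v w y = x].
  by exists w; split; [exact: ole_refl|exists x; rewrite trans_id].
have first u z : olt u v -> S u v z <> y.
  move=> uv uz; have uw : ole u w by exact: ole_trans (olt_ole uv) vw.
  have [|uE|vu] := vP u; last 2 first.
  - by move: uv; rewrite uE => /olt_irr.
  - exact: (@olt_irr u (olt_trans uv vu)).
  by split=> //; exists z; rewrite -yx -uz trans_comp //; exact: olt_ole.
by exists (Colimit first).
Qed.

Definition inclusion w x : colimit := projT1 (cid (inclusion_ex w x)).

Lemma inclusionP w x : ole (stage (inclusion w x)) w /\
  S (stage (inclusion w x)) w (germ (inclusion w x)) = x.
Proof. by rewrite /inclusion; case: cid. Qed.

Lemma inclusion_isometric w : isometric (inclusion w).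
Proof.
move=> x y; have [xw xE] := inclusionP w x; have [yw yE] := inclusionP w y.
by rewrite colimit_mdist (colimit_distE xw yw) xE yE.
Qed.

Lemma inclusion_trans v w x : ole v w -> inclusion w (S v w x) = inclusion v x.
Proof.
move=> vw; have [aw aE] := inclusionP w (S v w x); have [bv bE] := inclusionP v x.
apply: mdist_positivity; rewrite colimit_mdist (colimit_distE aw (ole_trans bv vw)).
by rewrite aE -(trans_comp _ _ bv vw) bE mdistxx.
Qed.

Lemma inclusion_stage p : inclusion (stage p) (germ p) = p.
Proof.
have [aw aE] := inclusionP (stage p) (germ p).
by apply: mdist_positivity; rewrite colimit_mdist (colimit_distE aw (ole_refl _)) aE trans_id
  mdistxx.
Qed.

Lemma inclusion_above p w : ole (stage p) w -> p = inclusion w (S (stage p) w (germ p)).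
Proof. by move=> pw; rewrite inclusion_trans // inclusion_stage. Qed.

Lemma inclusion_seq (u : nat -> colimit) : exists w (y : nat -> A), u = inclusion w \o y.
Proof.
have [w wP] := countable_omega1_bounded (fun n => stage (u n)).
exists w, (fun n => S (stage (u n)) w (germ (u n))); apply/funext => n /=.
exact/inclusion_above/olt_ole.
Qed.

Lemma inclusion_tuple k (u : 'I_k -> colimit) v :
  exists w (y : 'I_k -> A), ole v w /\ u = fun i => inclusion w (y i).
Proof.
have [w wP] := countable_omega1_bounded
  (fun n => if insub n is Some i then stage (u i) else v).
have uw i : olt (stage (u i)) w by have := wP (i : nat); rewrite valK.
exists w, (fun i => S (stage (u i)) w (germ (u i))); split.
  (* The index [k] lies just outside the tuple and reads the default [v], so the common bound is
     also above [v]. *)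
  by have := wP k; rewrite insubF ?ltnn // => /olt_ole.
by apply/funext => i; exact/inclusion_above/olt_ole.
Qed.

Lemma inclusion_tuple2 k (a b : 'I_k -> colimit) :
  exists w (y z : 'I_k -> A), a = (fun i => inclusion w (y i)) /\ b = fun i => inclusion w (z i).
Proof.
have [v [y [_ ay]]] := inclusion_tuple a ozero.
have [w [z [vw bz]]] := inclusion_tuple b v.
exists w, (fun i => S v w (y i)), z; split=> //; rewrite ay.
by apply/funext => i; rewrite inclusion_trans.
Qed.

(** A sequence meets only countably many stages, so it lies in a single copy of [A], which is
    complete. *)
Lemma colimit_complete : complete_space colimit.
Proof.
apply: seq_complete => u; have [w [y ->]] := inclusion_seq u => cu.
have [|x yx] := @complete_seq_cvg _ _ y (@carrier_complete R L A).
  by move=> e /cu[N NP]; exists N => i j Ni Nj; rewrite -(inclusion_isometric w); exact: NP.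
exists (inclusion w x) => e /yx; apply: filterS => n /=.
by rewrite inclusion_isometric.
Qed.

Lemma inclusion_eq_trans k v w (y z : 'I_k -> A) :
  (fun i => inclusion v (y i)) = (fun i => inclusion w (z i)) ->
  let m := omax v w in (fun i => S v m (y i)) = (fun i => S w m (z i)).
Proof.
move=> yz m; apply/funext => i; apply: (isometric_inj (@inclusion_isometric m)).
rewrite !inclusion_trans; [|exact: ole_omaxr|exact: ole_omaxl].
exact: (congr1 (fun f => f i) yz).
Qed.

Variable Omega : (nat -> R) -> \bar R.
Hypothesis hO : universal_weak_modulus L Omega.

Lemma trans_embedding v w : ole v w -> embedding (S v w).
Proof. by move=> vw; exact/(aut_limit_embedding hO)/trans_limit. Qed.

Definition colimit_fint F (x : 'I_(farity F) -> colimit) : colimit :=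
  let w := projT1 (cid (inclusion_tuple x ozero)) in
  inclusion w (fint (projT1 (cid (projT2 (cid (inclusion_tuple x ozero)))))).

Definition colimit_rint P (x : 'I_(rarity P) -> colimit) : R :=
  rint (projT1 (cid (projT2 (cid (inclusion_tuple x ozero))))).

(** The definition chooses some stage containing the arguments. Two choices are compared at a common
    later stage, where the linking maps commute with [F]. *)
Lemma colimit_fintE w F (y : 'I_(farity F) -> A) :
  colimit_fint (fun i => inclusion w (y i)) = inclusion w (fint y).
Proof.
rewrite /colimit_fint; case: cid => v /= e; case: cid => z /= [_ yz].
have := inclusion_eq_trans yz; set m := omax w v => /= yzm.
have wm : ole w m by exact: ole_omaxl.
have vm : ole v m by exact: ole_omaxr.
rewrite -(inclusion_trans _ wm) -(inclusion_trans _ vm).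
have [_ wF _] := trans_embedding wm; have [_ vF _] := trans_embedding vm.
by rewrite wF vF yzm.
Qed.

Lemma colimit_rintE w P (y : 'I_(rarity P) -> A) :
  colimit_rint (fun i => inclusion w (y i)) = rint y.
Proof.
rewrite /colimit_rint; case: cid => v /= e; case: cid => z /= [_ yz].
have := inclusion_eq_trans yz; set m := omax w v => /= yzm.
have wm : ole w m by exact: ole_omaxl.
have vm : ole v m by exact: ole_omaxr.
have [_ _ wP] := trans_embedding wm; have [_ _ vP] := trans_embedding vm.
by have := wP (Some P) y; have := vP (Some P) z; rewrite /= yzm => -> ->.
Qed.

Lemma colimit_fint_respects F (x y : 'I_(farity F) -> colimit) :
  mdist (colimit_fint x) (colimit_fint y) <= fmod (fun i => mdist (x i) (y i)).
Proof.
have [w [a [b [-> ->]]]] := inclusion_tuple2 x y.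
rewrite !colimit_fintE inclusion_isometric; under eq_fun do rewrite inclusion_isometric.
exact: fint_respects.
Qed.

Lemma colimit_rint_bound P (x : 'I_(rarity P) -> colimit) :
  (rbound P).1 <= colimit_rint x <= (rbound P).2.
Proof. exact: rint_bound. Qed.

Lemma colimit_rint_respects P (x y : 'I_(rarity P) -> colimit) :
  `|colimit_rint x - colimit_rint y| <= rmod (fun i => mdist (x i) (y i)).
Proof.
have [w [a [b [-> ->]]]] := inclusion_tuple2 x y.
rewrite !colimit_rintE; under eq_fun do rewrite inclusion_isometric.
exact: rint_respects.
Qed.

Lemma colimit_dint_bound (x y : colimit) : (dbound L).1 <= mdist x y <= (dbound L).2.
Proof. exact: dint_bound. Qed.

Definition colimit_structure : structure L := @Structure R L colimit colimit_complete
  colimit_fint colimit_fint_respects colimit_rint colimit_rint_bound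
  colimit_rint_respects colimit_dint_bound.

Lemma inclusion_embedding w : @embedding R L A colimit_structure (inclusion w).
Proof.
split=> [|F x|[P|] x]; first exact: inclusion_isometric.
- by rewrite /fint /= colimit_fintE.
- by rewrite /= /rint /= colimit_rintE.
- exact: inclusion_isometric.
Qed.

(** A countable dense set would lie in one copy of [A]. That copy is closed, so it would already
    contain the next one, against [trans_strict]. *)
Lemma colimit_not_separable : ~ separable colimit_structure.
Proof.
move=> [D [cD dD]].
have [p0 Dp0] : exists p, D p.
  have [v _] := @olt_min setT (ex_intro _ ozero I).
  have [y _] := trans_strict S (osuccP ozero).1.
  have [z Dz _] := dense_approx (inclusion ozero y : colimit_structure) dD (ltr01 : 0 < 1 :> R).
  by exists z.
have [X [DX XD]] := countable_enumeration cD Dp0.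
have [w [y Xy]] := inclusion_seq X.
have [z zP] := trans_strict S (osuccP w).1.
have wS : ole w (osucc w) by apply: olt_ole; exact: (osuccP w).1.
have [|x xE] := isometric_complete_range (y := inclusion (osucc w) z)
    (@carrier_complete R L A) (@inclusion_isometric w).
  move=> e e0; have [q Dq zq] := dense_approx (inclusion (osucc w) z : colimit_structure) dD e0.
  by have [j jq] := XD q Dq; exists (y j);
    rewrite -[inclusion w (y j)]/((inclusion w \o y) j) -Xy jq.
apply: (zP x); apply: (isometric_inj (@inclusion_isometric (osucc w))).
by rewrite inclusion_trans.
Qed.

End Colimit.

(** * Values of Scott formulas in the direct limit *)

Section Transfer.
Variables (R : realType) (L : signature R) (A : structure L).

Lemma aut_eval n (p : formula L n) (g : aut A) (a : 'I_n -> A) :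
  Defs.eval p (fun i => g (a i)) = Defs.eval p a.
Proof.
elim: p a => {n} [n p|n m f fc p IH|n p IH|n p IH|n K cK J p IH|n K cK J p IH] a.
- exact: (embedding_basic (aut_embedding g) p a).
- by rewrite /=; congr f; apply/funext => i; exact: IH.
- rewrite /=; congr sup_in; apply/seteqP; split=> _ [c _ <-] /=.
    exists (aut_inv_fun g c) => //.
    by rewrite -(IH (snoc a (aut_inv_fun g c))) (snoc_comp g) aut_inv_funK.
  by exists (g c) => //; rewrite -(snoc_comp g) IH.
- rewrite /=; congr inf_in; apply/seteqP; split=> _ [c _ <-] /=.
    exists (aut_inv_fun g c) => //.
    by rewrite -(IH (snoc a (aut_inv_fun g c))) (snoc_comp g) aut_inv_funK.
  by exists (g c) => //; rewrite -(snoc_comp g) IH.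
- by rewrite /=; congr sup_in; apply: eq_imagel => k _; exact: IH.
- by rewrite /=; congr inf_in; apply: eq_imagel => k _; exact: IH.
Qed.

Lemma eq_le_iff (x y : R) : (forall t, x <= t <-> y <= t) -> x = y.
Proof.
by move=> xy; apply/eqP; rewrite eq_le; apply/andP; split; apply/xy.
Qed.

Lemma eq_ge_iff (x y : R) : (forall t, t <= x <-> t <= y) -> x = y.
Proof.
by move=> xy; apply/eqP; rewrite eq_le; apply/andP; split; apply/xy.
Qed.

Variable Omega : (nat -> R) -> \bar R.
Hypothesis hO : universal_weak_modulus L Omega.
Let wO := universal_is_weak hO.

(** Near the finite tuple [a] the map is an automorphism up to [d]: invariance is exact for the
    automorphism, and the modulus absorbs the rest. *)
Lemma aut_limit_eval n (p : formula L n) (f : A -> A) (a : 'I_n -> A) :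
  scott_like Omega p -> aut_limit f -> Defs.eval p (fun i => f (a i)) = Defs.eval p a.
Proof.
move=> sp fl; apply/eqP; rewrite eq_le; apply/andP; split; apply/ler_addgt0Pr => e e0.
all: have [d d0 dP] := wrestrict_small wO n e0; have [g gP] := fl _ a d d0.
all: rewrite -(aut_eval p g a); apply: (scott_like_continuous wO sp); apply: dP => i.
all: try exact: mdist_ge0.
  exact/ltW/gP.
by rewrite metric_sym; exact/ltW/gP.
Qed.

Variable S : coherent_system A.
Local Notation B := (colimit_structure S hO).
Local Notation iota := (inclusion S).

Lemma snoc_inclusion n (a : 'I_n -> A) w (c : B) : exists v (y : A), ole w v /\
  @snoc B n (fun i => iota w (a i)) c = fun i => iota v (snoc (fun i => S w v (a i)) y i).
Proof.
pose v := omax w (stage c); have wv : ole w v by exact: ole_omaxl.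
have cv : ole (stage c) v by exact: ole_omaxr.
exists v, (S (stage c) v (germ c)); split=> //.
rewrite snoc_comp; congr snoc; last exact: inclusion_above.
by apply/funext => i; rewrite inclusion_trans.
Qed.

(** Quantifiers over the direct limit range over elements of later copies of [A]. Those give nothing
    new: moving [a] to the later copy by a linking map does not change the value of the quantified
    formula, and its witnesses there are elements of [A]. *)
Lemma inclusion_eval n (p : formula L n) : scott_like Omega p ->
  forall w (a : 'I_n -> A), Defs.eval (A := B) p (fun i => iota w (a i)) = Defs.eval p a.
Proof.
elim=> {n p}.
- move=> n K cK p c p01 c01 w a; rewrite /=; congr sup_in; apply: eq_imagel => k _.
  congr `|_ - _|.
  exact (@embedding_basic R L A (colimit_structure S hO) _ (@inclusion_embedding R L A S Omega hO
    w) n (p k) a).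
- by move=> n p q _ pP _ qP w a; rewrite !eval_Fmax pP qP.
- move=> n p sp pP w a; apply: eq_le_iff => t.
  rewrite !(scott_like_sup_le _ _ sp); split=> -[t0 pt]; split=> // c.
    by rewrite -(pP w) snoc_comp; exact: pt.
  have [v [y [wv ->]]] := snoc_inclusion a w c; rewrite pP.
  have : Defs.eval (Fsup p) (fun i => S w v (a i)) <= t.
    rewrite aut_limit_eval; [|exact: SLsup|exact: trans_limit].
    exact/(scott_like_sup_le _ _ sp).
  by move=> /(scott_like_sup_le _ _ sp)[_]; exact.
- move=> n p sp pP w a; apply: eq_ge_iff => t.
  rewrite !(scott_like_inf_ge _ _ sp); split=> -[t0 pt]; split=> // c.
    by rewrite -(pP w) snoc_comp; exact: pt.
  have [v [y [wv ->]]] := snoc_inclusion a w c; rewrite pP.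
  have : t <= Defs.eval (Finf p) (fun i => S w v (a i)).
    rewrite aut_limit_eval; [|exact: SLinf|exact: trans_limit].
    exact/(scott_like_inf_ge _ _ sp).
  by move=> /(scott_like_inf_ge _ _ sp)[_]; exact.
- move=> n K cK p sp pP w a; rewrite /=; congr sup_in; apply: eq_imagel => k _.
  exact: pP.
- move=> n K cK p sp pP w a; rewrite /=; congr inf_in; apply: eq_imagel => k _.
  exact: pP.
Qed.

End Transfer.

(** * Back-and-forth pseudo-distances of a structure with itself *)

Section BackAndForth.
Variables (R : realType) (L : signature R) (Omega : (nat -> R) -> \bar R).
Hypothesis hO : universal_weak_modulus L Omega.
Variable (A : structure L).
Variable x0 : A.

Let wO := universal_is_weak hO.
Let sO := universal_shift hO.

Local Notation bf w := (@bf R L Omega A A w).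

Lemma bf0 : bf ozero = @bf_zero R L Omega A A.
Proof. exact: transrec0. Qed.

Lemma bfS w : bf (osucc w) = bf_succ (bf w).
Proof. exact: transrecS. Qed.

Lemma bf_limE w : is_limit w ->
  bf w = bf_lim (fun v : {v : omega1 | olt v w} => bf (sval v)).
Proof. by move=> lw; exact: transrec_lim. Qed.

Lemma bf_zero_le n (a b : 'I_n -> A) (t : \bar R) :
  (bf ozero a b <= t)%E <->
  forall p, basic_respects Omega (n:=n) p -> (`|basic_eval p a - basic_eval p b|%:E <= t)%E.
Proof.
rewrite bf0 /bf_zero; split=> [h p pO|h].
  by apply: le_trans h; apply: ereal_sup_ubound; exists p.
by apply: ge_ereal_sup => _ [p [pO ->]]; exact: h.
Qed.

Lemma bf_lim_le w n (a b : 'I_n -> A) (t : \bar R) : is_limit w ->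
  (bf w a b <= t)%E <-> forall v, olt v w -> (bf v a b <= t)%E.
Proof.
move=> lw; rewrite bf_limE // /bf_lim; split=> [h v vw|h].
  by apply: le_trans h; apply: ereal_sup_ubound; exists (exist _ v vw).
by apply: ge_ereal_sup => _ [v _ <-]; apply: h; exact: (svalP v).
Qed.

Lemma bf_succ_le (r : pseudodistance A A) n (a b : 'I_n -> A) (t : \bar R) :
  (bf_succ r a b <= t)%E <-> (0 <= t)%E /\ forall c d : A,
    (ereal_inf [set y : \bar R | exists (c' : A) (d' : A),
      y = Order.max (r n.+1 (snoc a c) (snoc b d'))
                    (r n.+1 (snoc a c') (snoc b d))] <= t)%E.
Proof.
rewrite /bf_succ ge_max; split=> [/andP[t0 h]|[t0 h]].
  by split=> // c d; apply: le_trans h; apply: ereal_sup_ubound; exists c, d.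
by rewrite t0; apply: ge_ereal_sup => _ [c [d ->]]; exact: h.
Qed.

Lemma bf_zero_reindex k n (s : 'I_k -> 'I_n) (a b : 'I_n -> A) : strictly_increasing s ->
  (bf ozero (fun i => a (s i)) (fun i => b (s i)) <= bf ozero a b)%E.
Proof.
move=> si; apply/bf_zero_le => p pO.
have /bf_zero_le/(_ (basic_rename s p)) := lexx (bf ozero a b).
by rewrite !basic_rename_eval; apply; exact: basic_respects_rename.
Qed.

End BackAndForth.
(** * The Scott rank *)

Lemma olt_osucc v w : olt v (osucc w) -> ole v w.
Proof.
move=> vS; have [_ wP] := osuccP w.
have [vw|->|wv] := olt_total v w; [by right|by left|by case: (wP v vS)].
Qed.

Lemma ereal_rat_between (R : realType) (x y : \bar R) : (x < y)%E ->
  exists q : rat, (x < (ratr q)%:E)%E /\ ((ratr q)%:E < y)%E.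
Proof.
have fin (r s : R) : r < s -> exists q : rat, (r%:E < (ratr q)%:E)%E /\ ((ratr q)%:E < s%:E)%E.
  move=> /rat_in_itvoo[q]; rewrite in_itv /= => /andP[rq qs].
  by exists q; rewrite !lte_fin.
case: x y => [r| |] [s| |] //= xy.
- by apply: fin; rewrite -lte_fin.
- have [|q [h1 h2]] := fin r (r + 1); first by rewrite ltrDl.
  by exists q; rewrite ltry.
- have [|q [h1 h2]] := fin (s - 1) s; first by rewrite ltrBlDr ltrDl.
  by exists q; rewrite ltNyr.
- by exists 0; rewrite ltry ltNyr.
Qed.

Section BackAndForth.
Variables (R : realType) (L : signature R) (Omega : (nat -> R) -> \bar R).
Hypothesis hO : universal_weak_modulus L Omega.
Variable (A : structure L).
Variable x0 : A.

Let wO := universal_is_weak hO.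

Local Notation bf w := (@bf R L Omega A A w).

Lemma bf_continuous w n (a a' b b' : 'I_n -> A) (e : R) :
  (wrestrict Omega (fun i => mdist (a i) (a' i)) <= e%:E)%E ->
  (wrestrict Omega (fun i => mdist (b i) (b' i)) <= e%:E)%E ->
  (bf w a b <= bf w a' b' + (e + e)%:E)%E.
Proof.
elim/omega1_ind: w n a a' b b' => [|w IH|w lw IH] n a a' b b' aa bb.
- apply/bf_zero_le => p pO; have /bf_zero_le/(_ p pO) h := lexx (bf ozero a' b').
  apply: le_trans (leeD h (lexx _)); rewrite -EFinD lee_fin.
  have := le_trans (basic_respects_dist a a' pO) aa.
  have := le_trans (basic_respects_dist b b' pO) bb.
  rewrite !lee_fin.
  have := ler_distD (basic_eval p a') (basic_eval p a) (basic_eval p b).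
  have := ler_distD (basic_eval p b') (basic_eval p a') (basic_eval p b).
  by rewrite (distrC (basic_eval p b')); lra.
- rewrite !bfS; apply/bf_succ_le; split.
    apply: adde_ge0; first by rewrite /bf_succ le_max lexx.
    have := wrestrict_mdist_ge0 wO aa; have := wrestrict_mdist_ge0 wO bb.
    by rewrite lee_fin; lra.
  move=> c d; have /bf_succ_le[_ /(_ c d) h] := lexx (bf_succ (bf w) a' b').
  apply: le_trans (leeD h (lexx _)); rewrite -leeBlDr //.
  apply: le_ereal_inf_tmp => _ [c' [d' ->]]; rewrite leeBlDr //.
  apply: (@le_trans _ _ (Order.max (bf w (snoc a c) (snoc b d')) (bf w (snoc a c') (snoc b d)))).
    by apply: ereal_inf_lbound; exists c', d'.
  rewrite ge_max; apply/andP; split.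
    apply: le_trans (IH _ (snoc a c) (snoc a' c) (snoc b d') (snoc b' d') _ _) _.
    + by rewrite wrestrict_mdist_snoc.
    + by rewrite wrestrict_mdist_snoc.
    + by rewrite leeD // le_max lexx.
  apply: le_trans (IH _ (snoc a c') (snoc a' c') (snoc b d) (snoc b' d) _ _) _.
  + by rewrite wrestrict_mdist_snoc.
  + by rewrite wrestrict_mdist_snoc.
  + by rewrite leeD // le_max lexx orbT.
- apply/bf_lim_le => // v vw; apply: le_trans (IH v vw n a a' b b' aa bb) _.
  have /(bf_lim_le _ _ _ _ lw)/(_ v vw) h := lexx (bf w a' b').
  exact: leeD.
Qed.

Lemma bf_succ_mono (r r' : pseudodistance A A) n (a b : 'I_n -> A) :
  (forall m (c d : 'I_m -> A), (r m c d <= r' m c d)%E) ->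
  (bf_succ r a b <= bf_succ r' a b)%E.
Proof.
move=> rr'; apply/bf_succ_le; split=> [|c d]; first by rewrite /bf_succ le_max lexx.
have /bf_succ_le[_ /(_ c d)] := lexx (bf_succ r' a b); apply: le_trans.
apply: le_ereal_inf_tmp => _ [c' [d' ->]].
apply: (@le_trans _ _ (Order.max (r _ (snoc a c) (snoc b d')) (r _ (snoc a c') (snoc b d)))).
  by apply: ereal_inf_lbound; exists c', d'.
by rewrite ge_max !le_max !rr' orbT.
Qed.

(** At 0, play the dummy move [x0] and forget the last entry. The other cases follow from
    monotonicity of [bf_succ]. *)
Lemma bf_le_succ w n (a b : 'I_n -> A) : (bf w a b <= bf (osucc w) a b)%E.
Proof.
elim/omega1_ind: w n a b => [|w IH|w lw IH] n a b.
- rewrite bfS; have /bf_succ_le[_ /(_ x0 x0)] := lexx (bf_succ (bf ozero) a b).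
  apply: le_trans; apply: le_ereal_inf_tmp => _ [c' [d' ->]]; rewrite le_max.
  apply/orP; left.
  have := bf_zero_reindex hO (snoc a x0) (snoc b d') (@lift_max_increasing n).
  by under eq_fun do rewrite snoc_lift;
    under [X in @Defs.bf _ _ _ _ _ _ _ _ X]eq_fun do rewrite snoc_lift.
- by rewrite !bfS; apply: bf_succ_mono => m c d; rewrite -bfS; exact: IH.
- apply/bf_lim_le => // v vw; apply: (le_trans (IH v vw n a b)); rewrite !bfS.
  apply: bf_succ_mono => m c d.
  by have /(bf_lim_le _ _ _ _ lw)/(_ v vw) := lexx (bf w c d).
Qed.

Lemma bf_mono v w n (a b : 'I_n -> A) : olt v w -> (bf v a b <= bf w a b)%E.
Proof.
elim/omega1_ind: w v => [|w IH|w lw IH] v vw; first by case: (ozeroP vw).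
  have [->|/IH vw'] := olt_osucc vw; first exact: bf_le_succ.
  exact: le_trans vw' (bf_le_succ _ _ _).
by have /(bf_lim_le _ _ _ _ lw)/(_ v vw) := lexx (bf w a b).
Qed.

(** The values increase with [w], so the gaps at different jumps are disjoint, and each contains a
    rational number. *)
Lemma countable_jumps n (a b : 'I_n -> A) :
  countable [set w | bf w a b <> bf (osucc w) a b].
Proof.
have /choice[q qP] : forall w, exists q : rat, bf w a b <> bf (osucc w) a b ->
    (bf w a b < (ratr q)%:E)%E /\ ((ratr q)%:E < bf (osucc w) a b)%E.
  move=> w; have [e|ne] := pselect (bf w a b = bf (osucc w) a b); first by exists 0.
  have [|q qP] := @ereal_rat_between R (bf w a b) (bf (osucc w) a b); last by exists q.
  by rewrite lt_neqAle bf_le_succ andbT; apply/eqP.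
have qlt v w : bf v a b <> bf (osucc v) a b -> bf w a b <> bf (osucc w) a b ->
    olt v w -> q v <> q w.
  move=> /qP[_ v2] /qP[w1 _] vw qvw.
  have vSw : (bf (osucc v) a b <= bf w a b)%E.
    have [Sv|->//|wS] := olt_total (osucc v) w; first exact: bf_mono.
    by case: ((osuccP v).2 w wS).
  by have := lt_le_trans (lt_le_trans v2 vSw) (ltW w1); rewrite qvw ltxx.
apply/countable_injP; exists (pickle \o q) => v w; rewrite !inE => nv nw /=.
move=> /(pcan_inj pickleK) qvw; have [vw|//|wv] := olt_total v w.
  by case: (qlt v w nv nw vw).
by case: (qlt w v nw nv wv).
Qed.

(** Countably many pairs of tuples from [D] have countably many jumps in all, so some [w] below
    omega1 avoids them. Continuity extends stability at [w] from [D] to [A]. *)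
Lemma bf_stable_exists (D : set A) : countable D -> dense D ->
  exists w, bf_stable Omega A w.
Proof.
move=> cD dD; pose T := {n : nat & 'I_n -> {c : A | D c}}.
have cT : countable [set: T] := countable_tuples cD.
pose fst_ (t : T) : 'I_(projT1 t) -> A := fun i => sval (projT2 t i).
(* The second tuple is re-read at the length of the first. All pairs of equal length occur in this
   way, without transport along an equality of lengths. *)
pose snd_ (t s : T) : 'I_(projT1 t) -> A :=
  fun i => if insub (i : nat) is Some j then sval (projT2 s j) else fst_ t i.
pose J (t s : T) := [set w | bf w (fst_ t) (snd_ t s) <> bf (osucc w) (fst_ t) (snd_ t s)].
have [w wJ] : exists w, ~ (\bigcup_t \bigcup_s J t s) w.
  apply: contrapT => n; apply: omega1_uncountable.
  have -> : [set: omega1] = \bigcup_t \bigcup_s J t s.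
    by apply/seteqP; split=> // w _; apply: contrapT => nw; apply: n; exists w.
  apply: bigcup_countable => // t _; apply: bigcup_countable => // s _.
  exact: countable_jumps.
exists w => n a b; apply/eqP; rewrite eq_le bf_le_succ /=.
apply/lee_addgt0Pr => e e0; have e4 : 0 < e / 4 by rewrite divr_gt0.
have [d d0 dP] := wrestrict_small wO n e4.
have /choice[a' a'P] : forall i, exists y, D y /\ mdist (a i) y < d.
  by move=> i; have [y Dy iy] := dense_approx (a i) dD d0; exists y.
have /choice[b' b'P] : forall i, exists y, D y /\ mdist (b i) y < d.
  by move=> i; have [y Dy iy] := dense_approx (b i) dD d0; exists y.
pose t : T := existT _ n (fun i => exist _ (a' i) (a'P i).1).
pose s : T := existT _ n (fun i => exist _ (b' i) (b'P i).1).
have tE : fst_ t = a' by apply/funext.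
have sE : snd_ t s = b' by apply/funext => i; rewrite /snd_ valK.
have ws : bf w a' b' = bf (osucc w) a' b'.
  rewrite -tE -sE; apply: contrapT => nst; apply: wJ.
  by exists t => //; exists s.
have aa : (wrestrict Omega (fun i => mdist (a i) (a' i)) <= (e / 4)%:E)%E.
  by apply: dP => i; [exact: mdist_ge0|exact/ltW/(a'P i).2].
have bb : (wrestrict Omega (fun i => mdist (b i) (b' i)) <= (e / 4)%:E)%E.
  by apply: dP => i; [exact: mdist_ge0|exact/ltW/(b'P i).2].
apply: le_trans (bf_continuous (osucc w) aa bb) _; rewrite -ws.
rewrite (wrestrict_mdist_sym Omega a a') in aa; rewrite (wrestrict_mdist_sym Omega b b') in bb.
apply: le_trans (leeD (bf_continuous w aa bb) (lexx _)) _.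
rewrite -addeA -EFinD leeD // lee_fin; lra.
Qed.

Lemma scott_rank_stable (D : set A) : countable D -> dense D ->
  bf_stable Omega A (scott_rank Omega A).
Proof.
move=> cD dD; rewrite /scott_rank.
have [|w ws wm] := @olt_min (bf_stable Omega A); first exact: bf_stable_exists cD dD.
apply: (proj1 (@xgetPex _ ozero [set w | bf_stable Omega A w /\
  forall v, bf_stable Omega A v -> ~ olt v w] _)).
exists w; split=> // v /wm[->|wv]; first exact: olt_irr.
by move=> vw; apply: (@olt_irr v (olt_trans vw wv)).
Qed.

Lemma bf_xx_le0 w n (a : 'I_n -> A) : (bf w a a <= 0)%E.
Proof.
elim/omega1_ind: w n a => [|w IH|w lw IH] n a.
- by apply/bf_zero_le => p _; rewrite subrr normr0.
- rewrite bfS; apply/bf_succ_le; split=> // c d.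
  apply: (@le_trans _ _ (Order.max (bf w (snoc a c) (snoc a c)) (bf w (snoc a d) (snoc a d)))).
    by apply: ereal_inf_lbound; exists d, c.
  by rewrite ge_max !IH.
- by apply/bf_lim_le => // v vw; exact: IH.
Qed.

Variables (D : set A) (cD : countable D).
Hypothesis dD : dense D.
Variables (E : forall n, set (basic L n)) (cE : forall n, countable (@E n)).
Hypothesis dE : forall n, dense_basic01 Omega (@E n).

Local Notation value := (scott_value cD cE).

(* That is, [value w a b = min(1, bf w a b)]. *)
Lemma value_bf w n (a b : 'I_n -> A) (t : R) : 0 <= t < 1 ->
  value w a b <= t <-> (bf w a b <= t%:E)%E.
Proof.
elim/omega1_ind: w n a b t => [|w IH|w lw IH] n a b t /andP[t0 t1].
- split=> [/(value0_le _ _ dE)[_ h]|h].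
    apply/bf_zero_le => p pO.
    have := h _ (truncate_basic01 (basic_eval p a) pO).
    rewrite !truncate_eval subrr normr0 (min_l ler01) sub0r normrN distrC lee_fin.
    rewrite ger0_norm ?le_min ?normr_ge0 ?ler01 //.
    by rewrite ge_min => /orP[//|]; rewrite leNgt t1.
  apply/(value0_le _ _ dE); split=> // p [pO _]; rewrite -lee_fin.
  by move: h => /bf_zero_le; exact.
- split=> [h|].
    rewrite bfS; apply/bf_succ_le; split=> [|c d]; first by rewrite lee_fin.
    (* [s] lies strictly between [t] and 1, because the induction hypothesis only speaks of
       thresholds below 1. *)
    apply/lee_addgt0Pr => e e0; pose s := Num.min (t + e) ((t + 1) / 2).
    have ts : t < s by rewrite lt_min; apply/andP; split; lra.
    have se : s <= t + e by rewrite ge_min lexx.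
    have s1 : s < 1 by rewrite gt_min; apply/orP; right; lra.
    have s01 : 0 <= s < 1 by apply/andP; split; lra.
    pose u := (s - t) / 2; have u0 : 0 < u by rewrite divr_gt0 // subr_gt0.
    have [r r0 rP] := wrestrict_small wO n.+1 u0.
    have tsu : value (osucc w) a b < t + u by lra.
    have tu1 : t + u <= 1 by rewrite /u; lra.
    (* Scott formulas only challenge with elements of [D], while [bf_succ] ranges over [A]: the
       answer to a nearby [c0] is used for [c]. *)
    have [c0 Dc0 cc0] := dense_approx c dD r0.
    have [d' cd'] := valueS_forth dE tu1 tsu Dc0.
    have [c' Dc' dc'] := valueS_back dE d tu1 tsu.
    apply: (@le_trans _ _ (Order.max (bf w (snoc a c) (snoc b d')) (bf w (snoc a c') (snoc b d)))).
      by apply: ereal_inf_lbound; exists c', d'.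
    apply: (@le_trans _ _ s%:E); last by rewrite -EFinD lee_fin.
    rewrite ge_max; apply/andP; split; apply/(IH _ _ _ _ s01); last by rewrite /u in dc'; lra.
    have : value w (snoc a c) (snoc b d') <= value w (snoc a c0) (snoc b d') + u.
      apply: (value_continuousl cD cE dE wO); apply: rP => i; first exact: mdist_ge0.
      by rewrite /snoc; case: unlift => [j|]; rewrite ?mdistxx ltW.
    by move: cd'; rewrite /u; lra.
  (* [bf_succ] asks for a challenge on both sides at once; [x0] fills the side that is not under
     consideration. *)
  rewrite bfS => /bf_succ_le[_ h]; apply: (valueS_leP dE) => // [c s Dc ts s1|x s ts s1].
    have : (ereal_inf [set y : \bar R | exists (c' : A) (d' : A),
      y = Order.max (bf w (snoc a c) (snoc b d')) (bf w (snoc a c') (snoc b x0))] < ((t + s) /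
        2)%:E)%E.
      by apply: le_lt_trans (h c x0) _; rewrite lte_fin; lra.
    move=> /ereal_inf_lt[_ [c' [d' ->]]]; rewrite gt_max => /andP[/ltW h1 _]; exists d'.
    have h01 : 0 <= (t + s) / 2 < 1 by apply/andP; split; lra.
    by move/(IH _ _ _ _ h01) : h1; lra.
  have : (ereal_inf [set y : \bar R | exists (c' : A) (d' : A),
      y = Order.max (bf w (snoc a x0) (snoc b d')) (bf w (snoc a c') (snoc b x))] < ((t + s) /
        2)%:E)%E.
    by apply: le_lt_trans (h x0 x) _; rewrite lte_fin; lra.
  move=> /ereal_inf_lt[_ [c' [d' ->]]]; rewrite gt_max => /andP[_ /ltW h1].
  have h01 : 0 <= (t + s) / 2 < 1 by apply/andP; split; lra.
  move/(IH _ _ _ _ h01) : h1 => h1.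
  (* Half of the room up to [s] pays for the infimum; a quarter more pays for moving the answer [c']
     into [D]. *)
  have u0 : 0 < (s - t) / 4 by lra.
  have [r r0 rP] := wrestrict_small wO n.+1 u0.
  have [c0 Dc0 cc0] := dense_approx c' dD r0; exists c0 => //.
  have : value w (snoc a c0) (snoc b x) <= value w (snoc a c') (snoc b x) + (s - t) / 4.
    apply: (value_continuousl cD cE dE wO); apply: rP => i; first exact: mdist_ge0.
    by rewrite /snoc; case: unlift => [j|]; [rewrite mdistxx ltW|rewrite metric_sym ltW].
  lra.
- have t01 : 0 <= t < 1 by rewrite t0.
  rewrite (value_lim_le _ _ dE) // bf_lim_le //; split=> [[_ h] v vw|h].
    exact/(IH v vw _ _ _ _ t01)/h.
  by split=> // v vw; exact/(IH v vw _ _ _ _ t01)/h.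
Qed.

End BackAndForth.

(** * Incomplete automorphism group: a nonseparable model of the Scott sentence *)

Section IncompleteToNonseparable.
Variables (R : realType) (L : signature R) (Omega : (nat -> R) -> \bar R).
Hypothesis hO : universal_weak_modulus L Omega.
Variables (A : structure L) (D : set A) (cD : countable D).
Hypothesis dD : dense D.
Variables (E : forall n, set (basic L n)) (cE : forall n, countable (@E n)).
Hypothesis dE : forall n, dense_basic01 Omega (@E n).

Local Notation value := (scott_value cD cE).

Lemma scott_sentence_self (x0 : A) (w := scott_rank Omega A) :
  value w (@tnil A) (@tnil A) = 0 /\
  forall n (a b : 'I_n -> A), value w a b = value (osucc w) a b.
Proof.
have svalP v n (a b : 'I_n -> A) t := value_bf hO x0 cD dD cE dE v a b t.
have t01 : 0 <= (0 : R) < 1 by rewrite lexx ltr01.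
split=> [|n a b].
  apply/eqP; rewrite eq_le (value_ge0 _ _ dE) andbT.
  by apply/svalP => //; exact: bf_xx_le0.
have ws : bf Omega w a b = bf Omega (osucc w) a b.
  exact: (scott_rank_stable hO x0 cD dD).
(* Values lie in [0, 1], so only thresholds [t] in [0, 1) distinguish them, and there they agree
   with the pseudo-distances. *)
apply: eq_le_iff => t; have [t0|t0] := leP 0 t; last first.
  by split=> h; move: (lt_le_trans t0 (le_trans (value_ge0 _ _ dE _ _ _) h)); rewrite ltxx.
have [t1|t1] := ltP t 1; last by split=> _; apply: le_trans t1; exact: (value_le1 _ _ dE).
have {}t01 : 0 <= t < 1 by rewrite t0.
by rewrite !svalP // ws.
Qed.

Lemma incomplete_nonseparable_model : ~ complete_space (aut A) ->
  exists B : structure L, models B (scott_sentence Omega cD cE) /\ ~ separable B.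
Proof.
move=> nc; have [f fl fns] := incomplete_aut_limit hO nc.
have [y fy] : exists y, forall x, f x <> y.
  apply: contrapT => n; apply: fns => y; apply: contrapT => ny; apply: n.
  by exists y => x xy; apply: ny; exists x.
have [x0 Dx0 _] := dense_approx y dD (ltr01 : 0 < 1 :> R).
have [X [DX XD]] := countable_enumeration cD Dx0.
have dX : dense (range X).
  apply: approx_dense => x e e0; have [z Dz xz] := dense_approx x dD e0.
  by have [j jz] := XD z Dz; exists z => //; exists j.
have [S] := coherent_system_exists dX fl (ex_intro _ y fy).
exists (colimit_structure S hO); split; last exact: colimit_not_separable.
have [s0 s1] := scott_sentence_self x0.
(* Every tuple of the direct limit comes from one copy of [A], so both clauses of the sentence
   reduce to their validity in [A]. *)
have sE v n (a b : 'I_n -> A) w :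
    value v a (fun i => inclusion S w (b i) : colimit_structure S hO) = value v a b.
  by apply: inclusion_eval; exact: scott_formula_like.
apply/(models_scott_sentence cD cE dE); split.
  rewrite -s0 -(sE _ _ _ _ ozero).
  by congr scott_value; exact: tuple0_eq.
move=> n a b _; have [w [c [_ ->]]] := inclusion_tuple b ozero.
by rewrite !sE s1.
Qed.

End IncompleteToNonseparable.

Theorem theorem1p6 (R : realType) (L : signature R)
    (hL : countable_signature L)
    (Omega : (nat -> R) -> \bar R) (hO : universal_weak_modulus L Omega)
    (A : structure L) (hA : separable A)
    (D : set A) (cD : countable D) (dD : dense D)
    (E : forall n : nat, set (basic L n)) (cE : forall n : nat, countable (E n))
    (dE : forall n : nat, dense_basic01 Omega (E n)) :
  (forall B : structure L, models B (scott_sentence Omega cD cE) -> separable B) <->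
  complete_space (aut A).
Proof.
split=> [sep|cA B]; last exact: (complete_models_separable hO dD dE).
apply: contrapT => nc; have [B [mB nB]] := incomplete_nonseparable_model hO cD dD cE dE nc.
exact/nB/sep.
Qed.
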